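(* Let $\alpha\in(0,1]$, $N:=\lfloor1/\alpha\rfloor$, $\beta\in(\frac1\alpha-N,1]$, $T>0$, let $\mathbb X$ be an $\alpha$-branched rough path lift on $[0,T]$ of $X\in\mathcal C^\alpha([0,T],\mathbb R^d)$ and let $\sigma=(\sigma_1,\dots,\sigma_d)\in C^{N-1}(\mathbb R^n,\mathbb R^n\otimes(\mathbb R^d)^* )$. Assume that $\Upsilon_\tau$ is globally Lipschitz continuous for all $\tau\in\mathcal T^{\le N-1}$ and that $\Upsilon_\tau$ is globally $\beta$-H\''older continuous for all $\tau\in\mathcal T^{=N}$. Then: (i) for every $\mu>0$ and every Davie solution $Z$, $$\|Z^{[N+1]}\|_{(N+\beta)\alpha,\mu}\lesssim_{\mathbb X,\sigma,T}(1\vee\|Z^{[1]}\|_{\alpha,\mu})+\sum_{\ell=2}^{N}\|Z^{[\ell]}\|_{\ell\alpha,\mu};$$ (ii) if either $T$ or $\mu$ is sufficiently small, i.e. if $T\wedge\mu\le\varepsilon_0$ for some $\varepsilon_0>0$ depending only on $\alpha,\beta,\sigma$ and $\mathbb X$ (on $\mathbb X$ only through the numbers $\|\mathbb X(\tau)\|_{|\tau|\alpha}$, $\tau\in\mathcal T^{\le N}$), then every Davie solution $Z$ satisfies $$(1\vee\|Z^{[1]}\|_{\alpha,\mu})+\sum_{i=2}^N\|Z^{[i]}\|_{i\alpha,\mu}\le2\Big[\Big(1\vee\sum_{i=1}^d|\Upsilon_{\bullet_i}(Z_0)|\,\|\mathbb X(\bullet_i)\|_\alpha\Big)+\sum_{\tau\in\mathcal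 T^{\le N},\,|\tau|\ge2}|\tau|\,|\Upsilon_\tau(Z_0)|\,\|\mathbb X(\tau)\|_{|\tau|\alpha}\Big];$$ (iii) if moreover $\beta=1$, i.e. $\Upsilon_\tau$ is globally Lipschitz continuous for all $\tau\in\mathcal T^{\le N}$, then, if either $T$ or $\mu$ is small enough (in the same sense as in (ii)), every Davie solution $Z$ satisfies $$\sum_{i=1}^N\|Z^{[i]}\|_{i\alpha,\mu}\le2\sum_{\tau\in\mathcal T^{\le N}}|\tau|\,|\Upsilon_\tau(Z_0)|\,\|\mathbb X(\tau)\|_{|\tau|\alpha}.$$
   Context: $a\vee b=\max(a,b)$, $a\wedge b=\min(a,b)$; $A\lesssim_{\mathbb X,\sigma,T}B$ means $A\le cB$ with $c$ depending only on $\mathbb X,\sigma,T$ (and $\alpha,\beta,n,d$), not on $Z$ or $\mu$. Trees. $\mathcal T$ is the set of finite non-planar rooted trees with vertices decorated by $\{1,\dots,d\}$; $|\tau|$ is the number of vertices. $\mathcal F$ is the set of forests, i.e. finite commutative products (multisets) of trees, including the empty forest $\mathbf 1$; $|w|$ is the total number of vertices. $\mathcal T^{\le m},\mathcal T^{=m},\mathcal F^{\le m}$ are the subsets of elements with at most, resp. exactly, $m$ vertices. $[w]_i$ is the tree obtained by joining the roots of the trees of $w$ to a new root decorated by $i$; $\bullet_i=[\mathbf 1]_i$. If $w=\tau_1^{n_1}\cdots\tau_k^{n_k}$ with distinct $\tau_i$, $\pi(w):=\prod_i n_i!$. Grafting. $\tau\curvearrowright\mathbf 1=0$, $\tau\curvearrowright[w]_i=[\tau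 w+\tau\curvearrowright w]_i$, $\tau\curvearrowright(\tau_1\cdots\tau_k)=\sum_i\tau_1\cdots(\tau\curvearrowright\tau_i)\cdots\tau_k$ (extended linearly), and (Guin-Oudom) $\mathbf 1\curvearrowright\tau=\tau$, $(\tau_1\cdots\tau_k)\curvearrowright\tau=\tau_1\curvearrowright((\tau_2\cdots\tau_k)\curvearrowright\tau)-(\tau_1\curvearrowright(\tau_2\cdots\tau_k))\curvearrowright\tau$. Elementary differentials. $\Upsilon_{\bullet_j}=\sigma_j:\mathbb R^n\to\mathbb R^n$ and $\Upsilon_{[\tau_1\cdots\tau_k]_j}=\sum_{i_1,\dots,i_k}\partial_{i_1}\cdots\partial_{i_k}\sigma_j\,\Upsilon_{\tau_1}^{i_1}\cdots\Upsilon_{\tau_k}^{i_k}$; defined for $|\tau|\le N$ when $\sigma\in C^{N-1}$. Branched rough path. A family of maps $\mathbb X_{st}:\mathcal F^{\le N}\to\mathbb R$, $0\le s\le t\le T$, with $\mathbb X_{st}(\mathbf 1)=1$, $\mathbb X_{st}(\tau_1\cdots\tau_k)=\prod_i\mathbb X_{st}(\tau_i)$, $|\mathbb X_{st}(\tau)|\lesssim|t-s|^{|\tau|\alpha}$ uniformly for $\tau\in\mathcal T^{\le N}$, and Chen's relation, which (by multiplicativity) reads: for $s\le u\le t$, $\tau\in\mathcal T^{\le N}$, $\mathbb X_{st}(\tau)=\mathbb X_{su}(\tau)+\sum_{w\in\mathcal F,\rho\in\mathcal T}\frac{\mathbb X_{su}(w)}{\pi(w)}\mathbb X_{ut}(\rho)\langle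 w\curvearrowright\rho,\tau\rangle$, where $\langle w\curvearrowright\rho,\tau\rangle$ is the coefficient of $\tau$ in $w\curvearrowright\rho$. It is a lift of $X$ if $\mathbb X_{st}(\bullet_i)=X^i_t-X^i_s$. Davie solution: a map $Z:[0,T]\to\mathbb R^n$ with $Z_t-Z_s-\sum_{\tau\in\mathcal T^{\le N}}\Upsilon_\tau(Z_s)\mathbb X_{st}(\tau)=o(t-s)$ uniformly for $0\le s\le t\le T$. Solution remainders: $Z^{[m+1]}_{st}:=Z_t-Z_s-\sum_{\tau\in\mathcal T^{\le m}}\Upsilon_\tau(Z_s)\mathbb X_{st}(\tau)$, $m\ge0$. Norms. For $F$ on $\{0\le s\le t\le T\}$: $\|F\|_\eta=\sup_{0\le s<t\le T}|F_{st}|/(t-s)^\eta$ and $\|F\|_{\eta,\mu}=\sup_{0\le s<t\le T,\ t-s\le\mu}e^{-t/\mu}|F_{st}|/(t-s)^\eta$. *)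

(* Defs.v *)
From HB Require Import structures.
From mathcomp Require Import all_boot all_order all_algebra.
From mathcomp Require Import finmap multiset freeg.
From mathcomp Require Import all_classical all_reals all_analysis.

Set Implicit Arguments.
Unset Strict Implicit.
Unset Printing Implicit Defensive.
Import Order.TTheory GRing.Theory Num.Theory.
Import numFieldNormedType.Exports.
Local Open Scope classical_set_scope.
Local Open Scope ring_scope.

(** A non-planar tree is represented by its canonical planar embedding: the one
   in which, at every vertex, the list of subtrees is sorted for a fixed total
   order.  The lemmas [root_node], [branches_node] and [node_root_branches]
   say that (i, w) |-> [w]_i is a bijection between decorations paired with
   multisets of trees, and trees. *)

Section PlanarTrees.
Variable d : nat.

Inductive ptree := PNode of 'I_d & seq ptree.

Definition proot (t : ptree) := let: PNode i _ := t in i.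
Definition pbranches (t : ptree) := let: PNode _ s := t in s.

Lemma ptree_ind_foldr (P : ptree -> Prop) :
  (forall i s, foldr (fun t => and (P t)) True s -> P (PNode i s)) ->
  forall t, P t.
Proof.
move=> IH; fix rec 1 => -[i s]; apply: IH.
by elim: s => [|u s IHs] /=; [exact: I|split; [exact: rec|exact: IHs]].
Qed.

Fixpoint ptree_code (t : ptree) : GenTree.tree 'I_d :=
  let: PNode i s := t in GenTree.Node 0 (GenTree.Leaf i :: map ptree_code s).

Fixpoint ptree_decode (g : GenTree.tree 'I_d) : option ptree :=
  if g is GenTree.Node _ (GenTree.Leaf i :: s) then
    Some (PNode i (pmap ptree_decode s))
  else None.

Lemma ptree_codeK : pcancel ptree_code ptree_decode.
Proof.
elim/ptree_ind_foldr => i s IH /=; congr (Some (PNode i _)).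
by elim: s IH => //= t s IHs [-> /IHs ->].
Qed.

HB.instance Definition _ := Countable.copy ptree (pcan_type ptree_codeK).

Lemma ptree_ind' (P : ptree -> Prop) :
  (forall i s, {in s, forall t, P t} -> P (PNode i s)) -> forall t, P t.
Proof.
move=> IH; elim/ptree_ind_foldr => i s Ps; apply: IH.
elim: s Ps => //= t s IHs [Pt /IHs Ps] u; rewrite inE => /predU1P[->//|].
exact: Ps.
Qed.

Fixpoint psize (t : ptree) : nat :=
  let: PNode _ s := t in (sumn (map psize s)).+1.

Definition ple : rel ptree := fun t u => (choice.pickle t <= choice.pickle u)%N.

Fixpoint canon (t : ptree) : ptree :=
  let: PNode i s := t in PNode i (sort ple (map canon s)).

Lemma ple_total : total ple. Proof. by move=> t u; exact: leq_total. Qed.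
Lemma ple_trans : transitive ple. Proof. by move=> t u v; exact: leq_trans. Qed.
Lemma ple_anti : antisymmetric ple.
Proof.
by move=> t u /anti_leq /(congr1 (@choice.unpickle ptree)); rewrite !choice.pickleK => -[].
Qed.

Lemma canonK t : canon (canon t) == canon t.
Proof.
apply/eqP; elim/ptree_ind': t => i s IH /=; congr PNode.
rewrite (@map_id_in _ canon); last first.
  by move=> t; rewrite mem_sort => /mapP[u us ->]; exact: IH.
by rewrite sorted_sort ?sort_sorted //; [exact: ple_trans|exact: ple_total].
Qed.

Record tree := Tree { ptree_of_tree :> ptree; _ : canon ptree_of_tree == ptree_of_tree }.
HB.instance Definition _ := [isSub for ptree_of_tree].
HB.instance Definition _ := [Countable of tree by <:].

Definition mk_tree (t : ptree) : tree := Tree (canonK t).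

Lemma mk_treeK (tau : tree) : mk_tree tau = tau.
Proof. by apply: val_inj => /=; case: tau => t /= /eqP. Qed.

End PlanarTrees.

Notation forest d := {mset tree d}%mset.

Section Trees.
Variable d : nat.
Implicit Types (tau rho : tree d) (w : forest d).

Definition tree_size tau : nat := psize tau.
Definition forest_size w : nat := (\sum_(tau <- w) tree_size tau)%N.

Definition node (i : 'I_d) w : tree d :=
  mk_tree (PNode i [seq ptree_of_tree tau | tau <- w]).
Definition tree_root tau : 'I_d := proot tau.
Definition branches tau : forest d := seq_mset (map (@mk_tree d) (pbranches tau)).

(** pi(w), the symmetry factor of the multiset of trees w *)
Definition forest_pi w : nat := (\prod_(tau <- finsupp w) (w tau)`!)%N.

Lemma root_node i w : tree_root (node i w) = i. Proof. by []. Qed.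

Lemma branches_node i w : branches (node i w) = w.
Proof.
rewrite /branches /= -[RHS]seq_mset_id; apply/eq_seq_msetP.
rewrite (@map_id_in _ (@canon d)); last by move=> _ /mapP[tau _ ->]; case: tau => t /= /eqP.
rewrite -[X in perm_eq _ X](_ : map (@mk_tree d) [seq ptree_of_tree tau | tau <- w] = w).
  by apply: perm_map; rewrite perm_sort.
by rewrite -map_comp map_id_in // => tau _ /=; rewrite mk_treeK.
Qed.

Lemma node_root_branches tau : node (tree_root tau) (branches tau) = tau.
Proof.
apply: val_inj; rewrite /node /tree_root /branches; case: tau => -[i s] /= /eqP Ht.
rewrite -[RHS]Ht; congr PNode; apply/perm_sortP.
- exact: ple_total.
- exact: ple_trans.
- exact: ple_anti.
set u := map (@mk_tree d) s.
rewrite (_ : map (@canon d) s = map (@canon d) (map (@ptree_of_tree d) u)).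
  by do 2 apply: perm_map; exact: perm_eq_seq_mset.
by rewrite -!map_comp; apply: eq_map => t /=; rewrite (eqP (canonK t)).
Qed.

Lemma psize_canon (t : ptree d) : psize (canon t) = psize t.
Proof.
elim/ptree_ind': t => i s IH /=; congr _.+1.
have /perm_sumn -> : perm_eq (map (@psize d) (sort (@ple d) (map (@canon d) s)))
   (map (@psize d) (map (@canon d) s)) by apply: perm_map; rewrite perm_sort.
by rewrite -map_comp; congr sumn; apply/eq_in_map.
Qed.

Lemma tree_size_node i w : tree_size (node i w) = (forest_size w).+1.
Proof. by rewrite /tree_size psize_canon /= -map_comp sumnE big_map. Qed.

Lemma tree_size_gt0 tau : (0 < tree_size tau)%N.
Proof. by rewrite -[tau]node_root_branches tree_size_node. Qed.

Lemma tree_size_branches tau rho : rho \in branches tau -> (tree_size rho < tree_size tau)%N.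
Proof.
rewrite -[X in (_ < tree_size X)%N]node_root_branches tree_size_node ltnS /forest_size.
by move=> rhoB; rewrite (perm_big _ (perm_to_rem rhoB)) big_cons leq_addr.
Qed.

Lemma finite_trees m : finite_set [set tau : tree d | (tree_size tau <= m)%N].
Proof.
pose seqs := fun (A : seq (ptree d)) =>
  fix F k := if k is k'.+1 then [::] :: [seq x :: s | x <- A, s <- F k'] else [:: [::]].
pose fix trees k : seq (ptree d) :=
  if k is k'.+1 then [seq PNode i s | i <- enum 'I_d, s <- seqs (trees k') k']
  else [::].
have seqsP A : forall k s, (size s <= k)%N -> {subset s <= A} -> s \in seqs A k.
  elim=> [|k IH] [|x s] //= sk sA; rewrite inE /=.
  apply/allpairsP; exists (x, s); split => //=; first by apply: sA; rewrite inE eqxx.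
  by apply: IH => // y ys; apply: sA; rewrite inE ys orbT.
have size_sumn (s : seq (ptree d)) : (size s <= sumn (map (@psize d) s))%N.
  by elim: s => //= -[i s] r /= IH; rewrite addSn ltnS (leq_trans IH) ?leq_addl.
have treesP : forall k t, (psize t <= k)%N -> t \in trees k.
  elim=> [|k IH] [i s] //=; rewrite ltnS => sk.
  apply/allpairsP; exists (i, s); split => //=; first by rewrite mem_enum.
  apply: seqsP; first exact: leq_trans sk.
  move=> t ts; apply: IH; apply: leq_trans sk.
  by rewrite (perm_sumn (perm_map _ (perm_to_rem ts))) /= leq_addr.
apply: (@sub_finite_set _ _ [set` map (@mk_tree d) (trees m)]).
  move=> tau /= taum; apply/mapP; exists (ptree_of_tree tau); last by rewrite mk_treeK.
  exact: treesP.
exact: finite_seq.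
Qed.

End Trees.

(** [{freeg K / int}] is the free Z-module on K. *)

Lemma fglift0 (R : nzRingType) (K : choiceType) (M : lmodType R) (f : K -> M) :
  fglift f 0 = 0.
Proof. by rewrite -freeg_nil fglift_Freeg prelift_nil. Qed.

Section Grafting.
Variable d : nat.
Implicit Types (tau rho : tree d) (w : forest d).

Definition lin (A B : choiceType) (f : A -> B) (D : {freeg A / int}) :
    {freeg B / int} := fglift (fun a => << f a >>) D.

(** Leibniz extension of g : T -> Z[T] to forests *)
Definition leibniz (g : tree d -> {freeg (tree d) / int}) w :
    {freeg (forest d) / int} :=
  \sum_(rho <- w) lin (fun rho' => rho' +` (w `\ rho))%mset (g rho).

(** The fuel [k] bounds the number of vertices of [rho]; see [graftE]. *)
Fixpoint graft_rec (k : nat) tau rho : {freeg (tree d) / int} :=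
  if k is k'.+1 then
    lin (node (tree_root rho))
      (<< (tau +` branches rho)%mset >> + leibniz (graft_rec k' tau) (branches rho))
  else 0.

Definition graft tau rho := graft_rec (tree_size rho) tau rho.
Definition graft_forest tau w := leibniz (graft tau) w.

Lemma graft_recE k tau rho : (tree_size rho <= k)%N -> graft_rec k tau rho = graft tau rho.
Proof.
rewrite /graft; have [m] := ubnP (tree_size rho); elim: m k rho => // m IH k rho.
case E: (tree_size rho) k (tree_size_gt0 rho) => [|l] [|k] //= _; rewrite !ltnS => lm lk.
congr (lin _ (_ + _)); apply: eq_big_seq => x xB; congr lin.
have xl : (tree_size x <= l)%N by rewrite -ltnS -E tree_size_branches.
have xm := leq_ltn_trans xl lm.
by rewrite (IH k) ?(leq_trans xl) // (IH l).
Qed.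

Lemma graftE tau i w :
  graft tau (node i w) = lin (node i) (<< (tau +` w)%mset >> + graft_forest tau w).
Proof.
rewrite {1}/graft tree_size_node /= branches_node root_node; congr (lin _ (_ + _)).
apply: eq_big_seq => x xw; rewrite graft_recE // -ltnS -(tree_size_node i).
by apply: tree_size_branches; rewrite branches_node.
Qed.

(** Guin-Oudom extension to forests; the fuel [k] is the number of trees of
   [w].  The forest is commutative and its trees are extracted in the order of
   the enumeration of [w]: by the pre-Lie identity the result does not depend
   on that order. *)
Fixpoint go_graft_rec (k : nat) w rho : {freeg (tree d) / int} :=
  if k is k'.+1 then
    if enum_mset w is tau :: _ then
      let v := (w `\ tau)%mset in
      fglift (graft tau) (go_graft_rec k' v rho)
      - fglift (fun v' => go_graft_rec k' v' rho) (graft_forest tau v)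
    else << rho >>
  else << rho >>.

Definition go_graft w rho := go_graft_rec (size w) w rho.

Lemma go_graft0 rho : go_graft mset0 rho = << rho >>.
Proof. by rewrite /go_graft; have -> : size (mset0 : forest d) = 0%N by rewrite size_mset0. Qed.

Lemma go_graft1 tau rho : go_graft [mset tau]%mset rho = graft tau rho.
Proof.
rewrite /go_graft.
have -> : enum_mset [mset tau]%mset = [:: tau] by rewrite enum_msetn.
rewrite /= enum_msetn /=.
have -> : ([mset tau] `\ tau)%mset = mset0 :> forest d by apply/msetP=> x; rewrite msetE2 mset0E subnn.
by rewrite /graft_forest /leibniz enum_mset0 big_nil fglift0 subr0 liftU scale1r.
Qed.

End Grafting.

Section ElementaryDifferentials.
Variables (R : realType) (n d : nat).

Definition pderiv (i : 'I_n) (f : 'rV[R]_n -> R) : 'rV[R]_n -> R :=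
  fun x => 'D_(delta_mx 0 i) f x.

Definition iter_pderiv (s : seq 'I_n) (f : 'rV[R]_n -> R) := foldr pderiv f s.

Fixpoint Ck (k : nat) (f : 'rV[R]_n -> R) : Prop :=
  continuous f /\
  if k is k'.+1 then
    forall i : 'I_n, (forall x, derivable f x (delta_mx 0 i)) /\ Ck k' (pderiv i f)
  else True.

Variable sigma : 'I_d -> 'rV[R]_n -> 'rV[R]_n.

Fixpoint elem_diff (t : ptree d) : 'rV[R]_n -> 'rV[R]_n :=
  let: PNode j s := t in fun x => \row_a
    \sum_(i : (size s).-tuple 'I_n)
      iter_pderiv i (fun y => sigma j y 0 a) x *
      \prod_(l < size s) nth (fun=> 0) [seq elem_diff u | u <- s] l x 0 (tnth i l).

Definition Upsilon (tau : tree d) := elem_diff tau.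

End ElementaryDifferentials.

Section Norms.
Variable R : realType.

Definition enorm n (x : 'rV[R]_n) : R := Num.sqrt (\sum_i x 0 i ^+ 2).

Definition glob_lipschitz n (f : 'rV[R]_n -> 'rV[R]_n) :=
  exists L : R, forall x y, enorm (f x - f y) <= L * enorm (x - y).

Definition glob_holder (beta : R) n (f : 'rV[R]_n -> 'rV[R]_n) :=
  exists L : R, forall x y, enorm (f x - f y) <= L * enorm (x - y) `^ beta.

(** The two norms take as argument (s, t) |-> |F_st|. *)
Definition two_norm (T eta : R) (F : R -> R -> R) : \bar R :=
  ereal_sup [set z | exists s t : R,
    [/\ 0 <= s, s < t, t <= T & z = (F s t / (t - s) `^ eta)%:E]].

Definition two_norm_mu (T eta mu : R) (F : R -> R -> R) : \bar R :=
  ereal_sup [set z | exists s t : R,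
    [/\ 0 <= s, s < t, t <= T, t - s <= mu &
        z = (expR (- (t / mu)) * F s t / (t - s) `^ eta)%:E]].

End Norms.

Section RoughPaths.
Variables (R : realType) (d N : nat).

Definition holder_path (alpha T : R) (x : R -> 'rV[R]_d) :=
  exists C : R, forall s t, 0 <= s -> s <= t -> t <= T ->
    enorm (x t - x s) <= C * (t - s) `^ alpha.

(** Only the values [X s t w] with 0 <= s <= t <= T and |w| <= N are
   meaningful. In [brp_chen] the summand vanishes unless |w| + |rho| = |tau|. *)
Record branched_rough_path (alpha T : R) (X : R -> R -> forest d -> R) : Prop := {
  brp_unit : forall s t, 0 <= s -> s <= t -> t <= T -> X s t mset0 = 1;
  brp_mul : forall s t, 0 <= s -> s <= t -> t <= T ->
    forall w : forest d, (forest_size w <= N)%N ->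
    X s t w = \prod_(tau <- w) X s t [mset tau]%mset;
  brp_holder : exists C : R, forall tau : tree d, (tree_size tau <= N)%N ->
    forall s t, 0 <= s -> s <= t -> t <= T ->
    `|X s t [mset tau]%mset| <= C * (t - s) `^ ((tree_size tau)%:R * alpha);
  brp_chen : forall s u t, 0 <= s -> s <= u -> u <= t -> t <= T ->
    forall tau : tree d, (tree_size tau <= N)%N ->
    X s t [mset tau]%mset = X s u [mset tau]%mset +
      \sum_(p \in [set: forest d * tree d])
        X s u p.1 / (forest_pi p.1)%:R * X u t [mset p.2]%mset *
        (coeff tau (go_graft p.1 p.2))%:~R }.

Definition bullet (i : 'I_d) : tree d := node i mset0.

Record branched_lift (alpha T : R) (x : R -> 'rV[R]_d)
    (X : R -> R -> forest d -> R) : Prop := {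
  bl_path : holder_path alpha T x;
  bl_rough : branched_rough_path alpha T X;
  bl_lift : forall s t, 0 <= s -> s <= t -> t <= T ->
    forall i : 'I_d, X s t [mset bullet i]%mset = x t 0 i - x s 0 i }.

(** || X(tau) ||_(|tau| alpha) *)
Definition rp_norm (alpha T : R) (X : R -> R -> forest d -> R) (tau : tree d) : \bar R :=
  two_norm T ((tree_size tau)%:R * alpha) (fun s t => `|X s t [mset tau]%mset|).

Variables (n : nat) (sigma : 'I_d -> 'rV[R]_n -> 'rV[R]_n).

(** Z^[l]_st for l >= 1: the sum is over trees with at most l - 1 vertices *)
Definition remainder (X : R -> R -> forest d -> R) (Z : R -> 'rV[R]_n) (l : nat)
    (s t : R) : 'rV[R]_n :=
  Z t - Z s -
  \sum_(tau \in [set tau : tree d | (tree_size tau < l)%N])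
    X s t [mset tau]%mset *: Upsilon sigma tau (Z s).

Definition davie_solution (T : R) (X : R -> R -> forest d -> R) (Z : R -> 'rV[R]_n) :=
  forall e : R, 0 < e -> exists2 delta : R, 0 < delta &
    forall s t, 0 <= s -> s <= t -> t <= T -> t - s <= delta ->
    enorm (remainder X Z N.+1 s t) <= e * (t - s).

(** || Z^[l] ||_(eta, mu) *)
Definition rem_norm (T : R) (X : R -> R -> forest d -> R) (Z : R -> 'rV[R]_n)
    (l : nat) (eta mu : R) : \bar R :=
  two_norm_mu T eta mu (fun s t => enorm (remainder X Z l s t)).

End RoughPaths.

(* Main.v *)
Require Import Defs.
From HB Require Import structures.
From mathcomp Require Import all_boot all_order all_algebra.
From mathcomp Require Import finmap multiset freeg.
From mathcomp Require Import all_classical all_reals all_analysis.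
From mathcomp Require Import zify ring lra.

Set Implicit Arguments.
Unset Strict Implicit.
Unset Printing Implicit Defensive.
Import Order.TTheory GRing.Theory Num.Theory.
Import numFieldNormedType.Exports.
Local Open Scope classical_set_scope.
Local Open Scope ring_scope.

(** Fix s <= u and put theta = (u - s)^alpha.  Then Z_u is the value at r = theta
   of the polynomial curve y_r = Z_s + sum_l r^l v_l, where
   theta^l v_l = Z^[l]_su - Z^[l+1]_su for l < N and theta^N v_N = Z^[N]_su.  For
   l < N, v_l is the combination of the Upsilon_tau(Z_s), |tau| = l, with
   coefficients theta^(-l) X_su(tau).  By Chen's relation,
     Z^[N+1]_st - Z^[N+1]_su - Z^[N+1]_ut
       = sum_rho X_ut(rho) (Upsilon_rho(Z_u)
           - sum_w X_su(w) / pi(w) Upsilon_(w grafted on rho)(Z_s)),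
   and since Upsilon_(w grafted on rho) is the iterated derivative of Upsilon_rho
   in the directions Upsilon_tau, tau in w, the bracket is the Taylor remainder of
   order N - |rho| at r = theta of r |-> Upsilon_rho(y_r).

   The derivatives of Upsilon_rho are not bounded separately, so this remainder is
   estimated by induction on the order: the derivative of Upsilon_rho in the
   direction Upsilon_tau is Upsilon_(tau grafted on rho), which is again Lipschitz
   or Hoelder.  Integrating in r yields some polynomial with a uniform error, which
   must be the Taylor polynomial as both have error o(r^(N - |rho|)).

   Dyadic sewing of the bound on the increments gives (i).  For (ii) and (iii),
   Z^[l] = Z^[l+1] + sum_(|tau| = l) X(tau) Upsilon_tau(Z_s), where
   Upsilon_tau(Z_s) is compared with Upsilon_tau(Z_0); all error terms carry a factor
   (T /\ mu)^(alpha beta) and are absorbed in the left-hand side, which is finite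
   for a Davie solution. *)

Lemma sum_continuous (K : numFieldType) (T : topologicalType) (I : Type) (r : seq I)
    (F : I -> T -> K) :
  (forall i, continuous (F i)) -> continuous (fun x => \sum_(i <- r) F i x).
Proof.
move=> cF; elim: r => [|i r IH].
  by under eq_fun do rewrite big_nil; exact: cst_continuous.
under eq_fun do rewrite big_cons.
by move=> x; apply: cvgD; [exact: cF|exact: IH].
Qed.

Section PartialDerivatives.
Variables (R : realType) (n : nat).
Implicit Types (f g : 'rV[R]_n -> R) (x y u v : 'rV[R]_n).

Lemma is_derive_line f x v t : derivable f (x + t *: v) v ->
  is_derive t 1 (fun r : R => f (x + r *: v)) ('D_v f (x + t *: v)).
Proof.
have E : (fun h : R => h^-1 *: (((fun r => f (x + r *: v)) \o shift t) (h *: 1) - f (x + t *: v)))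
       = (fun h : R => h^-1 *: ((f \o shift (x + t *: v)) (h *: v) - f (x + t *: v))).
  apply/funext => h /=; congr (_ *: (f _ - _)).
  by rewrite [h *: 1]mulr1 scalerDl addrCA addrA.
by move=> df; apply: DeriveDef; rewrite /derivable /derive E.
Qed.

Lemma line_MVT f x v (t : R) : (forall y, derivable f y v) ->
  exists2 c : R, `|c| <= `|t| & f (x + t *: v) - f x = t * 'D_v f (x + c *: v).
Proof.
move=> df; pose g r := f (x + r *: v).
have dg (r : R) : is_derive r 1 g ('D_v f (x + r *: v)) by exact: is_derive_line.
have cg A : {within A, continuous g}.
  by apply: continuous_subspaceT => r; apply: differentiable_continuous; exact/derivable1_diffP.
have g0 : g 0 = f x by rewrite /g scale0r addr0.
have [t0|t0] := leP 0 t.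
  have [c] := MVT_segment t0 (fun r _ => dg r) (cg _).
  rewrite in_itv /= subr0 -/(g t) -g0 => /andP[c0 ct] ->; exists c; last by rewrite mulrC.
  by rewrite !ger0_norm.
have [c] := MVT_segment (ltW t0) (fun r _ => dg r) (cg _).
rewrite in_itv /= sub0r -/(g t) -g0 => /andP[tc c0] E; exists c; last first.
  by rewrite -opprB E mulrN opprK mulrC.
by rewrite !ler0_norm ?(ltW t0) // lerN2.
Qed.

Lemma rV_coord_le v i : `|v 0 i| <= `|v|.
Proof. by rewrite [leRHS]mx_normrE; exact: (@le_bigmax _ _ _ 0 (fun ij => `|v ij.1 ij.2|) (0, i)). Qed.

Lemma rV_norm_le v (c : R) : 0 <= c -> (forall i, `|v 0 i| <= c) -> `|v| <= c.
Proof. by move=> c0 H; rewrite [leLHS]mx_normrE; apply: bigmax_le => // -[a i] _; rewrite ord1. Qed.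

Definition trunc_rV (j : nat) v : 'rV[R]_n := \row_i (if (i < j)%N then v 0 i else 0).

Lemma trunc_rVS (j : 'I_n) v :
  trunc_rV j.+1 v = trunc_rV j v + v 0 j *: delta_mx 0 j.
Proof.
apply/rowP => i; rewrite !mxE eqxx /= ltnS leq_eqVlt.
have [->|ij] := eqVneq i j; first by rewrite ltnn mulr1 add0r eqxx.
by rewrite mulr0 addr0 -(inj_eq val_inj) in ij *; rewrite (negPf ij).
Qed.

Lemma trunc_rV_all v : trunc_rV n v = v.
Proof. by apply/rowP => i; rewrite mxE ltn_ord. Qed.

Lemma trunc_rV0 v : trunc_rV 0 v = 0.
Proof. by apply/rowP => i; rewrite !mxE. Qed.

Lemma C1_expansion f x (e : R) : Ck 1 f -> 0 < e ->
  \forall v \near (0 : 'rV[R]_n), `|f (x + v) - f x - \sum_i v 0 i * pderiv i f x| <= e * `|v|.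
Proof.
move=> [_ Cf] e0; pose e' := e / n.+1%:R.
have e'0 : 0 < e' by rewrite divr_gt0.
have Hi (i : 'I_n) : \forall v \near (0 : 'rV[R]_n), `|pderiv i f (x + v) - pderiv i f x| <= e'.
  have [_ [C _]] := Cf i.
  by have /cvgrPdistC_le/(_ _ e'0)/nbhs0P := C x.
have := @filter_forall _ _ _ _ (nbhs_filter (0 : 'rV[R]_n)) Hi.
move=> /nbhs_ballP[dl /= dl0 H]; apply/nbhs_ballP; exists dl => // v.
rewrite -ball_normE /= sub0r normrN => vdl.
have step (j : 'I_n) : `|f (x + trunc_rV j.+1 v) - f (x + trunc_rV j v) - v 0 j * pderiv j f x| <= `|v| * e'.
  rewrite trunc_rVS addrA.
  have [c ct ->] := @line_MVT f (x + trunc_rV j v) (delta_mx 0 j) (v 0 j) (Cf j).1.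
  rewrite -/(pderiv j f _) -mulrBr normrM ler_pM ?rV_coord_le // -addrA; apply: H.
  rewrite mx_norm_ball /ball_ /= sub0r normrN; apply: le_lt_trans vdl.
  apply: rV_norm_le => // i; rewrite !mxE eqxx /=.
  case: eqP => [->|_]; first by rewrite ltnn add0r mulr1 (le_trans ct) ?rV_coord_le.
  by rewrite mulr0 addr0; case: ifP; rewrite ?normr0 ?rV_coord_le.
have -> : f (x + v) - f x - \sum_i v 0 i * pderiv i f x =
   \sum_(j < n) (f (x + trunc_rV j.+1 v) - f (x + trunc_rV j v) - v 0 j * pderiv j f x).
  rewrite sumrB; congr (_ - _).
  rewrite -(big_mkord xpredT (fun j => f (x + trunc_rV j.+1 v) - f (x + trunc_rV j v))).
  by rewrite telescope_sumr // trunc_rV_all trunc_rV0 addr0.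
apply: le_trans (ler_norm_sum _ _ _) _.
apply: le_trans (ler_sum _ (fun j _ => step j)) _.
rewrite sumr_const card_ord mulrC -mulr_natr -mulrA mulrCA [X in _ <= X]mulrC ler_wpM2l //.
by rewrite /e' mulrAC ler_pdivrMr // ler_wpM2l ?(ltW e0) // ler_nat.
Qed.

Definition grad_form f x v : R := \sum_i v 0 i * pderiv i f x.

Lemma grad_form_is_linear f x : linear (grad_form f x : 'rV[R]_n -> R).
Proof.
move=> a u v; rewrite /grad_form scaler_sumr -big_split; apply: eq_bigr => i _ /=.
by rewrite !mxE mulrDl -scalerAl.
Qed.
HB.instance Definition _ f x :=
  GRing.isLinear.Build R 'rV[R]_n R _ (grad_form f x) (grad_form_is_linear f x).

Lemma C1_diff f x : Ck 1 f -> is_diff x f (grad_form f x).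
Proof.
move=> Cf; have cg : continuous (grad_form f x).
  have H i : continuous (fun v : 'rV[R]_n => v 0 i * pderiv i f x).
    move=> y; have := @continuousM _ _ (fun v : 'rV[R]_n => v 0 i) (fun=> pderiv i f x) y.
    by apply; [exact: coord_continuous|exact: cst_continuous].
  exact: sum_continuous H.
have E : f \o shift x = cst (f x) + grad_form f x +o_ (0 : 'rV[R]_n) id.
  apply/eqaddoP => e e0 /=; have := @C1_expansion f x e Cf e0.
  apply: filterS => v; rewrite /= !fctE /= [v + x]addrC => H.
  by rewrite opprD addrA.
have dE := diff_unique cg E.
apply: DiffDef => //; apply/diff_locallyP; split; rewrite dE //.
Qed.

Lemma C1_derive f x v : Ck 1 f -> is_derive x v f (\sum_i v 0 i * pderiv i f x).
Proof.
move=> Cf; have D := C1_diff x Cf; apply: DeriveDef.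
  by apply: diff_derivable.
by rewrite deriveE // diff_val.
Qed.

Lemma Ck_continuous k f : Ck k f -> continuous f.
Proof. by case: k => [|k] []. Qed.

Lemma CkS k f : Ck k.+1 f -> Ck k f.
Proof.
elim: k f => [|k IH] f [cf Hf]; split=> // i; have [df Cf] := Hf i.
by split=> //; exact: IH.
Qed.

Lemma Ck_le j k f : (j <= k)%N -> Ck k f -> Ck j f.
Proof.
move=> jk; rewrite -(subnK jk); elim: (k - j)%N => // m IH Cf.
by apply: IH; apply: CkS.
Qed.

Lemma Ck_pderiv k f i : Ck k.+1 f -> Ck k (pderiv i f).
Proof. by case=> _ /(_ i)[]. Qed.

Lemma Ck_derivable k f i x : Ck k.+1 f -> derivable f x (delta_mx 0 i).
Proof. by case=> _ /(_ i)[]. Qed.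

Lemma Ck_cst k (c : R) : Ck k (fun _ : 'rV[R]_n => c).
Proof.
have H : forall c : R, continuous (fun _ : 'rV[R]_n => c) by move=> ?; exact: cst_continuous.
elim: k c => [|k IH] c; split=> // i; split; first by move=> x; exact: derivable_cst.
have -> : pderiv i (fun=> c) = (fun=> 0 : R) by apply/funext => x; exact: derive_cst.
exact: IH.
Qed.

Lemma rV_continuousD f g : continuous f -> continuous g -> continuous (fun x => f x + g x).
Proof. by move=> cf cg x; exact: (@continuousD _ _ _ f g x (cf x) (cg x)). Qed.

Lemma rV_continuousM f g : continuous f -> continuous g -> continuous (fun x => f x * g x).
Proof. by move=> cf cg x; exact: (@continuousM _ _ f g x (cf x) (cg x)). Qed.

Lemma Ck_add k f g : Ck k f -> Ck k g -> Ck k (fun x => f x + g x).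
Proof.
elim: k f g => [|k IH] f g [cf Hf] [cg Hg].
  by split=> //; exact: rV_continuousD.
split=> [|i]; first exact: rV_continuousD.
have [df Cf] := Hf i; have [dg Cg] := Hg i.
split=> [x|]; first exact: derivableD.
have -> : pderiv i (fun x => f x + g x) = fun x => pderiv i f x + pderiv i g x.
  by apply/funext => x; exact: deriveD.
exact: IH.
Qed.

Lemma pderivM f g i x : derivable f x (delta_mx 0 i) -> derivable g x (delta_mx 0 i) ->
  pderiv i (fun x => f x * g x) x = f x * pderiv i g x + g x * pderiv i f x.
Proof. exact: deriveM. Qed.

Lemma Ck_mul k f g : Ck k f -> Ck k g -> Ck k (fun x => f x * g x).
Proof.
elim: k f g => [|k IH] f g Cf Cg.
  by split=> //; apply: rV_continuousM; [exact: (Ck_continuous Cf)|exact: (Ck_continuous Cg)].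
split=> [|i]; first by apply: rV_continuousM; [exact: (Ck_continuous Cf)|exact: (Ck_continuous Cg)].
split=> [x|]; first by apply: derivableM; [exact: Ck_derivable Cf|exact: Ck_derivable Cg].
have -> : pderiv i (fun x => f x * g x) = fun x => f x * pderiv i g x + g x * pderiv i f x.
  by apply/funext => x; apply: pderivM; [exact: Ck_derivable Cf|exact: Ck_derivable Cg].
by apply: Ck_add; apply: IH; (exact: CkS) || exact: Ck_pderiv.
Qed.

Lemma Ck_sum k (I : eqType) (r : seq I) (F : I -> 'rV[R]_n -> R) :
  {in r, forall i, Ck k (F i)} -> Ck k (fun x => \sum_(i <- r) F i x).
Proof.
elim: r => [|i r IH] CF.
  by under eq_fun do rewrite big_nil; exact: Ck_cst.
under eq_fun do rewrite big_cons; apply: Ck_add; first by apply: CF; rewrite mem_head.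
by apply: IH => j jr; apply: CF; rewrite inE jr orbT.
Qed.

Lemma Ck_prod k (I : eqType) (r : seq I) (F : I -> 'rV[R]_n -> R) :
  {in r, forall i, Ck k (F i)} -> Ck k (fun x => \prod_(i <- r) F i x).
Proof.
elim: r => [|i r IH] CF.
  by under eq_fun do rewrite big_nil; exact: Ck_cst.
under eq_fun do rewrite big_cons; apply: Ck_mul; first by apply: CF; rewrite mem_head.
by apply: IH => j jr; apply: CF; rewrite inE jr orbT.
Qed.

Lemma second_difference f i j x (t : R) : Ck 2 f ->
  exists2 w : 'rV[R]_n, `|w| <= 2 * `|t| &
    f (x + t *: delta_mx 0 i + t *: delta_mx 0 j) - f (x + t *: delta_mx 0 i)
      - (f (x + t *: delta_mx 0 j) - f x) = t * (t * pderiv j (pderiv i f) (x + w)).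
Proof.
move=> Cf; pose ei : 'rV[R]_n := delta_mx 0 i; pose ej : 'rV[R]_n := delta_mx 0 j.
have shift_der y v w : derivable f (y + v) w -> is_derive y w (fun z => f (z + v)) ('D_w f (y + v)).
  move=> df.
  have E : (fun h : R => h^-1 *: (((fun z => f (z + v)) \o shift y) (h *: w) - f (y + v)))
       = (fun h : R => h^-1 *: ((f \o shift (y + v)) (h *: w) - f (y + v))).
    by apply/funext => h /=; rewrite addrA.
  by apply: DeriveDef; rewrite /derivable /derive E.
pose phi y := f (y + t *: ej) - f y.
have dphi y : is_derive y ei phi (pderiv i f (y + t *: ej) - pderiv i f y).
  by apply: is_deriveB; [apply: shift_der|apply: DeriveDef => //]; apply: Ck_derivable Cf.
have [c ct E] := @line_MVT phi x ei t (fun y => ex_derive (is_derive := dphi y)).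
have [c' ct' E'] := @line_MVT (pderiv i f) (x + c *: ei) ej t
  (fun y => @Ck_derivable 0 _ j y (Ck_pderiv i Cf)).
exists (c *: ei + c' *: ej).
  apply: (le_trans (ler_normD _ _)); rewrite !normrZ mulr2n mulrDl !mul1r.
  have e1 (l : 'I_n) : `|(delta_mx 0 l : 'rV[R]_n)| <= 1.
    by apply: rV_norm_le => // m; rewrite mxE; case: (_ && _); rewrite ?normr0 ?normr1.
  by apply: lerD; rewrite -[leRHS]mulr1 ler_pM // e1.
have := E; rewrite /phi => ->; congr (_ * _).
by rewrite (derive_val (is_derive := dphi _)) E' addrA.
Qed.

Lemma pderiv_comm f i j x : Ck 2 f -> pderiv i (pderiv j f) x = pderiv j (pderiv i f) x.
Proof.
have tri (a b c e : R) : `|a - b| <= e / 2 -> `|a - c| <= e / 2 -> `|b - c| <= e.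
  by rewrite !ler_norml => /andP[? ?] /andP[? ?]; apply/andP; split; lra.
have canc (t a b : R) : t != 0 -> t * (t * a) = t * (t * b) -> a = b.
  by move=> t0 /(mulfI t0)/(mulfI t0).
have swap (a b c e : R) : a - b - (c - e) = a - c - (b - e) by ring.
move=> Cf; apply/eqP; rewrite -subr_eq0 -normr_le0; apply/ler_addgt0Pr => e e0; rewrite add0r.
have cont a b : continuous (pderiv a (pderiv b f)).
  exact: Ck_continuous (Ck_pderiv a (Ck_pderiv b Cf)).
have e2 : 0 < e / 2 by rewrite divr_gt0.
have near a b : exists2 dl : R, 0 < dl & forall w, `|w| < dl ->
    `|pderiv a (pderiv b f) (x + w) - pderiv a (pderiv b f) x| <= e / 2.
  have /cvgrPdistC_le/(_ _ e2)/nbhs0P/nbhs_ballP[dl /= dl0 H] := cont a b x.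
  exists dl => // w wdl; apply: H.
  by rewrite mx_norm_ball /ball_ /= sub0r normrN.
have [d1 d10 H1] := near i j; have [d2 d20 H2] := near j i.
pose t : R := Num.min d1 d2 / 3.
have t0 : 0 < t by rewrite divr_gt0 // lt_min d10 d20.
have tn0 : t != 0 by rewrite gt_eqF.
have t3 : 2 * `|t| < Num.min d1 d2.
  rewrite gtr0_norm // /t mulrA ltr_pdivrMr // mulrC ltr_pM2l ?ltr_nat //.
  by rewrite lt_min d10 d20.
move: t3; rewrite lt_min => /andP[t1 t2].
have [w1 w1t E1] := @second_difference f j i x t Cf.
have [w2 w2t E2] := @second_difference f i j x t Cf.
have {E1 E2} E : pderiv i (pderiv j f) (x + w1) = pderiv j (pderiv i f) (x + w2).
  have : t * (t * pderiv i (pderiv j f) (x + w1)) = t * (t * pderiv j (pderiv i f) (x + w2)).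
    by apply: etrans (esym E1) (etrans _ E2); rewrite [x + _ + _]addrAC; exact: swap.
  exact: canc.
have := H1 w1 (le_lt_trans w1t t1); have := H2 w2 (le_lt_trans w2t t2); rewrite E => B1 B2.
exact: (tri _ _ _ _ B2 B1).
Qed.

End PartialDerivatives.

Section MultiDerivatives.
Variables (R : realType) (n : nat).
Implicit Types (f g : 'rV[R]_n -> R) (x y u v : 'rV[R]_n) (us vs : seq 'rV[R]_n).

Fixpoint mderiv us f : 'rV[R]_n -> R :=
  if us is u :: us' then fun x => \sum_i u 0 i * mderiv us' (pderiv i f) x else f.

Lemma mderiv_cons u us f x :
  mderiv (u :: us) f x = \sum_i u 0 i * mderiv us (pderiv i f) x.
Proof. by []. Qed.

Lemma is_derive_sumr (I : Type) (r : seq I) (F : I -> 'rV[R]_n -> R) (dF : I -> R) x v :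
  (forall i, is_derive x v (F i) (dF i)) ->
  is_derive x v (fun y => \sum_(i <- r) F i y) (\sum_(i <- r) dF i).
Proof.
move=> H; elim: r => [|i r IH].
  by under eq_fun do rewrite big_nil; rewrite big_nil; exact: is_derive_cst.
under eq_fun do rewrite big_cons; rewrite big_cons.
exact: (is_deriveD (H i) IH).
Qed.

Lemma is_deriveMfun f g (df dg : R) x v : is_derive x v f df -> is_derive x v g dg ->
  is_derive x v (fun y => f y * g y) (df * g x + f x * dg).
Proof.
by move=> Hf Hg; have := is_deriveM Hf Hg; rewrite addrC [_ *: df]mulrC.
Qed.

Lemma Ck_scale k (c : R) f : Ck k f -> Ck k (fun y => c * f y).
Proof. by move=> Cf; apply: Ck_mul => //; exact: Ck_cst. Qed.

Lemma Ck_grad_form k f u : Ck k.+1 f -> Ck k (fun y => grad_form f y u).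
Proof. by move=> Cf; apply: Ck_sum => i _; apply: Ck_scale; exact: Ck_pderiv. Qed.

Lemma mderiv_sum (I : eqType) (r : seq I) (a : I -> R) (F : I -> 'rV[R]_n -> R) us x :
  {in r, forall i, Ck (size us) (F i)} ->
  mderiv us (fun y => \sum_(i <- r) a i * F i y) x = \sum_(i <- r) a i * mderiv us (F i) x.
Proof.
elim: us F x => [|u us IH] F x CF //=.
have -> : \sum_i u 0 i * mderiv us (pderiv i (fun y => \sum_(i <- r) a i * F i y)) x =
   \sum_i u 0 i * \sum_(j <- r) a j * mderiv us (pderiv i (F j)) x.
  apply: eq_bigr => i _; congr (_ * _); rewrite -IH; last first.
    by move=> j jr; apply: Ck_pderiv; exact: CF.
  congr (mderiv us _ x); apply/funext => y.
  have H : forall s : seq I, {subset s <= r} ->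
      is_derive y (delta_mx 0 i) (fun y => \sum_(j <- s) a j * F j y) (\sum_(j <- s) a j * pderiv i (F j) y).
    elim=> [|j s IHs] sr.
      by under eq_fun do rewrite big_nil; rewrite big_nil; exact: is_derive_cst.
    under eq_fun do rewrite big_cons; rewrite big_cons; apply: is_deriveD.
      have dj : is_derive y (delta_mx 0 i) (F j) (pderiv i (F j) y).
        by apply: DeriveDef => //; apply: Ck_derivable (CF j _); apply: sr; rewrite mem_head.
      have := is_deriveMfun (is_derive_cst (a j) y (delta_mx 0 i)) dj.
      by rewrite mul0r add0r.
    by apply: IHs => l ls; apply: sr; rewrite inE ls orbT.
  exact: (derive_val (is_derive := H r (fun _ => id))).
under eq_bigr do rewrite big_distrr /=.
rewrite exchange_big /=; apply: eq_bigr => j _; rewrite big_distrr /=.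
by apply: eq_bigr => i _; rewrite mulrCA.
Qed.

Lemma mderiv_grad u us f x : Ck (size us).+1 f ->
  mderiv us (fun y => grad_form f y u) x = mderiv (u :: us) f x.
Proof. by move=> Cf; rewrite mderiv_sum //= => i _; exact: Ck_pderiv. Qed.

Lemma mderiv_swap u v us f x : Ck (size us).+2 f ->
  mderiv (u :: v :: us) f x = mderiv (v :: u :: us) f x.
Proof.
move=> Cf; rewrite /=.
under eq_bigr do rewrite big_distrr /=.
under [RHS]eq_bigr do rewrite big_distrr /=.
rewrite exchange_big /=; apply: eq_bigr => i _; apply: eq_bigr => j _.
have -> : pderiv i (pderiv j f) = pderiv j (pderiv i f).
  by apply/funext => y; apply: pderiv_comm; apply: Ck_le Cf.
exact: mulrCA.
Qed.

Lemma mderiv_move u us vs f x : Ck (size us + size vs).+1 f ->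
  mderiv (us ++ u :: vs) f x = mderiv (u :: us ++ vs) f x.
Proof.
elim: us f x => [|v us IH] f x //= Cf; rewrite -/(mderiv (v :: u :: us ++ vs) f x) in IH *.
rewrite -[RHS]/(mderiv (u :: v :: us ++ vs) f x) mderiv_swap ?size_cat //.
rewrite [RHS]mderiv_cons; apply: eq_bigr => i _; congr (_ * _); apply: IH.
exact: Ck_pderiv.
Qed.

Lemma mderiv_perm us vs f x : Ck (size us) f -> perm_eq us vs -> mderiv us f x = mderiv vs f x.
Proof.
elim: us vs f x => [|u us IH] vs f x Cf uv.
  by move: uv; rewrite perm_sym => /perm_nilP ->.
have uvs : u \in vs by rewrite -(perm_mem uv) mem_head.
case/splitPr: uvs uv => v1 v2 uv.
have {}uv : perm_eq us (v1 ++ v2) by rewrite -(perm_cons u) (permPl uv) perm_catC /= perm_cons perm_catC.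
rewrite mderiv_move; last by rewrite -size_cat -(perm_size uv).
rewrite !mderiv_cons; apply: eq_bigr => i _; congr (_ * _); apply: IH => //.
exact: Ck_pderiv.
Qed.

Lemma iter_pderiv_comm i (s : seq 'I_n) f : Ck (size s).+1 f ->
  iter_pderiv s (pderiv i f) = pderiv i (iter_pderiv s f).
Proof.
elim: s f => [|j s IH] f Cf //=; rewrite IH; last exact: CkS.
apply/funext => y; apply: pderiv_comm.
have H : forall (s : seq 'I_n) k g, Ck (size s + k) g -> Ck k (iter_pderiv s g).
  elim=> [|l r IHr] k g //= Cg; apply: Ck_pderiv; apply: IHr.
  by rewrite addnS -addSn.
by apply: H; rewrite addn2.
Qed.

Lemma Ck_iter_pderiv k (s : seq 'I_n) f : Ck (size s + k) f -> Ck k (iter_pderiv s f).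
Proof.
elim: s k f => [|l r IHr] k g //= Cg; apply: Ck_pderiv; apply: IHr.
by rewrite addnS -addSn.
Qed.

Lemma big_tuple_cons k (F : k.+1.-tuple 'I_n -> R) :
  \sum_(t : k.+1.-tuple 'I_n) F t = \sum_i \sum_(t : k.-tuple 'I_n) F [tuple of i :: t].
Proof.
rewrite pair_big /= (reindex (fun p : 'I_n * k.-tuple 'I_n => [tuple of p.1 :: p.2])) //=.
exists (fun t : k.+1.-tuple 'I_n => (thead t, [tuple of behead t])) => [[i t]|t] _ /=.
  by congr (_, _); apply: val_inj.
by rewrite -tuple_eta.
Qed.

Lemma mderivE us f x : Ck (size us) f ->
  mderiv us f x = \sum_(t : (size us).-tuple 'I_n)
    iter_pderiv t f x * \prod_(l < size us) nth 0 us l 0 (tnth t l).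
Proof.
elim: us f => [|u us IH] f Cf.
  rewrite (big_pred1 [tuple]) => [|t]; first by rewrite big_ord0 mulr1.
  by rewrite [t]tuple0; exact/esym/eqP.
rewrite [size _]/= big_tuple_cons mderiv_cons; apply: eq_bigr => i _.
rewrite IH; last exact: Ck_pderiv.
rewrite big_distrr /=; apply: eq_bigr => t _.
rewrite big_ord_recl /= tnth0 mulrCA -iter_pderiv_comm ?size_tuple //.
by congr (_ * (_ * _)); apply: eq_bigr => l _; rewrite tnthS.
Qed.

Lemma mderiv_consD u v us f x :
  mderiv (u + v :: us) f x = mderiv (u :: us) f x + mderiv (v :: us) f x.
Proof.
rewrite !mderiv_cons -big_split; apply: eq_bigr => i _ /=; by rewrite mxE mulrDl.
Qed.

Lemma mderiv_consZ c u us f x : mderiv (c *: u :: us) f x = c * mderiv (u :: us) f x.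
Proof.
by rewrite !mderiv_cons big_distrr; apply: eq_bigr => i _ /=; rewrite mxE mulrA.
Qed.

Lemma mderiv_cons0 us f x : mderiv (0 :: us) f x = 0.
Proof. by rewrite -(scale0r 0) mderiv_consZ mul0r. Qed.

Lemma is_derive_mderiv (T : eqType) (s : seq T) (U : T -> 'rV[R]_n -> 'rV[R]_n)
    (dU : T -> 'rV[R]_n) f x v :
  Ck (size s).+1 f ->
  {in s, forall r i, is_derive x v (fun y => U r y 0 i) (dU r 0 i)} ->
  is_derive x v (fun y => mderiv [seq U r y | r <- s] f y)
    (mderiv (v :: [seq U r x | r <- s]) f x
     + \sum_(r <- s) mderiv (dU r :: [seq U q x | q <- rem r s]) f x).
Proof.
elim: s f => [|r0 s IH] f Cf dUs.
  by rewrite big_nil addr0; exact: C1_derive.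
have H i := is_deriveMfun (dUs r0 (mem_head _ _) i)
  (IH (pderiv i f) (Ck_pderiv i Cf) (fun r rs => dUs r (mem_behead (s := r0 :: s) rs))).
have D := is_derive_sumr (index_enum 'I_n) H; refine (is_derive_eq D _).
rewrite big_split /= big_cons /= eqxx addrCA; congr (_ + _).
under eq_bigr do rewrite mulrDr.
rewrite big_split /=; congr (_ + _).
  rewrite -[LHS]/(mderiv (U r0 x :: v :: map (U ^~ x) s) f x).
  by rewrite mderiv_swap // size_map.
under eq_bigr do rewrite big_distrr /=.
rewrite exchange_big /=; apply: eq_big_seq => r rs.
rewrite -[LHS]/(mderiv (U r0 x :: dU r :: map (U ^~ x) (rem r s)) f x).
have szr : (size (rem r s)).+1 = size s.
  by rewrite size_rem // prednK //; case: (s) rs.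
rewrite mderiv_swap; last by rewrite size_map szr; apply: CkS.
rewrite mderiv_cons; apply: eq_bigr => i _; congr (_ * _); apply: mderiv_perm.
  have -> : size (U r0 x :: [seq U q x | q <- rem r s]) = size s by rewrite -szr /= size_map.
  exact: Ck_pderiv (CkS Cf).
rewrite -[U r0 x :: _]/(map (U ^~ x) (r0 :: rem r s)); apply: perm_map; case: eqP => [->|_] //.
by rewrite perm_sym perm_to_rem.
Qed.

End MultiDerivatives.

Lemma sub_morphD (U V : zmodType) (h : U -> V) :
  {morph h : x y / x - y} -> {morph h : x y / x + y}.
Proof.
move=> hB x y; have h0 : h 0 = 0 by rewrite -[X in h X](subr0 0) hB subrr.
by rewrite -{1}[y]opprK hB -[- y]sub0r hB h0 sub0r opprK.
Qed.

Section LinearExtension.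
Variables (K : choiceType) (V : zmodType).
Implicit Types (f : K -> V) (D : {freeg K / int}).

Definition lext f D : V := fglift (fun z => f z : zmodule V) D.

Lemma lext_is_additive f : {morph lext f : D1 D2 / D1 - D2}.
Proof. exact: (lift_is_additive (f : K -> zmodule V)). Qed.

Lemma lext0 f : lext f 0 = 0.
Proof. by rewrite -[X in lext f X](subr0 0) lext_is_additive subrr. Qed.

Lemma lextB f D1 D2 : lext f (D1 - D2) = lext f D1 - lext f D2.
Proof. exact: lext_is_additive. Qed.

Lemma lextD f D1 D2 : lext f (D1 + D2) = lext f D1 + lext f D2.
Proof. exact: (sub_morphD (lext_is_additive f)). Qed.

Lemma lext_sum (I : Type) (r : seq I) f (F : I -> {freeg K / int}) :
  lext f (\sum_(i <- r) F i) = \sum_(i <- r) lext f (F i).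
Proof. by elim: r => [|i r IH]; rewrite ?(big_nil, big_cons) ?lext0 // lextD IH. Qed.

Lemma lextU f k z : lext f << k *g z >> = f z *~ k.
Proof. exact: (liftU (f : K -> zmodule V)). Qed.

Lemma lextE f D : lext f D = \sum_(z <- dom D) f z *~ coeff z D.
Proof. by rewrite -[in LHS](freeg_sumE D) lext_sum; apply: eq_bigr => z _; rewrite lextU. Qed.

Lemma eq_lext f g D : {in dom D, f =1 g} -> lext f D = lext g D.
Proof. by move=> fg; rewrite !lextE; apply: eq_big_seq => z zD; rewrite fg. Qed.

End LinearExtension.

Lemma fglift_sum (K L : choiceType) (g : K -> {freeg L / int}) (D : {freeg K / int}) :
  fglift g D = \sum_(z <- dom D) coeff z D *: g z.
Proof.
have A := @lift_is_additive int K {freeg L / int} g.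
have A0 : fglift g 0 = 0 by rewrite -[X in fglift g X](subr0 0) A subrr.
have AD := sub_morphD A.
rewrite -[in LHS](freeg_sumE D).
elim: (dom D) => [|z r IH]; rewrite ?(big_nil, big_cons) ?A0 // AD IH liftU //.
Qed.

Lemma scale_freeg_mulz (L : choiceType) (k : int) (D : {freeg L / int}) : k *: D = D *~ k.
Proof. by rewrite -[k in LHS]intz scaler_int. Qed.

Lemma lextMz (L : choiceType) (V : zmodType) (f : L -> V) D (k : int) :
  lext f (D *~ k) = lext f D *~ k.
Proof.
have N n : lext f (D *+ n) = lext f D *+ n.
  by elim: n => [|n IH]; rewrite ?mulr0n ?lext0 // !mulrS lextD IH.
case: k => n; first by rewrite -!pmulrn N.
by rewrite NegzE !mulrNz -!pmulrn -sub0r lextB lext0 sub0r N.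
Qed.

Lemma lext_fglift (K L : choiceType) (V : zmodType) (f : L -> V)
    (g : K -> {freeg L / int}) D :
  lext f (fglift g D) = lext (fun z => lext f (g z)) D.
Proof.
rewrite fglift_sum lext_sum [RHS]lextE; apply: eq_bigr => z _.
by rewrite scale_freeg_mulz lextMz.
Qed.

Lemma lext_lin (K L : choiceType) (V : zmodType) (f : L -> V) (g : K -> L) D :
  lext f (lin g D) = lext (f \o g) D.
Proof. by rewrite /lin lext_fglift; apply: eq_lext => z _; rewrite lextU. Qed.

Section Homogeneous.
Implicit Types (K L : choiceType).

Definition homog K (sz : K -> nat) (m : nat) (D : {freeg K / int}) :=
  {in dom D, forall z, sz z = m}.

Lemma homog0 K (sz : K -> nat) m : homog sz m 0.
Proof. by move=> z; rewrite dom0. Qed.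

Lemma homogU K (sz : K -> nat) z : homog sz (sz z) << z >>.
Proof. by move=> y; rewrite domU1 inE => /eqP ->. Qed.

Lemma homogD K (sz : K -> nat) m D1 D2 : homog sz m D1 -> homog sz m D2 -> homog sz m (D1 + D2).
Proof. by move=> H1 H2 z /domD_subset; rewrite mem_cat => /orP[/H1|/H2]. Qed.

Lemma homogB K (sz : K -> nat) m D1 D2 : homog sz m D1 -> homog sz m D2 -> homog sz m (D1 - D2).
Proof. by move=> H1 H2; apply: homogD => // z; rewrite domN => /H2. Qed.

Lemma homog_sum K (sz : K -> nat) m (I : eqType) (r : seq I) (F : I -> {freeg K / int}) :
  {in r, forall i, homog sz m (F i)} -> homog sz m (\sum_(i <- r) F i).
Proof.
elim: r => [|i r IH] H; first by rewrite big_nil; exact: homog0.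
rewrite big_cons; apply: homogD; first by apply: H; rewrite mem_head.
by apply: IH => j jr; apply: H; rewrite inE jr orbT.
Qed.

Lemma homog_fglift K L (sz : K -> nat) m (g : L -> {freeg K / int}) D :
  {in dom D, forall z, homog sz m (g z)} -> homog sz m (fglift g D).
Proof.
move=> H; rewrite fglift_sum; apply: homog_sum => z zD y /domZ_subset; exact: H.
Qed.

Lemma homog_lin K L (sK : K -> nat) (sL : L -> nat) m m' (g : K -> L) D :
  homog sK m D -> (forall z, sK z = m -> sL (g z) = m') -> homog sL m' (lin g D).
Proof.
move=> HD H; apply: homog_fglift => z zD; rewrite -(H z (HD z zD)); exact: homogU.
Qed.

End Homogeneous.

Section ForestSizes.
Variable d : nat.
Implicit Types (tau rho : tree d) (w v : forest d).

Lemma perm_mset_cons tau w : perm_eq (tau +` w)%mset (tau :: w).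
Proof.
by apply/eq_seq_msetP; rewrite seq_mset_id mset_cons seq_mset_id.
Qed.

Lemma perm_mset_rem tau w : tau \in w -> perm_eq (w `\ tau)%mset (rem tau w).
Proof.
move=> tw; rewrite -(perm_cons tau) -(permPr (perm_to_rem tw)).
by rewrite perm_sym -{1}(msetB1K tw) perm_mset_cons.
Qed.

Lemma perm_mset_replace tau rho w : rho \in w ->
  perm_eq (tau +` (w `\ rho))%mset (tau :: rem rho w).
Proof.
by move=> rw; rewrite (permPl (perm_mset_cons _ _)) perm_cons perm_mset_rem.
Qed.

Lemma forest_sizeD1 tau w : forest_size (tau +` w)%mset = (tree_size tau + forest_size w)%N.
Proof. by rewrite /forest_size (perm_big _ (perm_mset_cons _ _)) big_cons. Qed.

Lemma size_msetD1 tau w : size (tau +` w)%mset = (size w).+1.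
Proof. by rewrite (perm_size (perm_mset_cons _ _)). Qed.

Lemma size_le_forest_size w : (size w <= forest_size w)%N.
Proof.
rewrite /forest_size -sum1_size; apply: leq_sum => tau _; exact: tree_size_gt0.
Qed.

Lemma forest_size_mset0 : forest_size (mset0 : forest d) = 0%N.
Proof. by rewrite /forest_size big_mset0. Qed.

Lemma forest_size_rem tau w : tau \in w ->
  forest_size w = (tree_size tau + forest_size (w `\ tau)%mset)%N.
Proof. by move=> tw; rewrite -{1}(msetB1K tw) forest_sizeD1. Qed.

Lemma size_rem_mset tau w : tau \in w -> size w = (size (w `\ tau)%mset).+1.
Proof. by move=> tw; rewrite -{1}(msetB1K tw) size_msetD1. Qed.

Lemma tree_size_mem tau w : tau \in w -> (tree_size tau <= forest_size w)%N.
Proof. by move=> tw; rewrite (forest_size_rem tw) leq_addr. Qed.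

Lemma leibniz_homog (g : tree d -> {freeg (tree d) / int}) w m :
  {in w, forall rho, homog (@tree_size d) (m + tree_size rho) (g rho)} ->
  homog (@forest_size d) (m + forest_size w) (leibniz g w).
Proof.
move=> H; apply: homog_sum => rho rw; apply: (homog_lin (H rho rw)) => z zE.
by rewrite forest_sizeD1 zE (forest_size_rem rw) addnA.
Qed.

Lemma leibniz_size (g : tree d -> {freeg (tree d) / int}) w :
  homog (fun v : forest d => size v) (size w) (leibniz g w).
Proof.
apply: homog_sum => rho rw; rewrite (size_rem_mset rw).
apply: (@homog_lin _ _ (fun=> 0%N) _ 0%N) => // z _; exact: size_msetD1.
Qed.

Lemma graft_homog tau rho : homog (@tree_size d) (tree_size tau + tree_size rho) (graft tau rho).
Proof.
have [m] := ubnP (tree_size rho); elim: m rho => // m IH rho; rewrite ltnS => rm.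
rewrite -(node_root_branches rho) in rm *; rewrite graftE tree_size_node in rm *.
set w := branches rho in rm *.
apply: (@homog_lin _ _ (@forest_size d) _ (tree_size tau + forest_size w)); last first.
  by move=> z zE; rewrite tree_size_node zE addnS.
apply: homogD; first by rewrite -forest_sizeD1; exact: homogU.
by apply: leibniz_homog => r rw; apply: IH; apply: leq_ltn_trans rm; exact: tree_size_mem.
Qed.

Lemma go_graft_rec_homog k w rho : size w = k ->
  homog (@tree_size d) (forest_size w + tree_size rho) (go_graft_rec k w rho).
Proof.
elim: k w rho => [|k IH] w rho wk /=.
  have -> : w = mset0 by apply/eqP; rewrite -size_mset_eq0 wk.
  by rewrite forest_size_mset0; exact: homogU.
have wk0 := wk; case E: (enum_mset w) wk => [|tau s] //= _.
have tw : tau \in w by rewrite -[tau \in w]/(tau \in enum_mset w) E mem_head.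
move: wk0; rewrite (size_rem_mset tw) => -[vk]; rewrite (forest_size_rem tw).
set v := (w `\ tau)%mset in vk *; rewrite -addnA; apply: homogB.
  by apply: homog_fglift => z zD; rewrite -(IH _ _ vk z zD); exact: graft_homog.
apply: homog_fglift => v' v'D; rewrite addnA.
have gh : {in v, forall r, homog (@tree_size d) (tree_size tau + tree_size r) (graft tau r)}.
  by move=> r _; exact: graft_homog.
rewrite -(leibniz_homog gh v'D).
by apply: IH; rewrite (leibniz_size v'D).
Qed.

Lemma go_graft_homog w rho :
  homog (@tree_size d) (forest_size w + tree_size rho) (go_graft w rho).
Proof. exact: go_graft_rec_homog. Qed.

End ForestSizes.

Section ElementaryDifferentials.
Variables (R : realType) (n d : nat) (sigma : 'I_d -> 'rV[R]_n -> 'rV[R]_n) (N : nat).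
Hypothesis sigmaC : forall (j : 'I_d) (a : 'I_n), Ck (N - 1) (fun y => sigma j y 0 a).
Implicit Types (tau rho : tree d) (w : forest d) (x y v : 'rV[R]_n).

Notation Ups := (Upsilon sigma).

Lemma mderivE_size k (us : seq 'rV[R]_n) f x : size us = k -> Ck k f ->
  mderiv us f x = \sum_(t : k.-tuple 'I_n)
    iter_pderiv t f x * \prod_(l < k) nth 0 us l 0 (tnth t l).
Proof. by move=> <-; exact: mderivE. Qed.

Lemma nth_fun (A B : Type) (z : B) (fs : seq (A -> B)) l (x : A) :
  nth (fun=> z) fs l x = nth z [seq f x | f <- fs] l.
Proof. by elim: fs l => [|f fs IH] [|l] //=. Qed.

Lemma canon_tree tau : Defs.canon (ptree_of_tree tau) = ptree_of_tree tau.
Proof. by case: tau => t /= /eqP. Qed.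

Lemma Upsilon_node j w x a : (size w <= N - 1)%N ->
  Ups (node j w) x 0 a = mderiv [seq Ups tau x | tau <- w] (fun y => sigma j y 0 a) x.
Proof.
move=> wN; rewrite /Upsilon /= mxE; set s := sort _ _.
have ps : perm_eq s [seq ptree_of_tree tau | tau <- w].
  rewrite perm_sort -map_comp (eq_map (g := @ptree_of_tree d)) // => tau /=.
  exact: canon_tree.
have Cs : Ck (size s) (fun y => sigma j y 0 a).
  by apply: Ck_le (sigmaC j a); rewrite (perm_size ps) size_map.
under eq_bigr do under eq_bigr do rewrite nth_fun -map_comp.
rewrite -(@mderivE_size (size s)) //; last by rewrite size_map.
apply: mderiv_perm; first by rewrite size_map.
by rewrite [X in perm_eq _ X](map_comp (fun u => elem_diff sigma u x)); exact: perm_map.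
Qed.

Lemma forest_size_node_le j w : (tree_size (node j w) <= N)%N -> (size w <= N - 1)%N.
Proof.
rewrite tree_size_node => wN; rewrite leq_subRL; last by apply: leq_ltn_trans wN.
by apply: leq_ltn_trans wN; exact: size_le_forest_size.
Qed.

Lemma Upsilon_Ck tau a : (tree_size tau <= N)%N -> Ck (N - tree_size tau) (fun y => Ups tau y 0 a).
Proof.
have [m] := ubnP (tree_size tau); elim: m tau a => // m IH tau a.
rewrite -(node_root_branches tau) ltnS; move: (tree_root tau) (branches tau) => j w wm wN.
have sN := forest_size_node_le wN.
have -> : (fun y => Ups (node j w) y 0 a) = (fun y => \sum_(t : (size w).-tuple 'I_n)
    (iter_pderiv t (fun y => sigma j y 0 a) y * \prod_(l < size w) Ups (nth tau w l) y 0 (tnth t l))).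
  apply/funext => y; rewrite Upsilon_node // (@mderivE_size (size w)) ?size_map //; last first.
    by apply: Ck_le (sigmaC j a).
  apply: eq_bigr => t _; congr (_ * _); apply: eq_bigr => l _.
  by rewrite (nth_map tau).
have wS := tree_size_node j w.
apply: Ck_sum => t _; apply: Ck_mul.
  apply: Ck_iter_pderiv; apply: Ck_le (sigmaC j a); rewrite size_tuple wS.
  by have := size_le_forest_size w; lia.
apply: Ck_prod => l _; have lw : nth tau w l \in w by exact: mem_nth.
have := tree_size_mem lw; rewrite wS in wm wN *.
set q := nth tau w l => qw.
have Cq : Ck (N - tree_size q) (fun y => Ups q y 0 (tnth t l)) by apply: IH; lia.
by apply: Ck_le Cq; lia.
Qed.

Definition DUps rho x v : 'rV[R]_n := \row_a grad_form (fun y => Ups rho y 0 a) x v.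

Lemma Upsilon_derive rho x v a : (tree_size rho < N)%N ->
  is_derive x v (fun y => Ups rho y 0 a) (DUps rho x v 0 a).
Proof.
move=> rN; rewrite mxE; apply: C1_derive.
by apply: (@Ck_le _ _ 1 (N - tree_size rho)); [lia|apply: Upsilon_Ck; exact: ltnW].
Qed.

Definition lUps (D : {freeg (tree d) / int}) x : 'rV[R]_n := lext (fun tau => Ups tau x) D.

Lemma mxE_lext (K : choiceType) (f : K -> 'rV[R]_n) D a :
  lext f D 0 a = lext (fun z => f z 0 a) D.
Proof.
rewrite !lextE summxE; apply: eq_bigr => z _.
by rewrite -scaler_int mxE mulrzl.
Qed.

Lemma mderiv_lext (K : choiceType) (f : K -> 'rV[R]_n) D us g x :
  lext (fun z => mderiv (f z :: us) g x) D = mderiv (lext f D :: us) g x.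
Proof.
rewrite !lextE.
elim: (dom D) => [|z r IH]; first by rewrite !big_nil mderiv_cons0.
rewrite !big_cons mderiv_consD -IH; congr (_ + _).
by rewrite -[f z *~ _]scaler_int mderiv_consZ mulrzl.
Qed.

Lemma is_derive_lext (K : choiceType) (f : K -> 'rV[R]_n -> R) (df : K -> R)
    (D : {freeg K / int}) x v :
  {in dom D, forall z, is_derive x v (f z) (df z)} ->
  is_derive x v (fun y => lext (fun z => f z y) D) (lext df D).
Proof.
move=> H; rewrite lextE; under eq_fun do rewrite lextE.
elim: (dom D) H => [|z r IH] H.
  by under eq_fun do rewrite big_nil; rewrite big_nil; exact: is_derive_cst.
under eq_fun do rewrite big_cons; rewrite big_cons; apply: is_deriveD.
  have := is_deriveMfun (H z (mem_head _ _)) (is_derive_cst ((coeff z D)%:~R : R) x v).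
  by rewrite mulr0 addr0 mulrzr; congr is_derive; apply/funext => y; rewrite mulrzr.
by apply: IH => y yr; apply: H; rewrite inE yr orbT.
Qed.

Lemma is_derive_leibniz w (g : tree d -> {freeg (tree d) / int}) G x v :
  Ck (size w).+1 G ->
  {in w, forall rho, tree_size rho < N}%N ->
  {in w, forall rho, lUps (g rho) x = DUps rho x v} ->
  is_derive x v (fun y => mderiv [seq Ups r y | r <- w] G y)
    (mderiv (v :: [seq Ups r x | r <- w]) G x
     + lext (fun w' : forest d => mderiv [seq Ups r x | r <- w'] G x) (leibniz g w)).
Proof.
move=> CG wN gw.
have H : {in enum_mset w, forall r i, is_derive x v (fun y => Ups r y 0 i) (DUps r x v 0 i)}.
  by move=> r rw i; apply: Upsilon_derive; exact: wN.
apply: (is_derive_eq (is_derive_mderiv CG H)); congr (_ + _).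
rewrite lext_sum; apply: eq_big_seq => rho rw; rewrite lext_lin -gw // -mderiv_lext.
apply: eq_lext => z _ /=.
apply/esym; have p := perm_mset_replace z rw.
rewrite (mderiv_perm _ _ (perm_map _ p)) //.
by apply: CkS; rewrite size_map size_msetD1 -(size_rem_mset rw).
Qed.

Lemma lUps_graft tau rho x : (tree_size tau + tree_size rho <= N)%N ->
  lUps (graft tau rho) x = DUps rho x (Ups tau x).
Proof.
have [m] := ubnP (tree_size rho); elim: m rho => // m IH rho.
rewrite -(node_root_branches rho) ltnS; move: (tree_root rho) (branches rho) => j w wm wN.
have wS := tree_size_node j w; have t0 := tree_size_gt0 tau; have sw := size_le_forest_size w.
apply/rowP => a.
rewrite graftE /lUps lext_lin lextD lextU mulr1z mxE /=.
have wN' : {in w, forall r, tree_size tau + tree_size r <= N}%N.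
  by move=> r rw; have := tree_size_mem rw; lia.
have Cs : Ck (size w).+1 (fun y => sigma j y 0 a) by apply: Ck_le (sigmaC j a); lia.
have gw : {in w, forall r, lUps (graft tau r) x = DUps r x (Ups tau x)}.
  by move=> r rw; apply: IH; [have := tree_size_mem rw; lia|exact: wN'].
have rN : {in w, forall r, tree_size r < N}%N by move=> r /wN'; lia.
have D1 := is_derive_leibniz Cs rN gw.
have D2 : is_derive x (Ups tau x) (fun y => Ups (node j w) y 0 a) (DUps (node j w) x (Ups tau x) 0 a).
  by apply: Upsilon_derive; lia.
have E : (fun y => Ups (node j w) y 0 a) =
         (fun y => mderiv [seq Ups r y | r <- w] (fun y => sigma j y 0 a) y).
  by apply/funext => y; apply: Upsilon_node; lia.
rewrite -(derive_val (is_derive := D2)) E (derive_val (is_derive := D1)); congr (_ + _).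
  rewrite Upsilon_node ?size_msetD1; last by lia.
  have p := perm_mset_cons tau w.
  by rewrite (mderiv_perm _ _ (perm_map _ p)) // size_map (perm_size p).
rewrite mxE_lext; apply: eq_lext => w' w'D /=; rewrite Upsilon_node // (leibniz_size w'D); lia.
Qed.

Lemma lUps_go_graft_rec k w rho x a : size w = k -> (forest_size w + tree_size rho <= N)%N ->
  lUps (go_graft_rec k w rho) x 0 a =
  mderiv [seq Ups r x | r <- w] (fun y => Ups rho y 0 a) x.
Proof.
elim: k w x a => [|k IH] w x a wk wN.
  rewrite /=; have -> : w = mset0 by apply/eqP; rewrite -size_mset_eq0 wk.
  by rewrite enum_mset0 /lUps lextU mulr1z.
have [tau [s E]] : exists tau s, enum_mset w = tau :: s.
  by case: (enum_mset w) wk => // t s _; exists t, s.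
have -> : go_graft_rec k.+1 w rho = fglift (graft tau) (go_graft_rec k (w `\ tau)%mset rho)
    - fglift (fun v' : forest d => go_graft_rec k v' rho) (graft_forest tau (w `\ tau)%mset).
  by rewrite /= E.
have tw : tau \in w by rewrite -[tau \in w]/(tau \in enum_mset w) E mem_head.
move: wk wN; rewrite (size_rem_mset tw) (forest_size_rem tw) => -[vk] wN.
have pw : perm_eq w (tau :: (w `\ tau)%mset) by rewrite -{1}(msetB1K tw) perm_mset_cons.
set v := (w `\ tau)%mset in vk wN pw *.
have t0 := tree_size_gt0 tau; have r0 := tree_size_gt0 rho; have sv := size_le_forest_size v.
have CU : Ck (N - tree_size rho) (fun y => Ups rho y 0 a) by apply: Upsilon_Ck; lia.
have CG : Ck (size v).+1 (fun y => Ups rho y 0 a) by apply: Ck_le CU; lia.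
have vN : {in v, forall r, tree_size r < N}%N by move=> r /tree_size_mem; lia.
have gv : {in v, forall r, lUps (graft tau r) x = DUps r x (Ups tau x)}.
  by move=> r /tree_size_mem rv; apply: lUps_graft; lia.
have D1 := is_derive_leibniz CG vN gv.
have D2 : is_derive x (Ups tau x) (fun y => lUps (go_graft_rec k v rho) y 0 a)
    (lext (fun t => DUps t x (Ups tau x) 0 a) (go_graft_rec k v rho)).
  under eq_fun do rewrite mxE_lext.
  by apply: is_derive_lext => t tD; apply: Upsilon_derive; rewrite (go_graft_rec_homog vk tD); lia.
have EE : (fun y => lUps (go_graft_rec k v rho) y 0 a) =
   (fun y => mderiv [seq Ups r y | r <- v] (fun y => Ups rho y 0 a) y).
  by apply/funext => y; apply: IH => //; lia.
rewrite /lUps lextB !lext_fglift !mxE.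
have -> : lext (fun z => lext (fun t => Ups t x) (graft tau z)) (go_graft_rec k v rho) 0 a =
    lext (fun t => DUps t x (Ups tau x) 0 a) (go_graft_rec k v rho).
  rewrite mxE_lext; apply: eq_lext => t tD.
  rewrite -lUps_graft // (go_graft_rec_homog vk tD); lia.
rewrite -(derive_val (is_derive := D2)) EE (derive_val (is_derive := D1)).
rewrite (mderiv_perm _ _ (perm_map (Ups ^~ x) pw)); last by rewrite size_map (perm_size pw) /=.
rewrite -[RHS]addr0 -addrA; congr (_ + _); apply/eqP; rewrite subr_eq0; apply/eqP.
rewrite mxE_lext; apply: eq_lext => v' v'D.
have gh : {in v, forall r, homog (@tree_size d) (tree_size tau + tree_size r) (graft tau r)}.
  by move=> r _; exact: graft_homog.
apply/esym; apply: IH; first by rewrite (leibniz_size v'D).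
by rewrite (leibniz_homog gh v'D); lia.
Qed.

Lemma lUps_go_graft w rho x a : (forest_size w + tree_size rho <= N)%N ->
  lUps (go_graft w rho) x 0 a =
  mderiv [seq Ups r x | r <- w] (fun y => Ups rho y 0 a) x.
Proof. exact: lUps_go_graft_rec. Qed.

End ElementaryDifferentials.

Section ForestEnumeration.
Variable d : nat.
Implicit Types (tau rho : tree d) (w : forest d).

Definition trees_le (m : nat) : seq (tree d) := fset_set [set tau : tree d | (tree_size tau <= m)%N].

Definition trees_eq (m : nat) : seq (tree d) := [seq tau <- trees_le m | tree_size tau == m].

Lemma mem_trees_le m tau : (tau \in trees_le m) = (tree_size tau <= m)%N.
Proof. by rewrite /trees_le in_fset_set ?in_setE; [apply/asboolP/idP|exact: finite_trees]. Qed.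

Lemma mem_trees_eq m tau : (tau \in trees_eq m) = (tree_size tau == m).
Proof. by rewrite mem_filter mem_trees_le; case: eqP => //= ->; rewrite leqnn. Qed.

Lemma trees_le_uniq m : uniq (trees_le m).
Proof. exact: fset_uniq. Qed.

Lemma trees_eq_uniq m : uniq (trees_eq m).
Proof. exact: filter_uniq (trees_le_uniq m). Qed.

Lemma finite_forests m : finite_set [set w : forest d | (forest_size w <= m)%N].
Proof.
apply: (@sub_finite_set _ _ ((@branches d) @` [set tau : tree d | (tree_size tau <= m.+1)%N]
                              `|` [set (mset0 : forest d)])).
  move=> w /= wm; have [->|[tau tw]] := mset_0Vmem w; first by right.
  left; exists (node (tree_root tau) w); last exact: branches_node.
  by rewrite /= tree_size_node.
rewrite finite_setU; split; last exact: finite_set1.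
by apply: finite_image; exact: finite_trees.
Qed.

Definition forests_le (m : nat) : seq (forest d) := fset_set [set w : forest d | (forest_size w <= m)%N].

Lemma mem_forests_le m w : (w \in forests_le m) = (forest_size w <= m)%N.
Proof. by rewrite /forests_le in_fset_set ?in_setE; [apply/asboolP/idP|exact: finite_forests]. Qed.

Lemma forests_le_uniq m : uniq (forests_le m).
Proof. exact: fset_uniq. Qed.

Lemma big_trees_le (V : zmodType) m (F : tree d -> V) :
  \sum_(tau <- trees_le m) F tau = \sum_(l < m) \sum_(tau <- trees_eq l.+1) F tau.
Proof.
elim: m => [|m IH].
  rewrite big_ord0 big1_seq // => tau /andP[_]; rewrite mem_trees_le.
  by have := tree_size_gt0 tau; lia.
rewrite big_ord_recr /= -IH (bigID (fun tau => tree_size tau == m.+1)) /= addrC; congr (_ + _).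
  rewrite -big_filter; apply: perm_big; apply: uniq_perm; rewrite ?filter_uniq ?trees_le_uniq //.
  by move=> tau; rewrite mem_filter !mem_trees_le; lia.
by rewrite -big_filter.
Qed.

Lemma forests_le0 : forests_le 0 = [:: mset0].
Proof.
apply: perm_small_eq => //; apply: uniq_perm; rewrite ?forests_le_uniq //.
move=> w; rewrite mem_forests_le inE leqn0 -size_mset_eq0.
apply/idP/idP => [/eqP w0|w0]; first by have := size_le_forest_size w; rewrite w0 leqn0.
by move: w0; rewrite size_mset_eq0 => /eqP ->; rewrite forest_size_mset0.
Qed.

Lemma big_forests_mem (V : zmodType) k tau (F : forest d -> V) : (tree_size tau <= k)%N ->
  \sum_(w <- forests_le k | tau \in w) F w =
  \sum_(w <- forests_le (k - tree_size tau)) F (tau +` w)%mset.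
Proof.
move=> tk; rewrite -big_filter -(big_map (fun w => tau +` w)%mset xpredT F).
apply: perm_big; apply: uniq_perm; first by rewrite filter_uniq ?forests_le_uniq.
  rewrite map_inj_uniq ?forests_le_uniq // => v w E.
  by rewrite -(msetD1K tau v) E msetD1K.
move=> w; rewrite mem_filter mem_forests_le; apply/andP/mapP => [[tw wk]|[v]].
  exists (w `\ tau)%mset; last by rewrite msetB1K.
  by rewrite mem_forests_le; move: wk; rewrite (forest_size_rem tw); lia.
rewrite mem_forests_le => vk ->; split; first exact: mset1D1.
by rewrite forest_sizeD1; lia.
Qed.

Lemma forest_piD1 tau w : forest_pi (tau +` w)%mset = ((w tau).+1 * forest_pi w)%N.
Proof.
pose A := (tau |` finsupp w)%fset.
have ext v : (finsupp v `<=` A)%fset -> forest_pi v = (\prod_(rho <- A) (v rho)`!)%N.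
  move=> vA; rewrite /forest_pi; apply: big_fset_incl => // rho _.
  by rewrite msuppE => /mset_eq0P ->.
rewrite !ext; last 2 first.
- by apply/fsubsetP => rho; rewrite !inE => ->; rewrite orbT.
- by apply/fsubsetP => rho; rewrite !msuppE in_mset1D !inE msuppE.
rewrite [LHS](big_fsetD1 tau) ?fset1U1 //= [X in _ = (_ * X)%N](big_fsetD1 tau) ?fset1U1 //=.
rewrite mset1DE eqxx add1n factS mulnA; congr (_ * _)%N.
apply: eq_big_seq => rho; rewrite in_fsetD1 => /andP[rt _].
by rewrite mset1DE (negPf rt).
Qed.

Lemma forest_pi_gt0 w : (0 < forest_pi w)%N.
Proof. by apply: prodn_gt0 => tau; exact: fact_gt0. Qed.

Lemma forest_pi0 : forest_pi (mset0 : forest d) = 1%N.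
Proof. by rewrite /forest_pi big1_seq // => tau; rewrite mset0E. Qed.

Lemma forest_size_count k w : (forest_size w <= k)%N ->
  forest_size w = (\sum_(tau <- trees_le k | tau \in w) w tau * tree_size tau)%N.
Proof.
move=> wk; rewrite /forest_size sum_mset.
have p : perm_eq (finsupp w) [seq tau <- trees_le k | tau \in w].
  apply: uniq_perm; rewrite ?fset_uniq ?filter_uniq ?trees_le_uniq // => tau.
  rewrite mem_filter msuppE mem_trees_le; apply/idP/andP => [tw|[]//]; split=> //.
  exact: leq_trans (tree_size_mem tw) wk.
by rewrite -[RHS]big_filter -(perm_big _ p).
Qed.

End ForestEnumeration.

Section TaylorPolynomials.
Variables (R : realType) (n d : nat) (c : tree d -> R) (u : tree d -> 'rV[R]_n) (x : 'rV[R]_n).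
Implicit Types (tau : tree d) (w : forest d) (G : 'rV[R]_n -> R).

Definition fprod w : R := \prod_(tau <- w) c tau.

Lemma fprodD1 tau w : fprod (tau +` w)%mset = c tau * fprod w.
Proof. by rewrite /fprod (perm_big _ (perm_mset_cons _ _)) big_cons. Qed.

Lemma fprod0 : fprod mset0 = 1.
Proof. by rewrite /fprod big_mset0. Qed.

Definition fweight w : R := fprod w / (forest_pi w)%:R.

Definition tpoly k G : {poly R} :=
  \sum_(w <- forests_le d k) (fweight w * mderiv [seq u tau | tau <- w] G x) *: 'X^(forest_size w).

Lemma tpolyE k G s :
  (tpoly k G).[s] = \sum_(w <- forests_le d k)
     s ^+ forest_size w * (fweight w * mderiv [seq u tau | tau <- w] G x).
Proof.
rewrite horner_sum; apply: eq_bigr => w _.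
by rewrite hornerZ hornerXn mulrC.
Qed.

Lemma size_tpoly k G : (size (tpoly k G) <= k.+1)%N.
Proof.
apply: (leq_trans (size_sum _ _ _)); apply/bigmax_leqP_seq => w; rewrite mem_forests_le => wk _.
apply: (leq_trans (size_scale_leq _ _)); by rewrite size_polyXn.
Qed.

Lemma tpoly0 G : tpoly 0 G = (G x)%:P.
Proof.
rewrite /tpoly forests_le0 big_seq1 forest_size_mset0 expr0 /fweight fprod0 forest_pi0.
by rewrite enum_mset0 /= divr1 mul1r alg_polyC.
Qed.

Lemma tpoly_horner0 k G : (tpoly k G).[0] = G x.
Proof.
rewrite tpolyE (bigD1_seq mset0) ?forests_le_uniq //=; last first.
  by rewrite mem_forests_le forest_size_mset0.
rewrite forest_size_mset0 expr0 /fweight fprod0 forest_pi0 enum_mset0 /= divr1 !mul1r.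
rewrite big1_seq ?addr0 // => w /andP[w0 _].
rewrite expr0n; have -> : (forest_size w == 0)%N = false; last by rewrite mul0r.
apply/negbTE; rewrite -lt0n; apply: leq_trans (size_le_forest_size w).
by rewrite lt0n size_mset_eq0.
Qed.

Lemma fweightD1 tau w : (w tau).+1%:R * fweight (tau +` w)%mset = c tau * fweight w.
Proof.
rewrite /fweight fprodD1 forest_piD1 natrM invfM.
have p0 : (w tau).+1%:R != 0 :> R by rewrite pnatr_eq0.
have q0 : (forest_pi w)%:R != 0 :> R by rewrite pnatr_eq0 -lt0n forest_pi_gt0.
by move: p0 q0; move: (w tau).+1%:R (forest_pi w)%:R => a b a0 b0; field; rewrite a0 b0.
Qed.

Lemma deriv_tpoly k G : Ck k G ->
  (tpoly k G)^`() = \sum_(tau <- trees_le d k)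
    ((tree_size tau)%:R * c tau) *: ('X^((tree_size tau).-1)
        * tpoly (k - tree_size tau) (fun y => grad_form G y (u tau))).
Proof.
move=> CG; rewrite /tpoly raddf_sum /=.
pose F w tau := ((w tau * tree_size tau)%:R * (fweight w * mderiv [seq u tau | tau <- w] G x))
    *: 'X^((forest_size w).-1) : {poly R}.
transitivity (\sum_(w <- forests_le d k) \sum_(tau <- trees_le d k | tau \in w) F w tau).
  apply: eq_big_seq => w; rewrite mem_forests_le => wk.
  rewrite derivZ derivXn -scaler_nat scalerA mulrC {1}(forest_size_count wk) natr_sum.
  by rewrite mulr_suml scaler_suml.
rewrite (exchange_big_dep xpredT) //=; apply: eq_big_seq => tau; rewrite mem_trees_le => tk.
rewrite big_forests_mem // mulr_sumr scaler_sumr; apply: eq_big_seq => w.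
rewrite mem_forests_le => wk.
have Cw : Ck (size (w : forest d)).+1 G.
  apply: Ck_le CG; have := size_le_forest_size w; have := tree_size_gt0 tau; lia.
have XM (a b : nat) (m : R) : 'X^a * (m *: 'X^b) = m *: 'X^(a + b) :> {poly R}.
  by rewrite -scalerAr -exprD.
rewrite /F mset1DE eqxx add1n XM scalerA forest_sizeD1.
rewrite (mderiv_perm x _ (perm_map u (perm_mset_cons tau w))); last first.
  by rewrite size_map size_msetD1.
rewrite map_cons -mderiv_grad ?size_map //.
have -> : ((tree_size tau + forest_size w).-1 = (tree_size tau).-1 + forest_size w)%N.
  by have := tree_size_gt0 tau; lia.
congr (_ *: _); set M := mderiv _ _ _; rewrite natrM.
transitivity ((tree_size tau)%:R * ((w tau).+1%:R * fweight (tau +` w)%mset) * M); first by ring.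
by rewrite fweightD1; ring.
Qed.

End TaylorPolynomials.

Section SmallFunctions.
Variable R : realType.
Implicit Types (f g : R -> R) (s r e : R).

Definition small k f := forall e, 0 < e -> exists2 dl : R, 0 < dl &
  forall s, 0 < s -> s < dl -> `|f s| <= e * s ^+ k.

Lemma small_add k f g : small k f -> small k g -> small k (fun s => f s + g s).
Proof.
move=> sf sg e e0; have e2 : 0 < e / 2 by rewrite divr_gt0.
have [d1 d10 H1] := sf _ e2; have [d2 d20 H2] := sg _ e2.
exists (Num.min d1 d2); first by rewrite lt_min d10.
move=> s s0; rewrite lt_min => /andP[s1 s2].
by rewrite (splitr e) mulrDl; apply: le_trans (ler_normD _ _) (lerD (H1 _ s0 s1) (H2 _ s0 s2)).
Qed.

Lemma small0 k : small k (fun=> 0).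
Proof. by move=> e e0; exists 1 => // s s0 _; rewrite normr0 mulr_ge0 ?exprn_ge0 // ltW. Qed.

Lemma small_sum k (I : eqType) (r : seq I) (F : I -> R -> R) :
  {in r, forall i, small k (F i)} -> small k (fun s => \sum_(i <- r) F i s).
Proof.
elim: r => [|i r IH] H.
  by under eq_fun do rewrite big_nil; exact: small0.
under eq_fun do rewrite big_cons; apply: small_add; first by apply: H; rewrite mem_head.
by apply: IH => j jr; apply: H; rewrite inE jr orbT.
Qed.

Lemma small_scale k (a : R) f : small k f -> small k (fun s => a * f s).
Proof.
move=> sf e e0; have a1 : 0 < `|a| + 1 by rewrite ltr_wpDl.
have [dl dl0 H] := sf (e / (`|a| + 1)) (divr_gt0 e0 a1).
exists dl => // s s0 sd; rewrite normrM.
apply: le_trans (ler_wpM2l (normr_ge0 _) (H s s0 sd)) _.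
rewrite mulrA ler_wpM2r ?exprn_ge0 ?(ltW s0) // mulrC -mulrA ger_pMr // mulrC ler_pdivrMr //.
by rewrite mul1r lerDl.
Qed.

Lemma small_shift j k f : small k f -> small (j + k) (fun s => s ^+ j * f s).
Proof.
move=> sf e /sf[dl dl0 H]; exists dl => // s s0 sd.
by rewrite normrM exprD mulrCA ger0_norm ?exprn_ge0 ?(ltW s0) // ler_wpM2l ?exprn_ge0 ?(ltW s0) // H.
Qed.

Lemma small_eq k f g : (forall s, 0 < s -> f s = g s) -> small k f -> small k g.
Proof. by move=> fg sf e /sf[dl dl0 H]; exists dl => // s s0 sd; rewrite -fg // H. Qed.

Lemma small_bounded k f (C d0 : R) : 0 < d0 ->
  (forall s, 0 < s -> s < d0 -> `|f s| <= C * s ^+ k.+1) -> small k f.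
Proof.
move=> d00 H e e0; have C1 : 0 < `|C| + 1 by rewrite ltr_wpDl.
exists (Num.min d0 (e / (`|C| + 1))); first by rewrite lt_min d00 divr_gt0.
move=> s s0; rewrite lt_min => /andP[sd]; rewrite ltr_pdivlMr // => sC.
apply: (le_trans (H s s0 sd)); rewrite exprS mulrA ler_wpM2r ?exprn_ge0 ?(ltW s0) //.
apply: le_trans (ltW sC); rewrite mulrC ler_wpM2l ?(ltW s0) //.
by apply: le_trans (ler_norm C) _; rewrite lerDl.
Qed.

Lemma MVT_bound (f df : R -> R) (B s : R) : 0 <= s ->
  (forall r : R, is_derive r 1 f (df r)) ->
  (forall r, 0 < r -> r < s -> `|df r| <= B) -> `|f s - f 0| <= B * s.
Proof.
rewrite le_eqVlt => /predU1P[<-|s0] Df Hd; first by rewrite subrr normr0 mulr0.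
have cf : {within `[0, s], continuous f}.
  by apply: continuous_subspaceT => r; apply: differentiable_continuous; exact/derivable1_diffP.
have [r] := MVT s0 (fun r _ => Df r) cf.
rewrite in_itv /= subr0 => /andP[r0 rs] ->; rewrite normrM (gtr0_norm s0).
by rewrite ler_wpM2r ?(ltW s0) // Hd.
Qed.

Lemma small_integral k (f df : R -> R) : (forall r : R, is_derive r 1 f (df r)) ->
  f 0 = 0 -> small k df -> small k.+1 f.
Proof.
move=> Df f0 sdf e e0; have [dl dl0 H] := sdf e e0; exists dl => // s s0 sd.
have := @MVT_bound f df (e * s ^+ k) s (ltW s0) Df.
rewrite f0 subr0 -mulrA -exprSr; apply=> r r0 rs.
apply: le_trans (H r r0 (lt_trans rs sd)) _; rewrite ler_wpM2l ?(ltW e0) //.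
by rewrite lerXn2r ?nnegrE ?(ltW r0) ?(ltW s0) ?(ltW rs).
Qed.

Lemma small_cvg0 f : continuous f -> f 0 = 0 -> small 0 f.
Proof.
move=> cf f0 e e0.
have /cvgrPdistC_le/(_ e e0)/nbhs_ballP[dl /= dl0 H] := cf 0.
exists dl => // s s0 sd; have := H s; rewrite f0 subr0 expr0 mulr1; apply.
by rewrite /ball /= sub0r normrN gtr0_norm.
Qed.

Lemma small_le j k f : (j <= k)%N -> small k f -> small j f.
Proof.
move=> jk sf e e0; have [dl dl0 H] := sf e e0.
exists (Num.min dl 1); first by rewrite lt_min dl0 ltr01.
move=> s s0; rewrite lt_min => /andP[sd s1].
apply: (le_trans (H s s0 sd)); rewrite ler_wpM2l ?(ltW e0) //.
by rewrite ler_wiXn2l ?(ltW s0) ?(ltW s1).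
Qed.

Lemma small_const (a : R) : small 0 (fun=> a) -> a = 0.
Proof.
move=> sm; apply/eqP; rewrite -normr_le0; apply/ler_addgt0Pr => e e0; rewrite add0r.
have [dl dl0 H] := sm e e0.
have h0 : 0 < dl / 2 by rewrite divr_gt0.
have hd : dl / 2 < dl by rewrite ltr_pdivrMr // ltr_pMr // ltr1n.
by have := H _ h0 hd; rewrite expr0 mulr1.
Qed.

Lemma small_horner0 k (Q : {poly R}) : small k (horner Q) -> Q.[0] = 0.
Proof.
move=> sQ; apply/eqP; rewrite -oppr_eq0; apply/eqP; apply: small_const.
have s1 : small 0 (fun s => Q.[s] - Q.[0]).
  apply: small_cvg0; last by rewrite subrr.
  move=> s; have C := @continuousB _ _ _ (horner Q) (fun=> Q.[0]) s.
  by apply: C; [exact: continuous_horner|exact: cst_continuous].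
have s2 := small_scale (-1) (small_le (leq0n k) sQ).
by apply: small_eq (small_add s1 s2) => s _; ring.
Qed.

Lemma small_horner_eq0 k (Q : {poly R}) : (size Q <= k.+1)%N -> small k (horner Q) -> Q = 0.
Proof.
elim: k Q => [|k IH] Q sQ sm; have Q0 := small_horner0 sm.
  by move: Q0; rewrite (size1_polyC sQ) hornerC => ->; rewrite polyC0.
have /factor_theorem[q qE] : root Q 0 by apply/eqP.
rewrite subr0 in qE; rewrite qE in sQ sm *.
have [->|q0] := eqVneq q 0; first by rewrite mul0r.
rewrite size_mulX // ltnS in sQ; rewrite (IH q) ?mul0r //.
move=> e /sm[dl dl0 H]; exists dl => // s s0 sd; have := H s s0 sd.
by rewrite hornerMX normrM (gtr0_norm s0) exprSr mulrA ler_pM2r.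
Qed.

Lemma small_powR k f (C b d0 : R) : 0 < b -> 0 < d0 ->
  (forall s, 0 < s -> s < d0 -> `|f s| <= C * s ^+ k * s `^ b) -> small k f.
Proof.
move=> b0 d00 H e e0; have C1 : 0 < `|C| + 1 by rewrite ltr_wpDl.
pose q := (e / (`|C| + 1)) `^ b^-1.
have q0 : 0 < q by rewrite powR_gt0 // divr_gt0.
exists (Num.min d0 q); first by rewrite lt_min d00.
move=> s s0; rewrite lt_min => /andP[sd sq].
apply: (le_trans (H s s0 sd)); rewrite mulrAC ler_wpM2r ?exprn_ge0 ?(ltW s0) //.
have sb : s `^ b <= e / (`|C| + 1).
  have -> : e / (`|C| + 1) = q `^ b by rewrite -powRrM mulVf ?gt_eqF // powRr1 // ltW // divr_gt0.
  by apply: ge0_ler_powR; rewrite ?nnegrE ?(ltW b0) ?(ltW s0) ?(ltW q0) ?(ltW sq).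
apply: (@le_trans _ _ ((`|C| + 1) * s `^ b)).
  by rewrite ler_wpM2r ?powR_ge0 //; apply: le_trans (ler_norm C) _; rewrite lerDl.
by rewrite mulrC -ler_pdivlMr.
Qed.

End SmallFunctions.

Section TaylorAlongCurves.
Variables (R : realType) (n d N : nat).
Implicit Types (x y : 'rV[R]_n) (v : nat -> 'rV[R]_n) (s r e : R) (G : 'rV[R]_n -> R).

Definition curve x v s : 'rV[R]_n := x + \sum_(l < N) s ^+ l.+1 *: v l.

Definition dcurve v s : 'rV[R]_n := \sum_(l < N) (l.+1%:R * s ^+ l) *: v l.

Lemma curve0 x v : curve x v 0 = x.
Proof. by rewrite /curve big1 ?addr0 // => l _; rewrite expr0n /= scale0r. Qed.

Lemma is_derive_monomial m (u : 'rV[R]_n) s :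
  is_derive s 1 (fun r : R => r ^+ m.+1 *: u) ((m.+1%:R * s ^+ m) *: u).
Proof.
have dX : differentiable (fun r : R => r ^+ m.+1) s.
  by apply/derivable1_diffP; exact: exprn_derivable.
have dZ : differentiable (fun r : R => r ^+ m.+1 *: u) s by exact: differentiableZl.
apply: DeriveDef; first exact: diff_derivable.
rewrite deriveE // diffZl // -deriveE // exp_derive /=.
by rewrite scaler1.
Qed.

Lemma is_derive_curve x v s : is_derive s 1 (curve x v) (dcurve v s).
Proof.
have H : forall t : seq 'I_N, is_derive s 1 (fun r => \sum_(l <- t) r ^+ l.+1 *: v l)
    (\sum_(l <- t) (l.+1%:R * s ^+ l) *: v l).
  elim=> [|l t IH].
    by under eq_fun do rewrite big_nil; rewrite big_nil; exact: is_derive_cst.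
  under eq_fun do rewrite big_cons; rewrite big_cons.
  exact: (is_deriveD (is_derive_monomial _ _ _) IH).
have := is_deriveD (is_derive_cst x s 1) (H (index_enum 'I_N)); rewrite add0r.
exact.
Qed.

Lemma is_derive_along G x v s : Ck 1 G ->
  is_derive s 1 (fun r => G (curve x v r)) (grad_form G (curve x v s) (dcurve v s)).
Proof.
move=> CG; have dG := C1_diff (curve x v s) CG.
have dy := is_derive_curve x v s.
have dfy : differentiable (curve x v) s by apply/derivable1_diffP.
have dfG : differentiable G (curve x v s) by exact: ex_diff.
have dc : differentiable (G \o curve x v) s by exact: differentiable_comp.
rewrite -[fun r => _]/(G \o curve x v); apply: DeriveDef; first exact: diff_derivable.
have dE : 'd (curve x v) s (1 : R) = dcurve v s.
  by rewrite -deriveE // (derive_val (is_derive := dy)).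
rewrite deriveE // diff_comp // /= dE.
by rewrite (diff_val (is_diff_def := dG)).
Qed.

Lemma is_derive_horner (p : {poly R}) s : is_derive s 1 (horner p) (p^`()).[s].
Proof.
by apply: DeriveDef; [exact: derivable_horner|rewrite -derive1E -derivE].
Qed.

Lemma grad_form_sum G y (I : Type) (t : seq I) (a : I -> R) (F : I -> 'rV[R]_n) :
  grad_form G y (\sum_(i <- t) a i *: F i) = \sum_(i <- t) a i * grad_form G y (F i).
Proof. by rewrite linear_sum; apply: eq_bigr => i _; rewrite linearZ. Qed.

Lemma grad_form_cts G (u : 'rV[R]_n) : Ck 1 G -> continuous (fun y => grad_form G y u).
Proof. by move=> CG; exact: (Ck_continuous (Ck_grad_form u CG)). Qed.

Lemma curve_continuous x v : continuous (curve x v).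
Proof.
move=> s; apply: differentiable_continuous; apply/derivable1_diffP.
by have := is_derive_curve x v s.
Qed.

Lemma along_continuous G x v : continuous G -> continuous (fun s => G (curve x v s)).
Proof. by move=> cG s; apply: continuous_comp; [exact: curve_continuous|exact: cG]. Qed.

Variables (c : tree d -> R).

Definition tree_velocity k (u : tree d -> 'rV[R]_n) v :=
  forall l, (l < k)%N -> v l = \sum_(tau <- trees_eq d l.+1) c tau *: u tau.

Lemma grad_form_dcurve G y k u v s : (k <= N)%N -> tree_velocity k u v ->
  grad_form G y (dcurve v s) =
  \sum_(tau <- trees_le d k) ((tree_size tau)%:R * c tau) *
     (s ^+ (tree_size tau).-1 * grad_form G y (u tau))
  + \sum_(l < N | (k <= l)%N) (l.+1%:R * s ^+ l) * grad_form G y (v l).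
Proof.
move=> kN vE; rewrite grad_form_sum (bigID (fun l : 'I_N => (k <= l)%N)) /= addrC; congr (_ + _).
rewrite big_trees_le.
under eq_bigl do rewrite -ltnNge.
rewrite -(big_ord_widen N (fun l => l.+1%:R * s ^+ l * grad_form G y (v l)) kN).
apply: eq_bigr => l _; rewrite vE // grad_form_sum mulr_sumr.
apply: eq_big_seq => tau; rewrite mem_trees_eq => /eqP -> /=; ring.
Qed.

Lemma taylor_small k G u x v : Ck k G -> (k <= N)%N -> tree_velocity k u v ->
  small k (fun s => G (curve x v s) - (tpoly c u x k G).[s]).
Proof.
have [m] := ubnP k; elim: m k G => // m IH [|k] G; rewrite ltnS => km CG kN vE.
  apply: small_cvg0; last by rewrite curve0 tpoly0 hornerC subrr.
  move=> s; have C := @continuousB _ _ _ (fun s => G (curve x v s)) (horner (tpoly c u x 0 G)) s.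
  apply: C; last exact: continuous_horner.
  by apply: along_continuous; exact: Ck_continuous CG.
have C1 : Ck 1 G by apply: Ck_le CG.
have D s : is_derive s 1 (fun s => G (curve x v s) - (tpoly c u x k.+1 G).[s])
    (grad_form G (curve x v s) (dcurve v s) - (tpoly c u x k.+1 G)^`().[s]).
  exact: (is_deriveB (is_derive_along x v s C1) (is_derive_horner _ s)).
apply: (small_integral D); first by rewrite curve0 tpoly_horner0 subrr.
pose H tau s := grad_form G (curve x v s) (u tau)
  - (tpoly c u x (k.+1 - tree_size tau) (fun y => grad_form G y (u tau))).[s].
have E s : 0 < s -> \sum_(tau <- trees_le d k.+1) ((tree_size tau)%:R * c tau) *
       (s ^+ (tree_size tau).-1 * H tau s)
     + \sum_(l <- [seq l : 'I_N <- enum 'I_N | (k.+1 <= l)%N])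
         (l.+1%:R * (s ^+ l * grad_form G (curve x v s) (v l))) =
   grad_form G (curve x v s) (dcurve v s) - (tpoly c u x k.+1 G)^`().[s].
  move=> _; rewrite (@grad_form_dcurve _ _ k.+1 u) // deriv_tpoly // horner_sum.
  rewrite addrAC; congr (_ + _); last first.
    by rewrite big_filter big_enum_cond /=; apply: eq_big => // l _; rewrite mulrA.
  rewrite -sumrB; apply: eq_bigr => tau _.
  by rewrite hornerZ hornerM hornerXn -mulrBr -mulrBr.
apply: (small_eq E); apply: small_add.
  apply: small_sum => tau; rewrite mem_trees_le => tk; apply: small_scale.
  have t0 := tree_size_gt0 tau.
  have -> : (k = (tree_size tau).-1 + (k.+1 - tree_size tau))%N by lia.
  apply: small_shift; apply: IH; [lia| |lia|].
    by apply: Ck_grad_form; apply: Ck_le CG; lia.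
  by move=> l lk; apply: vE; lia.
apply: small_sum => l; rewrite mem_filter => /andP[kl _]; apply: small_scale.
have cg : continuous (fun s => grad_form G (curve x v s) (v l)).
  exact: (@along_continuous (fun y => grad_form G y (v l)) x v (grad_form_cts C1)).
have /cvgrPdistC_le/(_ _ ltr01)/nbhs_ballP[dl /= dl0 Hd] := cg 0.
apply: (@small_bounded _ _ _ (`|grad_form G x (v l)| + 1) (Num.min dl 1)).
  by rewrite lt_min dl0 ltr01.
move=> s s0; rewrite lt_min => /andP[sd s1].
rewrite normrM mulrC ler_pM //.
  have B : ball 0 dl s by rewrite /ball /= sub0r normrN gtr0_norm.
  have := Hd s B; rewrite curve0 => Hs.
  rewrite -lerBlDl; apply: le_trans Hs; exact: lerB_dist.
by rewrite ger0_norm ?exprn_ge0 ?(ltW s0) // ler_wiXn2l ?(ltW s0) ?(ltW s1).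
Qed.

End TaylorAlongCurves.

Section EuclideanNorm.
Variables (R : realType) (n : nat).
Implicit Types (x y z : 'rV[R]_n).

Lemma enorm_ge0 x : 0 <= enorm x.
Proof. exact: sqrtr_ge0. Qed.

Lemma sum_sqr_ge0 x : 0 <= \sum_i x 0 i ^+ 2.
Proof. by apply: sumr_ge0 => i _; exact: sqr_ge0. Qed.

Lemma sqr_enorm x : enorm x ^+ 2 = \sum_i x 0 i ^+ 2.
Proof. by rewrite sqr_sqrtr // sum_sqr_ge0. Qed.

Lemma enorm_coord x i : `|x 0 i| <= enorm x.
Proof.
rewrite -(ler_pXn2r (ltn0Sn 1)) ?nnegrE ?enorm_ge0 // sqr_enorm real_normK ?num_real //.
rewrite (bigD1 i) //= lerDl; apply: sumr_ge0 => j _; exact: sqr_ge0.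
Qed.

Lemma enorm_le_sum x : enorm x <= \sum_i `|x 0 i|.
Proof.
have S0 : 0 <= \sum_i `|x 0 i| by apply: sumr_ge0.
rewrite -(ler_pXn2r (ltn0Sn 1)) ?nnegrE ?enorm_ge0 // sqr_enorm expr2 mulr_suml.
apply: ler_sum => i _; rewrite -real_normK ?num_real // expr2 ler_wpM2l //.
by rewrite (bigD1 i) //= lerDl; apply: sumr_ge0.
Qed.

Lemma enormZ (a : R) x : enorm (a *: x) = `|a| * enorm x.
Proof.
rewrite /enorm -sqrtr_sqr -sqrtrM ?sqr_ge0 //; congr Num.sqrt.
by rewrite mulr_sumr; apply: eq_bigr => i _; rewrite mxE exprMn.
Qed.

Lemma enorm0 : enorm (0 : 'rV[R]_n) = 0.
Proof. by rewrite -(scale0r 0) enormZ normr0 mul0r. Qed.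

Lemma enormN x : enorm (- x) = enorm x.
Proof. by rewrite -scaleN1r enormZ normrN1 mul1r. Qed.

Lemma enorm_eq0 x : enorm x = 0 -> x = 0.
Proof.
move=> x0; apply/rowP => i; rewrite mxE; apply/eqP; rewrite -normr_le0 -x0.
exact: enorm_coord.
Qed.

Lemma enormD x y : enorm (x + y) <= enorm x + enorm y.
Proof.
have [/enorm_eq0 ->|x0] := eqVneq (enorm x) 0; first by rewrite add0r lerDr enorm_ge0.
have [/enorm_eq0 ->|y0] := eqVneq (enorm y) 0; first by rewrite addr0 lerDl enorm_ge0.
have xp : 0 < enorm x by rewrite lt_neqAle eq_sym x0 enorm_ge0.
have yp : 0 < enorm y by rewrite lt_neqAle eq_sym y0 enorm_ge0.
rewrite -(ler_pXn2r (ltn0Sn 1)) ?nnegrE ?addr_ge0 ?enorm_ge0 // sqrrD !sqr_enorm.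
set p := \sum_i x 0 i * y 0 i.
have -> : \sum_i (x + y) 0 i ^+ 2 = \sum_i x 0 i ^+ 2 + p *+ 2 + \sum_i y 0 i ^+ 2.
  by rewrite -sumrMnl -!big_split; apply: eq_bigr => i _; rewrite mxE sqrrD.
rewrite lerD2r lerD2l lerMn2r /= -(ler_pM2l (mulr_gt0 xp yp)).
have : 0 <= \sum_i (enorm y * x 0 i - enorm x * y 0 i) ^+ 2.
  by apply: sumr_ge0 => i _; exact: sqr_ge0.
have -> : \sum_i (enorm y * x 0 i - enorm x * y 0 i) ^+ 2 =
   enorm y ^+ 2 * enorm x ^+ 2 - (enorm x * enorm y * p) *+ 2 + enorm x ^+ 2 * enorm y ^+ 2.
  rewrite (sqr_enorm x) {2}(sqr_enorm y) !mulr_sumr -sumrMnl -sumrN -!big_split.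
  by apply: eq_bigr => i _ /=; rewrite -(sqr_enorm x); ring.
move: (enorm x) (enorm y) p => a b q; move=> {x0 y0 xp yp}; nra.
Qed.

Lemma enormB x y : enorm (x - y) <= enorm x + enorm y.
Proof. by apply: le_trans (enormD _ _) _; rewrite enormN. Qed.

Lemma enorm_distD z x y : enorm (x - y) <= enorm (x - z) + enorm (z - y).
Proof. by apply: le_trans (enormD _ _); rewrite subrKA. Qed.

Lemma enorm_sum (I : Type) (r : seq I) (F : I -> 'rV[R]_n) :
  enorm (\sum_(i <- r) F i) <= \sum_(i <- r) enorm (F i).
Proof.
elim: r => [|i r IH]; first by rewrite !big_nil enorm0.
by rewrite !big_cons; apply: le_trans (enormD _ _) _; rewrite lerD2l.
Qed.

End EuclideanNorm.

Section Expansion.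
Variables (R : realType) (n d : nat) (sigma : 'I_d -> 'rV[R]_n -> 'rV[R]_n) (N : nat) (beta : R).
Hypothesis sigmaC : forall (j : 'I_d) (a : 'I_n), Ck (N - 1) (fun y => sigma j y 0 a).
Hypothesis N_gt0 : (0 < N)%N.
Hypothesis beta01 : 0 < beta <= 1.
Hypothesis Ups_lip : forall tau : tree d, (tree_size tau <= N - 1)%N ->
  glob_lipschitz (Upsilon sigma tau).
Hypothesis Ups_hol : forall tau : tree d, tree_size tau = N ->
  glob_holder beta (Upsilon sigma tau).
Variables (K Th : R).
Hypotheses (K_ge0 : 0 <= K) (Th_ge1 : 1 <= Th).

Notation Ups := (Upsilon sigma).
Notation Ups_ tau a := (fun y : 'rV[R]_n => Ups tau y 0 a).

(** A starting point [dx], the values [dc] of a character on trees, the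
   coefficients [dv] of a polynomial curve and a bound [dA] for them.  Constants
   must not depend on the datum; [valid_pow] covers both [1 <= dA] and
   [beta = 1]. *)
Record datum := Datum {
  dx : 'rV[R]_n; dc : tree d -> R; dv : nat -> 'rV[R]_n; dA : R }.

Definition dcur (q : datum) : R -> 'rV[R]_n := curve N (dx q) (dv q).

Definition dUps (q : datum) (tau : tree d) : 'rV[R]_n := Ups tau (dx q).

Record valid (q : datum) : Prop := Valid {
  valid_ge0 : 0 <= dA q;
  valid_pow : dA q `^ beta <= dA q;
  valid_c : forall tau, (tree_size tau <= N)%N -> `|dc q tau| <= K;
  valid_v : forall l, (l < N)%N -> enorm (dv q l) <= dA q;
  valid_tree : tree_velocity (dc q) N.-1 (dUps q) (dv q) }.

Lemma beta_gt0 : 0 < beta. Proof. by case/andP: beta01. Qed.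
Lemma beta_le1 : beta <= 1. Proof. by case/andP: beta01. Qed.
Lemma Th_gt0 : 0 < Th. Proof. exact: lt_le_trans ltr01 Th_ge1. Qed.

Lemma pow_le_powR (s : R) : 0 <= s -> s <= Th -> s <= Th * s `^ beta.
Proof.
move=> s0 sT; have [s1|s1] := leP s 1; last first.
  apply: (le_trans sT); rewrite ler_peMr ?(ltW Th_gt0) //.
  by rewrite -(powRr0 s) ler_powR ?(ltW s1) // ltW // beta_gt0.
apply: (@le_trans _ _ (s `^ beta)); last by rewrite ler_peMl ?powR_ge0.
move: s0; rewrite le_eqVlt => /predU1P[<-|s0]; first exact: powR_ge0.
rewrite -{1}(powRr1 (ltW s0)); apply: ger_powR; last exact: beta_le1.
by rewrite s0 s1.
Qed.

(** The polynomial is left unspecified: it is identified in [Ups_expansion] by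
   the uniqueness of jets. *)
Definition ujet k (f : datum -> R -> R) := exists2 C : R, 0 <= C & forall q, valid q ->
  exists2 Q : {poly R}, (size Q <= k.+1)%N &
    forall s : R, 0 <= s -> s <= Th -> `|f q s - Q.[s]| <= C * dA q * (s ^+ k * s `^ beta).

Lemma ujet_ext k f g :
  (forall q (s : R), valid q -> 0 <= s -> s <= Th -> f q s = g q s) -> ujet k f -> ujet k g.
Proof.
move=> fg [C C0 H]; exists C => // q qv; have [Q sQ HQ] := H q qv.
by exists Q => // s s0 sT; rewrite -fg // HQ.
Qed.

Lemma ujet_small k f (C : R) : 0 <= C ->
  (forall q (s : R), valid q -> 0 <= s -> s <= Th -> `|f q s| <= C * dA q * (s ^+ k * s `^ beta)) ->
  ujet k f.
Proof.
move=> C0 H; exists C => // q qv; exists 0; first by rewrite size_poly0.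
by move=> s s0 sT; rewrite horner0 subr0 H.
Qed.

Lemma ujet0 k : ujet k (fun _ _ => 0).
Proof. by apply: (@ujet_small _ _ 0) => // q s qv s0 sT; rewrite normr0 !mul0r. Qed.

Lemma ujet_add k f g : ujet k f -> ujet k g -> ujet k (fun q s => f q s + g q s).
Proof.
move=> [C C0 Hf] [C' C'0 Hg]; exists (C + C'); first exact: addr_ge0.
move=> q qv; have [Q sQ HQ] := Hf q qv; have [P sP HP] := Hg q qv.
exists (Q + P); first by apply: leq_trans (size_polyD _ _) _; rewrite geq_max sQ sP.
move=> s s0 sT; rewrite hornerD opprD addrACA !mulrDl.
exact: le_trans (ler_normD _ _) (lerD (HQ s s0 sT) (HP s s0 sT)).
Qed.

Lemma ujet_sum k (I : eqType) (r : seq I) (F : I -> datum -> R -> R) :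
  {in r, forall i, ujet k (F i)} -> ujet k (fun q s => \sum_(i <- r) F i q s).
Proof.
elim: r => [|i r IH] H.
  by apply: ujet_ext (ujet0 k) => q s _ _ _; rewrite big_nil.
have H1 : ujet k (F i) by apply: H; rewrite mem_head.
have H2 : ujet k (fun q s => \sum_(i <- r) F i q s).
  by apply: IH => j jr; apply: H; rewrite inE jr orbT.
by apply: ujet_ext (ujet_add H1 H2) => q s _ _ _; rewrite big_cons.
Qed.

Lemma ujet_scale k (b : datum -> R) (B : R) f : (forall q, valid q -> `|b q| <= B) ->
  ujet k f -> ujet k (fun q s => b q * f q s).
Proof.
move=> bB [C C0 H]; exists (`|B| * C); first exact: mulr_ge0.
move=> q qv; have [Q sQ HQ] := H q qv; exists (b q *: Q).
  exact: leq_trans (size_scale_leq _ _) sQ.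
move=> s s0 sT; rewrite hornerZ -mulrBr normrM -!mulrA; apply: ler_pM => //.
  exact: le_trans (bB q qv) (ler_norm B).
by rewrite mulrA HQ.
Qed.

Lemma ujet_shift j k f : ujet k f -> ujet (j + k) (fun q s => s ^+ j * f q s).
Proof.
move=> [C C0 H]; exists C => // q qv; have [Q sQ HQ] := H q qv; exists ('X^j * Q).
  have [->|Q0] := eqVneq Q 0; first by rewrite mulr0 size_poly0.
  by rewrite mulrC size_mulXn // -addnS leq_add2l.
move=> s s0 sT; rewrite hornerM hornerXn -mulrBr normrM ger0_norm ?exprn_ge0 //.
rewrite exprD -[s ^+ j * _ * _]mulrA mulrCA ler_wpM2l ?exprn_ge0 //.
exact: HQ.
Qed.

Definition primitive (Q : {poly R}) : {poly R} :=
  \sum_(i < size Q) (Q`_i / i.+1%:R) *: 'X^(i.+1).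

Lemma deriv_primitive Q : (primitive Q)^`() = Q.
Proof.
rewrite /primitive raddf_sum /= -[RHS]coefK poly_def; apply: eq_bigr => i _.
by rewrite derivZ derivXn /= -['X^_ *+ _]scaler_nat scalerA divfK ?pnatr_eq0.
Qed.

Lemma horner_primitive0 Q : (primitive Q).[0] = 0.
Proof.
by rewrite /primitive horner_sum big1 // => i _; rewrite hornerZ hornerXn expr0n mulr0.
Qed.

Lemma size_primitive k (Q : {poly R}) : (size Q <= k)%N -> (size (primitive Q) <= k.+1)%N.
Proof.
move=> sQ; apply: leq_trans (size_sum _ _ _) _; apply/bigmax_leqP => i _.
apply: leq_trans (size_scale_leq _ _) _; rewrite size_polyXn ltnS.
exact: leq_trans (ltn_ord i) sQ.
Qed.

Lemma ujet_integral k f df : (forall q (r : R), is_derive r 1 (f q) (df q r)) ->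
  ujet k df -> ujet k.+1 f.
Proof.
move=> D [C C0 H]; exists C => // q qv; have [Q sQ HQ] := H q qv.
have A0 := valid_ge0 qv.
exists (primitive Q + (f q 0)%:P).
  apply: leq_trans (size_polyD _ _) _; rewrite geq_max size_primitive //=.
  by apply: leq_trans (size_polyC_leq1 _) _.
move=> s s0 sT; pose g (r : R) := f q r - (primitive Q + (f q 0)%:P).[r].
have Dg (r : R) : is_derive r 1 g (df q r - Q.[r]).
  have P := is_derive_horner (primitive Q + (f q 0)%:P) r.
  have -> : Q.[r] = (primitive Q + (f q 0)%:P)^`().[r].
    by rewrite derivD derivC addr0 deriv_primitive.
  exact: is_deriveB.
have g0 : g 0 = 0 by rewrite /g hornerD hornerC horner_primitive0 add0r subrr.
have := @MVT_bound _ g _ (C * dA q * (s ^+ k * s `^ beta)) s s0 Dg.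
rewrite g0 subr0 => B; apply: le_trans (B _) _; last first.
  by rewrite [leLHS](_ : _ = C * dA q * (s ^+ k.+1 * s `^ beta)) // exprS; ring.
move=> r r0 rs; apply: le_trans (HQ r (ltW r0) (ltW (lt_le_trans rs sT))) _.
rewrite ler_wpM2l ?mulr_ge0 // ler_pM ?exprn_ge0 ?powR_ge0 ?(ltW r0) //.
  by rewrite lerXn2r ?nnegrE ?(ltW r0) ?(ltW rs).
by apply: ge0_ler_powR; rewrite ?nnegrE ?(ltW r0) ?(ltW beta_gt0) ?(ltW rs).
Qed.

Lemma Ups_lipschitz tau : (tree_size tau < N)%N ->
  exists2 L : R, 0 <= L & forall x y, enorm (Ups tau x - Ups tau y) <= L * enorm (x - y).
Proof.
move=> tN; have [L H] : glob_lipschitz (Ups tau) by apply: Ups_lip; rewrite -ltnS subn1 (ltn_predK tN).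
exists `|L| => // x y; apply: le_trans (H x y) _.
by rewrite ler_wpM2r ?enorm_ge0 ?ler_norm.
Qed.

Lemma grad_form_bound tau : (tree_size tau < N)%N ->
  exists2 L : R, 0 <= L & forall y u a, `|grad_form (Ups_ tau a) y u| <= L * enorm u.
Proof.
move=> tN; have [L L0 H] := Ups_lipschitz tN; exists L => // y u a.
have D := @Upsilon_derive _ _ _ _ _ sigmaC tau y u a tN.
have DV : derivable (Ups_ tau a) y u by exact: ex_derive.
have <- : 'D_u (Ups_ tau a) y = grad_form (Ups_ tau a) y u.
  by rewrite (derive_val (is_derive := D)) mxE.
apply/ler_addgt0Pr => e e0; move: DV => /cvgrPdist_le/(_ e e0) E.
have [h hE] := @filter_ex _ _ _ _ E.
set qh := h^-1 *: _ in hE; rewrite -(subrK qh ('D_u (Ups_ tau a) y)).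
apply: le_trans (ler_normD _ _) _; rewrite addrC lerD //.
rewrite /qh normrZ normfV; have := H (h *: u + y) y; rewrite addrK enormZ => Hh.
have [->|h0] := eqVneq h 0; first by rewrite normr0 invr0 mul0r mulr_ge0 ?enorm_ge0.
rewrite ler_pdivrMl ?normr_gt0 // mulrCA; apply: le_trans Hh.
by have := enorm_coord (Ups tau (h *: u + y) - Ups tau y) a; rewrite !mxE.
Qed.

Definition dpoly (q : datum) k tau a : {poly R} := tpoly (dc q) (dUps q) (dx q) k (Ups_ tau a).

Definition uexp k tau := forall a, exists2 C : R, 0 <= C & forall q, valid q ->
  forall s : R, 0 <= s -> s <= Th ->
  `|Ups tau (dcur q s) 0 a - (dpoly q k tau a).[s]| <= C * dA q * (s ^+ k * s `^ beta).

Lemma uexp_ujet k tau a : uexp k tau -> ujet k (fun q s => Ups tau (dcur q s) 0 a).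
Proof.
move=> /(_ a)[C C0 H]; exists C => // q qv; exists (dpoly q k tau a); first exact: size_tpoly.
exact: H.
Qed.

Lemma dcur_dist : exists2 M : R, 0 <= M & forall q (s : R), valid q -> 0 <= s -> s <= Th ->
  enorm (dcur q s - dx q) <= s * (dA q * M).
Proof.
exists (\sum_(l < N) Th ^+ l).
  by apply: sumr_ge0 => l _; rewrite exprn_ge0 // ltW // Th_gt0.
move=> q s qv s0 sT; rewrite /dcur /curve addrC addKr.
apply: le_trans (enorm_sum _ _) _; rewrite !mulr_sumr; apply: ler_sum => l _.
rewrite enormZ ger0_norm ?exprn_ge0 // exprS -mulrA ler_wpM2l // mulrC.
apply: ler_pM; rewrite ?enorm_ge0 ?exprn_ge0 //; first exact: valid_v.
by rewrite lerXn2r ?nnegrE // ltW // Th_gt0.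
Qed.

Lemma uexp0 tau : (tree_size tau <= N)%N -> uexp 0 tau.
Proof.
move=> tN a; have [M M0 HM] := dcur_dist.
have coord q s : `|Ups tau (dcur q s) 0 a - (dpoly q 0 tau a).[s]| <=
    enorm (Ups tau (dcur q s) - Ups tau (dx q)).
  by rewrite /dpoly tpoly0 hornerC; have := enorm_coord (Ups tau (dcur q s) - Ups tau (dx q)) a; rewrite !mxE.
move: tN; rewrite leq_eqVlt => /orP[/eqP tN|tN].
  have [L H] := Ups_hol tN; exists (`|L| * M `^ beta); first by rewrite mulr_ge0 ?powR_ge0.
  move=> q qv s s0 sT; apply: le_trans (coord q s) _; apply: le_trans (H _ _) _.
  have A0 := valid_ge0 qv.
  apply: (@le_trans _ _ (`|L| * (s * (dA q * M)) `^ beta)).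
    apply: (le_trans (ler_wpM2r (powR_ge0 _ _) (ler_norm L))); rewrite ler_wpM2l //.
    by apply: ge0_ler_powR; rewrite ?nnegrE ?enorm_ge0 ?(ltW beta_gt0) ?mulr_ge0 ?HM.
  rewrite powRM ?mulr_ge0 // powRM //.
  rewrite expr0 mul1r -!mulrA ler_wpM2l // [M `^ _ * _]mulrC.
  have P := valid_pow qv.
  have -> : s `^ beta * (dA q `^ beta * M `^ beta) = (s `^ beta * M `^ beta) * dA q `^ beta by ring.
  have -> : dA q * s `^ beta * M `^ beta = (s `^ beta * M `^ beta) * dA q by ring.
  by rewrite ler_wpM2l ?mulr_ge0 ?powR_ge0.
have [L L0 H] := Ups_lipschitz tN.
exists (L * M * Th); first by rewrite !mulr_ge0 // ltW // Th_gt0.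
move=> q qv s s0 sT; apply: le_trans (coord q s) _; apply: le_trans (H _ _) _.
have A0 := valid_ge0 qv.
apply: (@le_trans _ _ (L * (s * (dA q * M)))); first by rewrite ler_wpM2l ?HM.
have -> : L * (s * (dA q * M)) = L * M * dA q * s by ring.
have -> : L * M * Th * dA q * (s ^+ 0 * s `^ beta) = L * M * dA q * (Th * s `^ beta) by rewrite expr0; ring.
by rewrite ler_wpM2l ?mulr_ge0 ?pow_le_powR.
Qed.

Lemma fweight_bound w : (forest_size w <= N)%N ->
  exists B : R, forall q, valid q -> `|fweight (dc q) w| <= B.
Proof.
move=> wN; exists (\prod_(tau <- w) K) => q qv; rewrite /fweight normrM normfV.
have p0 : (0 < forest_pi w)%N := forest_pi_gt0 w.
rewrite ler_pdivrMr ?normr_gt0 ?pnatr_eq0 -?lt0n //.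
rewrite (@le_trans _ _ (\prod_(tau <- w) K)) //; last first.
  rewrite ler_peMr ?prodr_ge0 // ger0_norm ?ler0n //.
  by rewrite ler1n.
rewrite /fprod normr_prod.
have H : {in enum_mset w, forall tau, `|dc q tau| <= K}.
  by move=> tau tw; apply: (valid_c qv); apply: leq_trans wN; exact: tree_size_mem.
elim: (enum_mset w) H => [|t r IH] H; first by rewrite !big_nil.
rewrite !big_cons ler_pM ?prodr_ge0 //; first by apply: H; rewrite mem_head.
by apply: IH => y yr; apply: H; rewrite inE yr orbT.
Qed.

Lemma grad_ujet k :
  (forall j tau, (j <= k)%N -> (tree_size tau + j <= N)%N -> uexp j tau) ->
  forall j rho tau a, (j <= k)%N -> (tree_size rho + tree_size tau + j <= N)%N ->
    ujet j (fun q s => grad_form (Ups_ rho a) (dcur q s) (dUps q tau)).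
Proof.
move=> E j; have [m] := ubnP j; elim: m j => // m IH j; rewrite ltnS => jm rho tau a jk sz.
have r0 := tree_size_gt0 rho; have t0 := tree_size_gt0 tau.
have rN : (tree_size rho < N)%N by lia.
pose err q s : 'rV[R]_n := \row_b (Ups tau (dcur q s) 0 b - (dpoly q j tau b).[s]).
pose lg w q s := grad_form (Ups_ rho a) (dcur q s) (lUps sigma (go_graft w tau) (dx q)).
pose ws := [seq w <- forests_le d j | w != mset0].
have dec q s : valid q -> lUps sigma (graft tau rho) (dcur q s) 0 a
   + (-1 * grad_form (Ups_ rho a) (dcur q s) (err q s)
      + \sum_(w <- ws) -1 * (fweight (dc q) w * (s ^+ forest_size w * lg w q s)))
   = grad_form (Ups_ rho a) (dcur q s) (dUps q tau).
  move=> qv; rewrite (lUps_graft sigmaC) //; last by lia.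
  rewrite mxE -[X in X + _]mul1r.
  have -> : dUps q tau = 1 *: Ups tau (dcur q s) + (-1) *: err q s
     + \sum_(w <- ws) (- (fweight (dc q) w * s ^+ forest_size w)) *: lUps sigma (go_graft w tau) (dx q).
    apply/rowP => b; rewrite !mxE summxE.
    have -> : (dpoly q j tau b).[s] = Ups tau (dx q) 0 b +
        \sum_(w <- ws) (fweight (dc q) w * s ^+ forest_size w) * lUps sigma (go_graft w tau) (dx q) 0 b.
      rewrite /dpoly tpolyE (bigD1_seq mset0) ?forests_le_uniq //=; last first.
        by rewrite mem_forests_le forest_size_mset0.
      rewrite forest_size_mset0 expr0 /fweight fprod0 forest_pi0 enum_mset0 /= divr1 !mul1r.
      congr (_ + _); rewrite -big_filter; apply: eq_big_seq => w.
      rewrite mem_filter mem_forests_le => /andP[_ wj].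
      by rewrite (lUps_go_graft sigmaC) //; [ring|lia].
    under [X in _ = _ + X]eq_bigr do rewrite mxE mulNr.
    by rewrite sumrN; ring.
  rewrite !linearD !linearZ /= -addrA; congr (_ + (_ + _)).
  rewrite grad_form_sum; apply: eq_bigr => w _; rewrite /lg; ring.
apply: (ujet_ext (fun q s qv _ _ => dec q s qv)); apply: ujet_add; [|apply: ujet_add].
- have -> : (fun q s => lUps sigma (graft tau rho) (dcur q s) 0 a) =
     (fun q s => \sum_(z <- dom (graft tau rho)) (coeff z (graft tau rho))%:~R * Ups z (dcur q s) 0 a).
    apply/funext => q; apply/funext => s; rewrite mxE_lext lextE.
    by apply: eq_bigr => z _; rewrite mulrzl.
  apply: ujet_sum => z zD; apply: (@ujet_scale _ (fun=> (coeff z (graft tau rho))%:~R) _ _ (fun q _ => lexx _)).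
  by apply: uexp_ujet; apply: E => //; rewrite (graft_homog zD); lia.
- apply: (@ujet_scale _ (fun=> -1) _ _ (fun q _ => lexx _)).
  have [L L0 HL] := grad_form_bound rN.
  have Eb : forall b, exists2 C : R, 0 <= C & forall q, valid q -> forall s : R, 0 <= s -> s <= Th ->
     `|err q s 0 b| <= C * dA q * (s ^+ j * s `^ beta).
    move=> b; have tj : (tree_size tau + j <= N)%N by lia.
    have [C C0 H] := E j tau jk tj b; exists C => // q qv s s0 sT; rewrite mxE; exact: H.
  pose C b := projT1 (cid2 (Eb b)).
  have CP b : 0 <= C b /\ forall q, valid q -> forall s : R, 0 <= s -> s <= Th ->
     `|err q s 0 b| <= C b * dA q * (s ^+ j * s `^ beta).
    by rewrite /C; case: (cid2 (Eb b)).
  apply: (@ujet_small _ _ (L * \sum_b C b)).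
    by apply: mulr_ge0 => //; apply: sumr_ge0 => b _; case: (CP b).
  move=> q s qv s0 sT; apply: le_trans (HL _ _ _) _; rewrite -!mulrA ler_wpM2l //.
  apply: le_trans (enorm_le_sum _) _; rewrite mulr_suml; apply: ler_sum => b _.
  by rewrite mulrA; have [_] := CP b; apply.
apply: ujet_sum => w; rewrite mem_filter mem_forests_le => /andP[w0 wj].
have wp : (0 < forest_size w)%N.
  by apply: leq_trans (size_le_forest_size w); rewrite lt0n size_mset_eq0.
apply: (@ujet_scale _ (fun=> -1) _ _ (fun q _ => lexx _)).
have wN : (forest_size w <= N)%N by lia.
have [B HB] := fweight_bound wN; apply: (ujet_scale HB).
have -> : (j = forest_size w + (j - forest_size w))%N by lia.
apply: ujet_shift.
have -> : lg w = (fun q s => \sum_(z <- dom (go_graft w tau)) (coeff z (go_graft w tau))%:~R *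
    grad_form (Ups_ rho a) (dcur q s) (dUps q z)).
  apply/funext => q; apply/funext => s; rewrite -grad_form_sum /lg /lUps lextE; congr grad_form.
  by apply: eq_bigr => z _; rewrite scaler_int.
apply: ujet_sum => z zD; apply: (@ujet_scale _ (fun=> (coeff z (go_graft w tau))%:~R) _ _ (fun q _ => lexx _)).
by apply: IH; rewrite ?(go_graft_homog zD); lia.
Qed.

Lemma ujet_weaken_shift (k l : nat) f (C : R) : (k <= l)%N -> 0 <= C ->
  (forall q (s : R), valid q -> `|f q s| <= C * dA q) ->
  ujet k (fun q s => s ^+ l.+1 * f q s).
Proof.
move=> kl C0 H; apply: (@ujet_small _ _ (C * Th ^+ (l - k) * Th)).
  by rewrite !mulr_ge0 ?exprn_ge0 // ltW // Th_gt0.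
move=> q s qv s0 sT; have A0 := valid_ge0 qv; rewrite normrM ger0_norm ?exprn_ge0 //.
have -> : s ^+ l.+1 = s ^+ (l - k) * s ^+ k * s by rewrite -exprD -exprSr; congr (_ ^+ _); lia.
have -> : C * Th ^+ (l - k) * Th * dA q * (s ^+ k * s `^ beta) =
   (Th ^+ (l - k) * s ^+ k * (Th * s `^ beta)) * (C * dA q) by ring.
apply: ler_pM; rewrite ?mulr_ge0 ?exprn_ge0 ?H //.
apply: ler_pM; rewrite ?mulr_ge0 ?exprn_ge0 ?pow_le_powR //.
by rewrite ler_wpM2r ?exprn_ge0 // lerXn2r ?nnegrE // ltW // Th_gt0.
Qed.

Lemma Ups_expansion k tau : (tree_size tau + k <= N)%N -> uexp k tau.
Proof.
have [m] := ubnP k; elim: m k tau => // m IH [|k] tau; rewrite ltnS => km tk a.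
  by apply: uexp0; lia.
have t0 := tree_size_gt0 tau; have tN : (tree_size tau < N)%N by lia.
have IHg := @grad_ujet k (fun j t jk => IH j t (leq_ltn_trans jk km)).
have CU : Ck k.+1 (Ups_ tau a).
  by apply: Ck_le (Upsilon_Ck sigmaC a _); lia.
have C1 : Ck 1 (Ups_ tau a) by apply: Ck_le CU.
have D q (s : R) : is_derive s 1 (fun s => Ups tau (dcur q s) 0 a)
    (grad_form (Ups_ tau a) (dcur q s) (dcurve N (dv q) s)).
  exact: is_derive_along.
have kN1 : (k.+1 <= N.-1)%N by lia.
have vE q : valid q -> tree_velocity (dc q) k.+1 (dUps q) (dv q).
  by move=> qv l lk; apply: (valid_tree qv); lia.
have J : ujet k (fun q s => grad_form (Ups_ tau a) (dcur q s) (dcurve N (dv q) s)).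
  pose F q s := \sum_(rho <- trees_le d k.+1) ((tree_size rho)%:R * dc q rho) *
      (s ^+ (tree_size rho).-1 * grad_form (Ups_ tau a) (dcur q s) (dUps q rho))
    + \sum_(l <- [seq l : 'I_N <- enum 'I_N | (k.+1 <= l)%N])
       (l.+1%:R * (s ^+ (l : 'I_N) * grad_form (Ups_ tau a) (dcur q s) (dv q l))).
  apply: (@ujet_ext _ F).
    move=> q s qv _ _; rewrite /F (@grad_form_dcurve _ _ _ _ (dc q) _ _ k.+1 (dUps q)) //; last 2 first.
    - by lia.
    - exact: vE.
    congr (_ + _); rewrite big_filter big_enum_cond /=; apply: eq_big => // l _; by rewrite mulrA.
  apply: ujet_add; apply: ujet_sum.
    move=> rho; rewrite mem_trees_le => rk; have rp := tree_size_gt0 rho.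
    apply: (@ujet_scale _ (fun q => (tree_size rho)%:R * dc q rho) ((tree_size rho)%:R * K)).
      move=> q qv; rewrite normrM normr_nat ler_wpM2l //; apply: (valid_c qv); lia.
    have -> : (k = (tree_size rho).-1 + (k.+1 - tree_size rho))%N by lia.
    by apply: ujet_shift; apply: IHg; lia.
  move=> l; rewrite mem_filter => /andP[kl _].
  apply: (@ujet_scale _ (fun=> l.+1%:R) _ _ (fun q _ => lexx _)).
  have [L L0 HL] := grad_form_bound tN.
  have lE : (l : nat) = l.-1.+1 by lia.
  apply: (@ujet_ext _ (fun q s => s ^+ l.-1.+1 * grad_form (Ups_ tau a) (dcur q s) (dv q l))).
    by move=> q s _ _ _; rewrite -lE.
  apply: (@ujet_weaken_shift k l.-1 (fun q s => grad_form (Ups_ tau a) (dcur q s) (dv q l)) L) => //.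
    by lia.
  move=> q s qv; apply: le_trans (HL _ _ _) _; rewrite ler_wpM2l //; exact: valid_v.
have [C C0 H] := ujet_integral D J; exists C => // q qv; have [Q sQ HQ] := H q qv.
suff -> : dpoly q k.+1 tau a = Q by exact: HQ.
apply/eqP; rewrite eq_sym -subr_eq0; apply/eqP; apply: (@small_horner_eq0 _ k.+1).
  by apply: leq_trans (size_polyD _ _) _; rewrite size_polyN geq_max sQ size_tpoly.
have S1 : small k.+1 (fun s => Ups tau (dcur q s) 0 a - Q.[s]).
  apply: (@small_powR _ _ _ (C * dA q) beta Th beta_gt0 Th_gt0) => s s0 sT.
  by rewrite -mulrA; apply: HQ; exact: ltW.
have S2 : small k.+1 (fun s => Ups tau (dcur q s) 0 a - (dpoly q k.+1 tau a).[s]).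
  by apply: taylor_small => //; [lia|exact: vE].
apply: small_eq (small_add S2 (small_scale (-1) S1)) => s _.
by rewrite hornerD hornerN; ring.
Qed.

End Expansion.

Lemma finite_bound (R : realDomainType) (I : eqType) (r : seq I) (P : I -> R -> Prop) :
  (forall i c c', c <= c' -> P i c -> P i c') ->
  {in r, forall i, exists2 c, 0 <= c & P i c} ->
  exists2 c, 0 <= c & {in r, forall i, P i c}.
Proof.
move=> mP; elim: r => [|i r IH] H; first by exists 0.
have [c c0 Pc] := H i (mem_head _ _).
have [c' c'0 Pc'] : exists2 c, 0 <= c & {in r, forall i, P i c}.
  by apply: IH => j jr; apply: H; rewrite inE jr orbT.
exists (c + c'); first exact: addr_ge0.
move=> j; rewrite inE => /predU1P[->|jr].
  by apply: mP Pc; rewrite lerDl.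
by apply: mP (Pc' j jr); rewrite lerDr.
Qed.

Lemma lext_widen (K : choiceType) (V : zmodType) (f : K -> V) (D : {freeg K / int}) (r : seq K) :
  uniq r -> {subset dom D <= r} -> lext f D = \sum_(z <- r) f z *~ coeff z D.
Proof.
move=> ur Dr; rewrite lextE [RHS](bigID (mem (dom D))) /= [X in _ = _ + X]big1 ?addr0; last first.
  by move=> z /coeff_outdom ->; rewrite mulr0z.
rewrite -[RHS]big_filter; apply: perm_big; apply: uniq_perm; rewrite ?filter_uniq ?uniq_dom //.
by move=> z; rewrite mem_filter; apply/idP/andP => [zD|[]//]; split=> //; exact: Dr.
Qed.

Section Remainders.
Variables (R : realType) (n d : nat) (sigma : 'I_d -> 'rV[R]_n -> 'rV[R]_n).
Variables (X : R -> R -> forest d -> R) (Z : R -> 'rV[R]_n).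
Implicit Types (s t u : R).

Notation Ups := (Upsilon sigma).

Lemma fsbig_trees (V : zmodType) (m : nat) (A : set (tree d)) (F : tree d -> V) :
  A = [set tau | (tree_size tau <= m)%N] ->
  \sum_(tau \in A) F tau = \sum_(tau <- trees_le d m) F tau.
Proof. by move=> ->; rewrite fsbig_finite //=; exact: finite_trees. Qed.

Lemma remainderE l s t : remainder sigma X Z l.+1 s t =
  Z t - Z s - \sum_(tau <- trees_le d l) X s t [mset tau]%mset *: Ups tau (Z s).
Proof. by rewrite /remainder (@fsbig_trees _ l). Qed.

Lemma remainder1 s t : remainder sigma X Z 1 s t = Z t - Z s.
Proof. by rewrite remainderE big_trees_le big_ord0 subr0. Qed.

Lemma remainderS l s t : remainder sigma X Z l.+1 s t =
  remainder sigma X Z l.+2 s t + \sum_(tau <- trees_eq d l.+1) X s t [mset tau]%mset *: Ups tau (Z s).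
Proof. by rewrite !remainderE !big_trees_le big_ord_recr /= opprD addrA subrK. Qed.

Variables (N : nat) (alpha T : R).
Hypothesis X_rough : branched_rough_path N alpha T X.

Definition chen_bracket s u (rho : tree d) : 'rV[R]_n :=
  Ups rho (Z u) - \sum_(w <- forests_le d (N - tree_size rho))
    (X s u w / (forest_pi w)%:R) *: lUps sigma (go_graft w rho) (Z s).

Lemma chen_pairs (F : forest d * tree d -> R) :
  (forall p, (N < forest_size p.1 + tree_size p.2)%N -> F p = 0) ->
  \sum_(p \in [set: forest d * tree d]) F p =
  \sum_(rho <- trees_le d N) \sum_(w <- forests_le d (N - tree_size rho)) F (w, rho).
Proof.
move=> F0; pose h (rho : tree d) (w : forest d) := (w, rho).
rewrite (@fsbigE _ _ _ _ _ [seq h rho w | rho <- trees_le d N, w <- forests_le d (N - tree_size rho)]).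
- under eq_bigl do rewrite in_setT.
  by rewrite big_allpairs_dep.
- apply: allpairs_uniq_dep; first exact: trees_le_uniq.
    by move=> rho _; exact: forests_le_uniq.
  by move=> [rho w] [rho' w'] _ _ [-> ->].
- by [].
move=> [w rho] _ wr; apply: F0; rewrite ltnNge; apply: contra wr => /= wr.
by apply/allpairsPdep; exists rho, w; rewrite mem_trees_le mem_forests_le; split=> //; lia.
Qed.

Lemma delta_remainder s u t : 0 <= s -> s <= u -> u <= t -> t <= T ->
  remainder sigma X Z N.+1 s t - remainder sigma X Z N.+1 s u - remainder sigma X Z N.+1 u t =
  \sum_(rho <- trees_le d N) X u t [mset rho]%mset *: chen_bracket s u rho.
Proof.
move=> s0 su ut tT; rewrite !remainderE.
have -> : \sum_(tau <- trees_le d N) X s t [mset tau]%mset *: Ups tau (Z s) =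
  \sum_(tau <- trees_le d N) X s u [mset tau]%mset *: Ups tau (Z s) +
  \sum_(rho <- trees_le d N) X u t [mset rho]%mset *:
    \sum_(w <- forests_le d (N - tree_size rho))
      (X s u w / (forest_pi w)%:R) *: lUps sigma (go_graft w rho) (Z s).
  pose F tau (p : forest d * tree d) := X s u p.1 / (forest_pi p.1)%:R * X u t [mset p.2]%mset *
        (coeff tau (go_graft p.1 p.2))%:~R.
  have E tau : tau \in trees_le d N -> X s t [mset tau]%mset = X s u [mset tau]%mset +
      \sum_(rho <- trees_le d N) \sum_(w <- forests_le d (N - tree_size rho)) F tau (w, rho).
    rewrite mem_trees_le => tN; rewrite (brp_chen X_rough s0 su ut tT tN); congr (_ + _).
    apply: chen_pairs => -[w rho] /= wr; rewrite coeff_outdom ?mulr0 //.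
    by apply/negP => /go_graft_homog; lia.
  rewrite (eq_big_seq (fun tau => X s u [mset tau]%mset *: Ups tau (Z s) +
     \sum_(rho <- trees_le d N) \sum_(w <- forests_le d (N - tree_size rho))
        F tau (w, rho) *: Ups tau (Z s))); last first.
    move=> tau /E ->; rewrite scalerDl; congr (_ + _).
    by rewrite scaler_suml; apply: eq_bigr => rho _; rewrite scaler_suml.
  rewrite big_split /=; congr (_ + _); rewrite exchange_big /=; apply: eq_big_seq => rho.
  rewrite mem_trees_le => rN; rewrite exchange_big /= scaler_sumr; apply: eq_big_seq => w.
  rewrite mem_forests_le => wN.
  rewrite /lUps (@lext_widen _ _ _ _ (trees_le d N)) ?trees_le_uniq //; last first.
    by move=> z /go_graft_homog zE; rewrite mem_trees_le zE; lia.
  rewrite !scaler_sumr; apply: eq_bigr => tau _.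
  by rewrite -scaler_int !scalerA /F /=; congr (_ *: _); rewrite [RHS]mulrC; ring.
under [RHS]eq_bigr do rewrite scalerBr.
rewrite sumrB; set a := \sum_(tau <- trees_le d N) X s u _ *: _.
set b := \sum_(rho <- trees_le d N) X u t _ *: \sum_(w <- _) _.
set e := \sum_(rho <- trees_le d N) X u t _ *: Ups _ _.
rewrite !opprD !opprK !addrA.
by apply/rowP => i; rewrite !mxE; ring.
Qed.

End Remainders.

Section DeltaBound.
Variables (R : realType) (n d : nat) (sigma : 'I_d -> 'rV[R]_n -> 'rV[R]_n) (N : nat) (beta : R).
Hypothesis sigmaC : forall (j : 'I_d) (a : 'I_n), Ck (N - 1) (fun y => sigma j y 0 a).
Hypothesis N_gt0 : (0 < N)%N.
Hypothesis beta01 : 0 < beta <= 1.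
Hypothesis Ups_lip : forall tau : tree d, (tree_size tau <= N - 1)%N ->
  glob_lipschitz (Upsilon sigma tau).
Hypothesis Ups_hol : forall tau : tree d, tree_size tau = N ->
  glob_holder beta (Upsilon sigma tau).
Variables (K Th : R).
Hypotheses (K_ge0 : 0 <= K) (Th_ge1 : 1 <= Th).

Notation Ups := (Upsilon sigma).
Notation Ups_ tau a := (fun y : 'rV[R]_n => Ups tau y 0 a).

Lemma powR_le_self (A : R) : 1 <= A \/ beta = 1 -> 0 <= A -> A `^ beta <= A.
Proof.
case/andP: beta01 => b0 b1 [A1 A0|-> A0]; last by rewrite powRr1.
by rewrite -[leRHS]powRr1 // ler_powR.
Qed.

Lemma telescope_last (V : zmodType) (r : nat -> V) m :
  \sum_(l < m.+1) (if (l.+1 < m.+1)%N then r l - r l.+1 else r l) = r 0%N.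
Proof.
rewrite big_ord_recr /= ltnn.
have -> : \sum_(i < m) (if (i.+1 < m.+1)%N then r i - r i.+1 else r i) = \sum_(i < m) (r i - r i.+1).
  by apply: eq_bigr => i _; rewrite ltnS ltn_ord.
elim: m => [|m IH]; first by rewrite big_ord0 add0r.
by rewrite big_ord_recr /= -addrA subrK.
Qed.

Lemma prod_rescale (th : R) (f : tree d -> R) (r : seq (tree d)) : th != 0 ->
  th ^+ (\sum_(tau <- r) tree_size tau) * \prod_(tau <- r) (f tau / th ^+ tree_size tau) =
  \prod_(tau <- r) f tau.
Proof.
move=> th0; elim: r => [|t r IH]; first by rewrite !big_nil mulr1.
rewrite !big_cons exprD mulrACA IH; congr (_ * _).
by rewrite mulrC divfK // expf_neq0.
Qed.

Section Increment.
Variables (alpha T : R) (X : R -> R -> forest d -> R) (Z : R -> 'rV[R]_n) (s u A th : R).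
Hypothesis X_rough : branched_rough_path N alpha T X.
Hypotheses (s0 : 0 <= s) (su : s <= u) (uT : u <= T) (th0 : 0 < th) (thTh : th <= Th).
Hypothesis X_su : forall tau, (tree_size tau <= N)%N -> `|X s u [mset tau]%mset| <= K * th ^+ tree_size tau.
Hypotheses (A0 : 0 <= A) (A1 : 1 <= A \/ beta = 1).
Hypothesis rem_su : forall l, (0 < l <= N)%N -> enorm (remainder sigma X Z l s u) <= A * th ^+ l.

Definition increment_datum : datum R n d := Datum (Z s)
  (fun tau => X s u [mset tau]%mset / th ^+ tree_size tau)
  (fun l => (th ^+ l.+1)^-1 *: (if (l.+1 < N)%N
     then remainder sigma X Z l.+1 s u - remainder sigma X Z l.+2 s u
     else remainder sigma X Z l.+1 s u))
  (A * (1 + Th)).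

Local Notation q := increment_datum.

Lemma increment_valid : valid sigma N beta K q.
Proof.
have Th0 : 0 <= Th by apply: le_trans Th_ge1.
have thX l : 0 < th ^+ l by rewrite exprn_gt0.
have AE : A <= A * (1 + Th) by rewrite ler_peMr // lerDl.
split=> /=.
- by rewrite mulr_ge0 // addr_ge0.
- apply: powR_le_self; last by rewrite mulr_ge0 // addr_ge0.
  by case: A1 => [h|]; [left; exact: le_trans AE|right].
- move=> tau tN; rewrite normrM normfV (gtr0_norm (thX _)) ler_pdivrMr //.
  exact: X_su.
- move=> l lN; rewrite enormZ normfV (gtr0_norm (thX _)) ler_pdivrMl // mulrC.
  case: ifP => [lN'|_]; last first.
    by apply: le_trans (rem_su _) _ => //; rewrite ler_wpM2r // ltW.
  apply: le_trans (enormB _ _) _; rewrite mulrDr mulr1 mulrDl; apply: lerD; first by apply: rem_su.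
  apply: le_trans (rem_su _) _ => //.
  by rewrite exprS mulrA ler_wpM2r ?(ltW (thX _)) // ler_wpM2l.
move=> l lN /=; have lN' : (l.+1 < N)%N by rewrite -(prednK N_gt0) ltnS.
rewrite lN' {1}(remainderS sigma X Z l s u) addrAC subrr add0r scaler_sumr; apply: eq_big_seq => tau.
by rewrite mem_trees_eq /dUps /= => /eqP ->; rewrite scalerA mulrC.
Qed.

Lemma increment_end : dcur N q th = Z u.
Proof.
rewrite /dcur /curve /=.
have -> : \sum_(l < N) th ^+ l.+1 *: ((th ^+ l.+1)^-1 *: (if (l.+1 < N)%N
     then remainder sigma X Z l.+1 s u - remainder sigma X Z l.+2 s u
     else remainder sigma X Z l.+1 s u)) = remainder sigma X Z 1 s u.
  under eq_bigr do rewrite scalerA divff ?expf_neq0 ?gt_eqF // scale1r.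
  by case: N N_gt0 => // m _; exact: (telescope_last (fun l => remainder sigma X Z l.+1 s u)).
by rewrite remainder1 addrC subrK.
Qed.

Lemma increment_bracket rho a : (tree_size rho <= N)%N ->
  chen_bracket sigma X Z N s u rho 0 a =
  Ups rho (dcur N q th) 0 a - (dpoly sigma q (N - tree_size rho) rho a).[th].
Proof.
move=> rN; rewrite increment_end /chen_bracket !mxE summxE; congr (_ - _).
rewrite /dpoly tpolyE; apply: eq_big_seq => w; rewrite mem_forests_le => wN.
rewrite mxE (lUps_go_graft sigmaC); last by rewrite addnC -leq_subRL.
rewrite /fweight /fprod /= !mulrA; congr (_ * _ * _).
by rewrite prod_rescale ?gt_eqF // (brp_mul X_rough) //; exact: leq_trans wN (leq_subr _ _).
Qed.

End Increment.

Lemma bracket_bound : exists2 C : R, 0 <= C & forall (alpha T : R) X Z (s u A th : R),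
  branched_rough_path N alpha T X -> 0 <= s -> s <= u -> u <= T -> 0 < th -> th <= Th ->
  (forall tau : tree d, (tree_size tau <= N)%N -> `|X s u [mset tau]%mset| <= K * th ^+ tree_size tau) ->
  0 <= A -> 1 <= A \/ beta = 1 ->
  (forall l, (0 < l <= N)%N -> enorm (remainder sigma X Z l s u) <= A * th ^+ l) ->
  forall rho : tree d, (tree_size rho <= N)%N ->
  enorm (chen_bracket sigma X Z N s u rho) <= C * A * (th ^+ (N - tree_size rho) * th `^ beta).
Proof.
have Th0 : 0 <= Th by apply: le_trans Th_ge1.
pose P (rho : tree d) (a : 'I_n) (C : R) := forall q, valid sigma N beta K q ->
  forall s : R, 0 <= s -> s <= Th ->
  `|Ups rho (dcur N q s) 0 a - (dpoly sigma q (N - tree_size rho) rho a).[s]| <=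
     C * dA q * (s ^+ (N - tree_size rho) * s `^ beta).
have mP rho a c c' : c <= c' -> P rho a c -> P rho a c'.
  move=> cc Pc q qv s s0 sT; apply: le_trans (Pc q qv s s0 sT) _.
  by rewrite !ler_wpM2r ?mulr_ge0 ?exprn_ge0 ?powR_ge0 // (valid_ge0 qv).
have [C C0 HC] : exists2 C, 0 <= C & {in trees_le d N, forall rho, forall a, P rho a C}.
  apply: finite_bound => [rho c c' cc H a|rho]; first exact: mP (H a).
  rewrite mem_trees_le => rN.
  have [C C0 HC] : exists2 C, 0 <= C & {in enum 'I_n, forall a, P rho a C}.
    apply: finite_bound; first exact: mP.
    move=> a _; apply: (Ups_expansion sigmaC N_gt0 beta01 Ups_lip Ups_hol K_ge0 Th_ge1).
      by rewrite subnKC.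
  by exists C => // a; apply: HC; rewrite mem_enum.
exists (n%:R * C * (1 + Th)); first by rewrite !mulr_ge0 ?addr_ge0.
move=> alpha T X Z s u A th Xr s0 su uT th0 thTh Xsu A0 A1 rsu rho rN.
apply: le_trans (enorm_le_sum _) _.
have V := increment_valid th0 thTh Xsu A0 A1 rsu.
have H a : `|chen_bracket sigma X Z N s u rho 0 a| <= C * (A * (1 + Th)) * (th ^+ (N - tree_size rho) * th `^ beta).
  rewrite (increment_bracket Z A Xr s0 su uT th0 a rN).
  have rM : rho \in trees_le d N by rewrite mem_trees_le.
  exact: (HC rho rM a _ V th (ltW th0) thTh).
apply: le_trans (ler_sum _ (fun a _ => H a)) _.
rewrite sumr_const card_ord -[leLHS]mulr_natl; set Y := th ^+ _ * _.
by rewrite [leLHS](_ : _ = n%:R * C * (1 + Th) * A * Y) //; ring.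
Qed.

Lemma delta_bound : exists2 C : R, 0 <= C & forall (alpha T : R) X Z (s u t A th : R),
  branched_rough_path N alpha T X -> 0 <= s -> s <= u -> u <= t -> t <= T -> 0 < th -> th <= Th ->
  (forall tau : tree d, (tree_size tau <= N)%N -> `|X s u [mset tau]%mset| <= K * th ^+ tree_size tau) ->
  (forall tau : tree d, (tree_size tau <= N)%N -> `|X u t [mset tau]%mset| <= K * th ^+ tree_size tau) ->
  0 <= A -> 1 <= A \/ beta = 1 ->
  (forall l, (0 < l <= N)%N -> enorm (remainder sigma X Z l s u) <= A * th ^+ l) ->
  enorm (remainder sigma X Z N.+1 s t - remainder sigma X Z N.+1 s u - remainder sigma X Z N.+1 u t)
    <= C * A * (th ^+ N * th `^ beta).
Proof.
have [C C0 HC] := bracket_bound.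
exists ((size (trees_le d N))%:R * (K * C)); first by rewrite !mulr_ge0.
move=> alpha T X Z s u t A th Xr s0 su ut tT th0 thTh Xsu Xut A0 A1 rsu.
rewrite (delta_remainder sigma Z Xr) //.
apply: le_trans (enorm_sum _ _) _.
apply: (@le_trans _ _ (\sum_(rho <- trees_le d N) K * C * A * (th ^+ N * th `^ beta))).
  rewrite big_seq [leRHS]big_seq; apply: ler_sum => rho; rewrite mem_trees_le => rN.
  rewrite enormZ.
  have -> : K * C * A * (th ^+ N * th `^ beta) =
     (K * th ^+ tree_size rho) * (C * A * (th ^+ (N - tree_size rho) * th `^ beta)).
    by rewrite -{1}(subnK rN) exprD; ring.
  apply: ler_pM; rewrite ?enorm_ge0 ?Xut //.
  by apply: (HC alpha T); rewrite // (le_trans ut).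
rewrite big_const_seq count_predT iter_addr_0 -[leLHS]mulr_natl.
by rewrite [leLHS](_ : _ = (size (trees_le d N))%:R * (K * C) * A * (th ^+ N * th `^ beta)) //; ring.
Qed.

End DeltaBound.

Section Sewing.
Variables (R : realType) (n : nat).
Implicit Types (F : R -> R -> 'rV[R]_n) (s t u h e : R).

Lemma sewing_constant (eta : R) : 1 < eta -> exists2 kap : R, 0 <= kap &
  forall h : R, 0 <= h -> 2 * (kap * (h / 2) `^ eta) + h `^ eta = kap * h `^ eta.
Proof.
move=> eta1; pose p := 2 `^ (1 - eta) : R.
have p1 : p < 1.
  rewrite /p -opprB powRN invf_lt1 ?powR_gt0 //.
  have e0 : 0 < eta - 1 by rewrite subr_gt0.
  have := gt0_ltr_powR e0 (x := 1) (y := 2); rewrite !nnegrE powR1; apply => //.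
  by rewrite ltr1n.
have q0 : 0 < 1 - p by rewrite subr_gt0.
exists (1 - p)^-1; first by rewrite invr_ge0 ltW.
move=> h h0; have E : 2 * (h / 2) `^ eta = p * h `^ eta.
  have i2 : (2^-1 : R) `^ eta = 2 `^ (- eta).
    by rewrite -powR_inv1 // -powRrM mulN1r.
  by rewrite powRM ?invr_ge0 // i2 /p powRD ?pnatr_eq0 ?implybT // powRr1 // mulrA mulrAC.
rewrite mulrCA E mulrA -[X in _ + X]mul1r -mulrDl; congr (_ * _).
have qn : 1 - p != 0 by rewrite gt_eqF.
by move: qn; move: p {p1 q0 E} => p qn; field.
Qed.

Lemma sewing (eta : R) : 1 < eta -> exists2 kap : R, 0 <= kap &
  forall F (E s t : R), 0 <= E -> s < t ->
  (forall s' t', s <= s' -> s' < t' -> t' <= t ->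
     enorm (F s' t' - F s' ((s' + t') / 2) - F ((s' + t') / 2) t') <= E * (t' - s') `^ eta) ->
  (forall e, 0 < e -> exists2 dl : R, 0 < dl & forall s' t', s <= s' -> s' <= t' -> t' <= t ->
     t' - s' <= dl -> enorm (F s' t') <= e * (t' - s')) ->
  enorm (F s t) <= kap * E * (t - s) `^ eta.
Proof.
move=> eta1; have [kap k0 kapE] := sewing_constant eta1; exists kap => // F E s t E0 st dF oF.
have key e : 0 < e -> enorm (F s t) <= kap * E * (t - s) `^ eta + e * (t - s).
  move=> e0; have [dl dl0 H] := oF e e0.
  have ind m : forall s' t', s <= s' -> s' < t' -> t' <= t -> t' - s' <= dl * 2 ^+ m ->
      enorm (F s' t') <= kap * E * (t' - s') `^ eta + e * (t' - s').
    elim: m => [|m IH] s' t' ss st' tt.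
      rewrite expr0 mulr1 => hd; apply: le_trans (H s' t' ss (ltW st') tt hd) _.
      by rewrite lerDr !mulr_ge0 ?powR_ge0.
    move=> hd; set u := (s' + t') / 2.
    have su : s' < u by rewrite /u ltr_pdivlMr // mulr_natr mulr2n ltrD2l.
    have ut : u < t' by rewrite /u ltr_pdivrMr // mulr_natr mulr2n ltrD2r.
    have h1 : u - s' = (t' - s') / 2 by rewrite /u; field.
    have h2 : t' - u = (t' - s') / 2 by rewrite /u; field.
    have hm : (t' - s') / 2 <= dl * 2 ^+ m by rewrite ler_pdivrMr // -mulrA -exprSr.
    have B1 := IH s' u ss su (le_trans (ltW ut) tt).
    have B2 := IH u t' (le_trans ss (ltW su)) ut tt.
    rewrite h1 in B1; rewrite h2 in B2.
    have D : F s' t' = (F s' t' - F s' u - F u t') + (F s' u + F u t').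
      by rewrite [F s' u + _]addrC addrA !subrK.
    rewrite D; apply: le_trans (enormD _ _) _.
    apply: le_trans (lerD (dF s' t' ss st' tt) (le_trans (enormD _ _) (lerD (B1 hm) (B2 hm)))) _.
    have c0 : 0 <= t' - s' by rewrite subr_ge0 ltW.
    have -> : kap * E * (t' - s') `^ eta = E * (kap * (t' - s') `^ eta) by rewrite -mulrA mulrCA.
    rewrite -(kapE _ c0); set a := (_ / 2) `^ eta; set b := _ `^ eta; set c := t' - s'.
    by rewrite [leLHS](_ : _ = E * (2 * (kap * a) + b) + e * c) //; field.
  have [m hm] : exists m : nat, t - s <= dl * 2 ^+ m.
    exists (Num.truncn ((t - s) / dl)).+1; rewrite mulrC -ler_pdivrMr //.
    apply: le_trans (ltW (truncnS_gt _)) _; rewrite -natrX ler_nat.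
    exact: ltnW (ltn_expl _ _).
  exact: (ind m).
apply/ler_addgt0Pr => e e0; have h0 : 0 < t - s by rewrite subr_gt0.
by have := key _ (divr_gt0 e0 h0); rewrite divfK ?gt_eqF.
Qed.

End Sewing.

Section DavieSolutions.
Variables (R : realType) (n d : nat) (sigma : 'I_d -> 'rV[R]_n -> 'rV[R]_n) (N : nat) (alpha beta : R).
Hypothesis sigmaC : forall (j : 'I_d) (a : 'I_n), Ck (N - 1) (fun y => sigma j y 0 a).
Hypothesis N_gt0 : (0 < N)%N.
Hypothesis beta01 : 0 < beta <= 1.
Hypothesis Ups_lip : forall tau : tree d, (tree_size tau <= N - 1)%N ->
  glob_lipschitz (Upsilon sigma tau).
Hypothesis Ups_hol : forall tau : tree d, tree_size tau = N ->
  glob_holder beta (Upsilon sigma tau).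
Hypothesis alpha_gt0 : 0 < alpha.
Hypothesis N_alpha : N%:R * alpha <= 1.
Hypothesis eta_gt1 : 1 < (N%:R + beta) * alpha.
Implicit Types (s t h T mu S K Th : R) (X : R -> R -> forest d -> R) (Z : R -> 'rV[R]_n).

Notation Ups := (Upsilon sigma).

Lemma powR_theta h m : 0 <= h -> (h `^ alpha) ^+ m = h `^ (m%:R * alpha).
Proof. by move=> h0; rewrite -powR_mulrn ?powR_ge0 // -powRrM mulrC. Qed.

Lemma powR_theta_last h : 0 < h -> (h `^ alpha) ^+ N * (h `^ alpha) `^ beta = h `^ ((N%:R + beta) * alpha).
Proof.
move=> h0; rewrite powR_theta ?ltW // -powRrM mulrDl [alpha * _]mulrC powRD //.
by rewrite (gt_eqF h0) implybT.
Qed.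

Lemma powR_up (T h p q : R) : 0 <= h -> h <= T -> 0 < p -> p <= q ->
  h `^ q <= T `^ (q - p) * h `^ p.
Proof.
move=> h0 hT p0 pq; have T0 := le_trans h0 hT.
move: h0; rewrite le_eqVlt => /predU1P[<-|h0].
  by rewrite !powR0 ?mulr0 // gt_eqF // (lt_le_trans p0).
have -> : h `^ q = h `^ (q - p) * h `^ p by rewrite -powRD ?subrK // (gt_eqF h0) implybT.
rewrite ler_wpM2r ?powR_ge0 //.
by apply: ge0_ler_powR; rewrite ?subr_ge0 ?nnegrE ?(ltW h0).
Qed.

Lemma lip tau : (tree_size tau < N)%N ->
  exists2 L : R, 0 <= L & forall x y, enorm (Ups tau x - Ups tau y) <= L * enorm (x - y).
Proof. by move=> tN; exact: (Ups_lipschitz Ups_lip tN). Qed.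

Lemma hol tau : tree_size tau = N ->
  exists2 L : R, 0 <= L & forall x y, enorm (Ups tau x - Ups tau y) <= L * enorm (x - y) `^ beta.
Proof.
move=> tN; have [L H] := Ups_hol tN; exists `|L| => // x y.
by apply: le_trans (H x y) _; rewrite ler_wpM2r ?powR_ge0 ?ler_norm.
Qed.

Definition tree_bound (Kf : tree d -> R) T X := forall tau, (tree_size tau <= N)%N ->
  forall s t, 0 <= s -> s <= t -> t <= T ->
  `|X s t [mset tau]%mset| <= Kf tau * (t - s) `^ ((tree_size tau)%:R * alpha).

Definition rem_bound T X Z mu l (p c : R) := forall s t, 0 <= s -> s < t -> t <= T -> t - s <= mu ->
  enorm (remainder sigma X Z l s t) <= expR (t / mu) * c * (t - s) `^ p.

Lemma rough_tree_bound T X : branched_rough_path N alpha T X ->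
  exists2 K : R, 0 <= K & tree_bound (fun=> K) T X.
Proof.
move=> [_ _ [C H] _]; exists `|C| => // tau tN s t s0 st tT.
by apply: le_trans (H tau tN s t s0 st tT) _; rewrite ler_wpM2r ?powR_ge0 ?ler_norm.
Qed.

Section Finiteness.
Variables (T : R) (X : R -> R -> forest d -> R) (Z : R -> 'rV[R]_n) (K : R).
Hypotheses (T_gt0 : 0 < T) (K_ge0 : 0 <= K) (X_K : tree_bound (fun=> K) T X).
Hypothesis Z_davie : davie_solution N sigma T X Z.

Lemma X_le_T tau s t : (tree_size tau <= N)%N -> 0 <= s -> s <= t -> t <= T ->
  `|X s t [mset tau]%mset| <= K * T `^ ((tree_size tau)%:R * alpha).
Proof.
move=> tN s0 st tT; apply: le_trans (X_K tN s0 st tT) _; rewrite ler_wpM2l //.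
apply: ge0_ler_powR; rewrite ?nnegrE ?subr_ge0 ?(ltW T_gt0) ?mulr_ge0 ?(ltW alpha_gt0) //.
by rewrite lerBlDr; apply: le_trans tT _; rewrite lerDl.
Qed.

Lemma davie_bounded : exists2 B : R, 0 <= B & forall t, 0 <= t -> t <= T -> enorm (Z t) <= B.
Proof.
have [dl dl0 Hd] := Z_davie ltr01.
have ind m : exists2 B : R, 0 <= B & forall t, 0 <= t -> t <= T -> t <= m%:R * dl -> enorm (Z t) <= B.
  elim: m => [|m [B B0 HB]].
    exists (enorm (Z 0)); first exact: enorm_ge0.
    move=> t t0 _; rewrite mul0r => t0'; have -> : t = 0 by apply/eqP; rewrite eq_le t0 t0'.
    by [].
  set s := m%:R * dl in HB *; have s0 : 0 <= s by rewrite mulr_ge0 // ltW.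
  pose Y := \sum_(tau <- trees_le d N) K * T `^ ((tree_size tau)%:R * alpha) * enorm (Ups tau (Z s)).
  have Y0 : 0 <= Y by apply: sumr_ge0 => tau _; rewrite !mulr_ge0 ?powR_ge0 ?enorm_ge0.
  exists (B + (dl + enorm (Z s) + Y)).
    by rewrite !addr_ge0 ?enorm_ge0 // ltW.
  move=> t t0 tT tm; have [ts|st] := leP t s.
    by apply: le_trans (HB t t0 tT ts) _; rewrite lerDl !addr_ge0 ?enorm_ge0 // ltW.
  rewrite -[leLHS]add0r; apply: lerD => //.
  have td : t - s <= dl by rewrite lerBlDl; move: tm; rewrite -natr1 mulrDl mul1r.
  have -> : Z t = remainder sigma X Z N.+1 s t + Z s
      + \sum_(tau <- trees_le d N) X s t [mset tau]%mset *: Ups tau (Z s).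
    by rewrite remainderE addrAC subrK subrK.
  apply: le_trans (enormD _ _) _; apply: lerD.
    apply: le_trans (enormD _ _) _; rewrite lerD2r.
    by apply: le_trans (Hd s t s0 (ltW st) tT td) _; rewrite mul1r.
  apply: le_trans (enorm_sum _ _) _; rewrite /Y big_seq [leRHS]big_seq.
  apply: ler_sum => tau; rewrite mem_trees_le => tN.
  by rewrite enormZ ler_wpM2r ?enorm_ge0 // X_le_T // ltW.
have [B B0 HB] := ind (Num.truncn (T / dl)).+1; exists B => // t t0 tT; apply: HB => //.
by apply: le_trans tT _; rewrite -ler_pdivrMr // ltW // truncnS_gt.
Qed.

Lemma Ups_davie_bounded : exists2 U : R, 0 <= U &
  {in trees_le d N, forall tau t, 0 <= t -> t <= T -> enorm (Ups tau (Z t)) <= U}.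
Proof.
have [B B0 HB] := davie_bounded.
apply: finite_bound => [tau c c' cc H t t0 tT|tau]; first exact: le_trans (H t t0 tT) cc.
have dist t : 0 <= t -> t <= T -> enorm (Z t - Z 0) <= B + B.
  move=> t0 tT; apply: le_trans (enormB _ _) _; apply: lerD; apply: HB => //.
  exact: ltW.
have split_Ups t : enorm (Ups tau (Z t)) <= enorm (Ups tau (Z t) - Ups tau (Z 0)) + enorm (Ups tau (Z 0)).
  by rewrite -{1}(subrK (Ups tau (Z 0)) (Ups tau (Z t))); exact: enormD.
rewrite mem_trees_le leq_eqVlt => /orP[/eqP tN|tN].
  have [L L0 H] := hol tN; exists (L * (B + B) `^ beta + enorm (Ups tau (Z 0))).
    by rewrite addr_ge0 ?mulr_ge0 ?powR_ge0 ?enorm_ge0.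
  move=> t t0 tT; apply: le_trans (split_Ups t) _; rewrite lerD2r.
  apply: le_trans (H _ _) _; rewrite ler_wpM2l //.
  case/andP: beta01 => b0 _.
  by apply: ge0_ler_powR; rewrite ?nnegrE ?enorm_ge0 ?addr_ge0 ?dist ?(ltW b0).
have [L L0 H] := lip tN; exists (L * (B + B) + enorm (Ups tau (Z 0))).
  by rewrite addr_ge0 ?mulr_ge0 ?addr_ge0 ?enorm_ge0.
move=> t t0 tT; apply: le_trans (split_Ups t) _; rewrite lerD2r.
by apply: le_trans (H _ _) _; rewrite ler_wpM2l // dist.
Qed.

Lemma davie_last_bound : exists2 B : R, 0 <= B & forall s t, 0 <= s -> s <= t -> t <= T ->
  enorm (remainder sigma X Z N.+1 s t) <= B * (t - s).
Proof.
have [dl dl0 Hd] := Z_davie ltr01; have [B B0 HB] := davie_bounded.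
have [U U0 HU] := Ups_davie_bounded.
pose W := B + B + \sum_(tau <- trees_le d N) K * T `^ ((tree_size tau)%:R * alpha) * U.
have W0 : 0 <= W.
  by rewrite !addr_ge0 //; apply: sumr_ge0 => tau _; rewrite !mulr_ge0 ?powR_ge0.
exists (1 + W / dl); first by rewrite addr_ge0 // divr_ge0 // ltW.
move=> s t s0 st tT; have h0 : 0 <= t - s by rewrite subr_ge0.
have Wd0 : 0 <= W / dl by rewrite divr_ge0 // ltW.
rewrite mulrDl; have [td|td] := leP (t - s) dl.
  by apply: le_trans (Hd s t s0 st tT td) _; rewrite lerDl mulr_ge0.
apply: (@le_trans _ _ W); last first.
  rewrite -[leLHS]add0r; apply: lerD; first by rewrite mul1r.
  by rewrite mulrAC ler_pdivlMr // ler_wpM2l // ltW.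
rewrite remainderE; apply: le_trans (enormB _ _) _; apply: lerD.
  apply: le_trans (enormB _ _) _; apply: lerD; apply: HB => //; first exact: le_trans st.
  exact: le_trans tT.
apply: le_trans (enorm_sum _ _) _; rewrite big_seq [leRHS]big_seq.
apply: ler_sum => tau tI; have tN : (tree_size tau <= N)%N by rewrite -mem_trees_le.
rewrite enormZ; apply: ler_pM; rewrite ?enorm_ge0 ?X_le_T //.
by apply: HU => //; exact: le_trans tT.
Qed.

Lemma davie_finite l : (0 < l <= N)%N -> exists2 B : R, 0 <= B & forall s t,
  0 <= s -> s <= t -> t <= T -> enorm (remainder sigma X Z l s t) <= B * (t - s) `^ (l%:R * alpha).
Proof.
pose p m : R := if (m <= N)%N then m%:R * alpha else 1.
suff H j m : (m + j = N.+1)%N -> (0 < m)%N -> exists2 B : R, 0 <= B & forall s t,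
    0 <= s -> s <= t -> t <= T -> enorm (remainder sigma X Z m s t) <= B * (t - s) `^ p m.
  case/andP => l0 lN; have := H (N.+1 - l)%N l; rewrite subnKC ?(leqW lN) // => /(_ erefl l0).
  by rewrite /p lN.
elim: j m => [|j IH] m.
  rewrite addn0 => -> _; have [B B0 HB] := davie_last_bound; exists B => // s t s0 st tT.
  by rewrite /p ltnn powRr1 ?subr_ge0 // HB.
rewrite addnS => -[mj] m0; have [B B0 HB] := IH m.+1 (etrans (addSn m j) (congr1 S mj)) isT.
have mN : (m <= N)%N by rewrite -mj leq_addr.
have [U U0 HU] := Ups_davie_bounded.
have pp : 0 < p m /\ p m <= p m.+1.
  rewrite /p mN; split; first by rewrite mulr_gt0 // ltr0n.
  case: ifP => _; first by rewrite ler_wpM2r ?ler_nat // ltW.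
  by apply: le_trans N_alpha; rewrite ler_wpM2r ?ler_nat // ltW.
exists (B * T `^ (p m.+1 - p m) + \sum_(tau <- trees_eq d m) K * U).
  by rewrite addr_ge0 ?mulr_ge0 ?powR_ge0 //; apply: sumr_ge0 => tau _; rewrite mulr_ge0.
move=> s t s0 st tT; have h0 : 0 <= t - s by rewrite subr_ge0.
have hT : t - s <= T by rewrite lerBlDr; apply: le_trans tT _; rewrite lerDl.
have -> : remainder sigma X Z m s t = remainder sigma X Z m.+1 s t +
    \sum_(tau <- trees_eq d m) X s t [mset tau]%mset *: Ups tau (Z s).
  by case: (m) m0 => // m' _; exact: remainderS.
rewrite mulrDl; apply: le_trans (enormD _ _) _; apply: lerD.
  apply: le_trans (HB s t s0 st tT) _; rewrite -mulrA ler_wpM2l //.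
  by case: pp => p0 pq; exact: powR_up.
apply: le_trans (enorm_sum _ _) _; rewrite mulr_suml big_seq [leRHS]big_seq.
apply: ler_sum => tau; rewrite mem_trees_eq => /eqP tm.
have tN : (tree_size tau <= N)%N by rewrite tm.
rewrite enormZ mulrAC; apply: ler_pM; rewrite ?enorm_ge0 //.
  by apply: le_trans (X_K tN s0 st tT) _; rewrite /p mN tm.
by apply: HU; rewrite ?mem_trees_le //; exact: le_trans tT.
Qed.

End Finiteness.

End DavieSolutions.

Section DavieEstimates.
Variables (R : realType) (n d : nat) (sigma : 'I_d -> 'rV[R]_n -> 'rV[R]_n) (N : nat) (alpha beta : R).
Hypothesis sigmaC : forall (j : 'I_d) (a : 'I_n), Ck (N - 1) (fun y => sigma j y 0 a).
Hypothesis N_gt0 : (0 < N)%N.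
Hypothesis beta01 : 0 < beta <= 1.
Hypothesis Ups_lip : forall tau : tree d, (tree_size tau <= N - 1)%N ->
  glob_lipschitz (Upsilon sigma tau).
Hypothesis Ups_hol : forall tau : tree d, tree_size tau = N ->
  glob_holder beta (Upsilon sigma tau).
Hypothesis alpha_gt0 : 0 < alpha.
Hypothesis N_alpha : N%:R * alpha <= 1.
Hypothesis eta_gt1 : 1 < (N%:R + beta) * alpha.
Implicit Types (s t h T mu S K Th : R) (X : R -> R -> forest d -> R) (Z : R -> 'rV[R]_n).

Notation Ups := (Upsilon sigma).

Notation tree_bound := (tree_bound N alpha).
Notation rem_bound := (rem_bound sigma).

Lemma last_rem_bound K Th : 0 <= K -> 1 <= Th -> exists2 C : R, 0 <= C & forall T X Z mu S,
  0 < mu -> branched_rough_path N alpha T X -> davie_solution N sigma T X Z ->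
  tree_bound (fun=> K) T X -> (Num.min T mu) `^ alpha <= Th -> 0 <= S -> 1 <= S \/ beta = 1 ->
  (forall l, (0 < l <= N)%N -> rem_bound T X Z mu l (l%:R * alpha) S) ->
  rem_bound T X Z mu N.+1 ((N%:R + beta) * alpha) (C * S).
Proof.
move=> K0 Th1; have [C C0 HC] := delta_bound sigmaC N_gt0 beta01 Ups_lip Ups_hol K0 Th1.
have [kap kap0 Hkap] := sewing n eta_gt1.
exists (kap * C); first exact: mulr_ge0.
move=> T X Z mu S mu0 Xr Zd XK minTh S0 S1 HR s t s0 st tT tmu.
set w := expR (t / mu); have w1 : 1 <= w.
  rewrite /w -(@expR0 R) ler_expR divr_ge0 //; last exact: ltW.
  exact: le_trans s0 (ltW st).
have w0 : 0 <= w := le_trans ler01 w1.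
have -> : w * (kap * C * S) * (t - s) `^ ((N%:R + beta) * alpha) =
   kap * (C * (w * S)) * (t - s) `^ ((N%:R + beta) * alpha).
  by ring.
apply: (Hkap (fun s t => remainder sigma X Z N.+1 s t)) => //; first by rewrite !mulr_ge0.
  move=> s' t' ss st' tt; set u := (s' + t') / 2.
  have su : s' < u by rewrite /u ltr_pdivlMr // mulr_natr mulr2n ltrD2l.
  have ut : u < t' by rewrite /u ltr_pdivrMr // mulr_natr mulr2n ltrD2r.
  have h1 : u - s' = (t' - s') / 2 by rewrite /u; field.
  have h2 : t' - u = (t' - s') / 2 by rewrite /u; field.
  set h := (t' - s') / 2 in h1 h2; have h0 : 0 < h by rewrite -h1 subr_gt0.
  have hle : h <= t' - s' by rewrite -h1 lerD2r ltW.
  have hts : t' - s' <= t - s by apply: lerB.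
  have s'0 : 0 <= s' := le_trans s0 ss.
  have t'T : t' <= T := le_trans tt tT.
  have uT : u <= T := le_trans (ltW ut) t'T.
  have hm : h <= Num.min T mu.
    rewrite le_min (le_trans hle (le_trans hts tmu)) andbT.
    apply: le_trans hle _; rewrite lerBlDr; apply: le_trans t'T _; by rewrite lerDl.
  have th0 : 0 < h `^ alpha by rewrite powR_gt0.
  have thTh : h `^ alpha <= Th.
    apply: le_trans minTh; apply: ge0_ler_powR; rewrite ?nnegrE ?(ltW alpha_gt0) ?(ltW h0) //.
    exact: le_trans (ltW h0) hm.
  have A0 : 0 <= w * S by rewrite mulr_ge0.
  have A1 : 1 <= w * S \/ beta = 1.
    by case: S1 => [S1|]; [left; rewrite -[leLHS]mulr1 ler_pM|right].
  have := HC alpha T X Z s' u t' (w * S) (h `^ alpha) Xr s'0 (ltW su) (ltW ut) t'T th0 thTh.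
  have Xsu tau : (tree_size tau <= N)%N -> `|X s' u [mset tau]%mset| <= K * (h `^ alpha) ^+ tree_size tau.
    by move=> tN; rewrite powR_theta ?(ltW h0) // -h1; apply: XK => //; exact: ltW.
  have Xut tau : (tree_size tau <= N)%N -> `|X u t' [mset tau]%mset| <= K * (h `^ alpha) ^+ tree_size tau.
    move=> tN; rewrite powR_theta ?(ltW h0) // -h2; apply: XK => //; last exact: ltW.
    exact: le_trans s'0 (ltW su).
  move=> /(_ Xsu Xut A0 A1) H; apply: le_trans (H _) _.
    move=> l lN; rewrite powR_theta ?(ltW h0) // -h1.
    have umu : u - s' <= mu by rewrite h1; apply: le_trans hle (le_trans hts tmu).
    apply: le_trans (HR l lN s' u s'0 su uT umu) _.
    rewrite ler_wpM2r ?powR_ge0 // ler_wpM2r // /w ler_expR ler_wpM2r ?invr_ge0 ?(ltW mu0) //.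
    exact: le_trans (ltW ut) tt.
  rewrite powR_theta_last // ler_wpM2l ?mulr_ge0 //.
  apply: ge0_ler_powR; rewrite ?nnegrE ?(ltW h0) ?(ltW (lt_trans ltr01 eta_gt1)) ?subr_ge0 ?(ltW st') //.
move=> e /Zd[dl dl0 H]; exists dl => // s' t' ss st' tt td.
by apply: H => //; [exact: le_trans ss|exact: le_trans tT].
Qed.

Lemma weighted_sup_bound T X Z mu S : 0 < mu -> 0 <= S ->
  rem_bound T X Z mu 1 (1%:R * alpha) S -> forall s, 0 <= s -> s <= T ->
  enorm (Z s - Z 0) <= expR (s / mu) * (2 * S * (Num.min T mu) `^ alpha).
Proof.
move=> mu0 S0 HR.
have step s t : 0 <= s -> s <= t -> t <= T -> t - s <= mu ->
    enorm (Z t - Z s) <= expR (t / mu) * (S * (Num.min T mu) `^ alpha).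
  move=> s0; rewrite le_eqVlt => /predU1P[<- _ _|st tT tmu].
    by rewrite subrr enorm0 !mulr_ge0 ?expR_ge0 ?powR_ge0.
  have := HR s t s0 st tT tmu; rewrite remainder1 mul1r => /le_trans; apply.
  rewrite -mulrA ler_wpM2l ?expR_ge0 // ler_wpM2l //.
  have h0 : 0 <= t - s by rewrite subr_ge0 ltW.
  have hm : t - s <= Num.min T mu.
    rewrite le_min tmu andbT lerBlDr; apply: le_trans tT _; by rewrite lerDl.
  by apply: ge0_ler_powR; rewrite ?nnegrE ?(ltW alpha_gt0) // (le_trans h0).
have P0 : 0 <= S * (Num.min T mu) `^ alpha by rewrite mulr_ge0 ?powR_ge0.
have ind m : forall s, 0 <= s -> s <= T -> s <= m%:R * mu ->
    enorm (Z s - Z 0) <= expR (s / mu) * (2 * (S * (Num.min T mu) `^ alpha)).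
  elim: m => [|m IH] s s0 sT.
    rewrite mul0r => s0'; have -> : s = 0 by apply/eqP; rewrite eq_le s0 s0'.
    by rewrite subrr enorm0 !mulr_ge0 ?expR_ge0 ?powR_ge0.
  move=> sm; have [smu|smu] := leP s mu.
    have := step 0 s (lexx _) s0 sT; rewrite subr0 => /(_ smu) /le_trans; apply.
    by rewrite ler_wpM2l ?expR_ge0 // ler_peMl // ler1n.
  have r0 : 0 <= s - mu by rewrite subr_ge0 ltW.
  have rs : s - mu <= s by rewrite lerBlDr lerDl ltW.
  have rT : s - mu <= T by apply: le_trans sT.
  have rm : s - mu <= m%:R * mu.
    by rewrite lerBlDr; apply: le_trans sm _; rewrite -natr1 mulrDl mul1r.
  have dm : s - (s - mu) <= mu by rewrite opprB addrC subrK.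
  have H1 := step _ s r0 rs sT dm; have H2 := IH _ r0 rT rm.
  apply: le_trans (enorm_distD (Z (s - mu)) _ _) _; apply: le_trans (lerD H1 H2) _.
  have -> : expR ((s - mu) / mu) = expR (s / mu) * (expR 1)^-1.
    by rewrite mulrBl divff ?gt_eqF // expRD expRN.
  rewrite -mulrA -mulrDr ler_wpM2l ?expR_ge0 // mulr2n [leRHS]mulrDl !mul1r lerD2l.
  rewrite mulrA ler_piMl // ler_pdivrMl ?expR_gt0 // mulr1 -mulr2n.
  by apply: le_trans (expR_ge1Dx _); rewrite mulr2n.
move=> s s0 sT; rewrite -mulrA; apply: (ind (Num.truncn (s / mu)).+1) => //.
by rewrite -ler_pdivrMr // ltW // truncnS_gt.
Qed.

Lemma Ups_growth tau : (tree_size tau <= N)%N -> exists2 L : R, 0 <= L & forall T Z mu S (e : R),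
  0 < mu -> 0 <= S -> 1 <= S \/ beta = 1 -> 0 < e -> e <= 1 ->
  (forall s, 0 <= s -> s <= T -> enorm (Z s - Z 0) <= expR (s / mu) * (2 * S * e `^ alpha)) ->
  forall s, 0 <= s -> s <= T ->
  enorm (Ups tau (Z s)) <= expR (s / mu) * (enorm (Ups tau (Z 0)) + L * S * e `^ (alpha * beta)).
Proof.
case/andP: (beta01) => b0 b1 tN.
have main (L : R) : 0 <= L ->
    (forall T Z mu S (e : R), 0 < mu -> 0 <= S -> 1 <= S \/ beta = 1 -> 0 < e -> e <= 1 ->
     (forall s, 0 <= s -> s <= T -> enorm (Z s - Z 0) <= expR (s / mu) * (2 * S * e `^ alpha)) ->
     forall s, 0 <= s -> s <= T ->
     enorm (Ups tau (Z s) - Ups tau (Z 0)) <= expR (s / mu) * (L * S * e `^ (alpha * beta))) ->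
    exists2 L : R, 0 <= L & forall T Z mu S (e : R),
     0 < mu -> 0 <= S -> 1 <= S \/ beta = 1 -> 0 < e -> e <= 1 ->
     (forall s, 0 <= s -> s <= T -> enorm (Z s - Z 0) <= expR (s / mu) * (2 * S * e `^ alpha)) ->
     forall s, 0 <= s -> s <= T ->
     enorm (Ups tau (Z s)) <= expR (s / mu) * (enorm (Ups tau (Z 0)) + L * S * e `^ (alpha * beta)).
  move=> L0 H; exists L => // T Z mu S e mu0 S0 S1 e0 e1 HZ s s0 sT.
  rewrite -{1}(subrK (Ups tau (Z 0)) (Ups tau (Z s))) mulrDr addrC.
  apply: le_trans (enormD _ _) _; apply: lerD; last exact: (H T).
  rewrite ler_peMl ?enorm_ge0 // -(@expR0 R) ler_expR divr_ge0 // ltW //.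
move: tN; rewrite leq_eqVlt => /orP[/eqP tN|tN].
  have [L L0 HL] := hol Ups_hol tN; apply: (main (L * 2)); first by rewrite mulr_ge0.
  move=> T Z mu S e mu0 S0 S1 e0 e1 HZ s s0 sT; apply: le_trans (HL _ _) _.
  have W0 : 0 <= expR (s / mu) * (2 * S * e `^ alpha) by rewrite !mulr_ge0 ?expR_ge0 ?powR_ge0.
  apply: (@le_trans _ _ (L * (expR (s / mu) * (2 * S * e `^ alpha)) `^ beta)).
    rewrite ler_wpM2l //; apply: ge0_ler_powR; rewrite ?nnegrE ?enorm_ge0 ?(ltW b0) //.
    exact: HZ.
  have w1 : 1 <= expR (s / mu) by rewrite -(@expR0 R) ler_expR divr_ge0 // ltW.
  rewrite !powRM ?mulr_ge0 ?expR_ge0 ?powR_ge0 // -powRrM.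
  have -> : expR (s / mu) * (L * 2 * S * e `^ (alpha * beta)) =
     L * (expR (s / mu) * (2 * S * e `^ (alpha * beta))) by ring.
  rewrite ler_wpM2l //; apply: ler_pM; rewrite ?powR_ge0 ?mulr_ge0 ?powR_ge0 //.
    exact: ler1_powR.
  rewrite ler_wpM2r ?powR_ge0 //; apply: ler_pM; rewrite ?powR_ge0 //.
    by apply: ler1_powR; rewrite ?ler1n.
  exact: (powR_le_self beta01).
have [L L0 HL] := lip Ups_lip tN; apply: (main (L * 2)); first by rewrite mulr_ge0.
move=> T Z mu S e mu0 S0 S1 e0 e1 HZ s s0 sT; apply: le_trans (HL _ _) _.
apply: le_trans (ler_wpM2l L0 (HZ s s0 sT)) _.
rewrite mulrCA ler_wpM2l ?expR_ge0 // !mulrA ler_wpM2l ?mulr_ge0 //.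
apply: ger_powR; first by rewrite e0.
by rewrite -[leRHS]mulr1 ler_wpM2l // ltW.
Qed.

Lemma rem_absorb (Kf : tree d -> R) : (forall tau, 0 <= Kf tau) ->
  exists2 G : R, 0 <= G & forall T X Z mu S,
  0 < T -> 0 < mu -> Num.min T mu <= 1 -> branched_rough_path N alpha T X ->
  davie_solution N sigma T X Z -> tree_bound Kf T X -> 0 <= S -> 1 <= S \/ beta = 1 ->
  (forall l, (0 < l <= N)%N -> rem_bound T X Z mu l (l%:R * alpha) S) ->
  forall l, (0 < l <= N)%N -> rem_bound T X Z mu l (l%:R * alpha)
    (\sum_(tau <- trees_eq d l) Kf tau * enorm (Ups tau (Z 0))
     + G * S * (Num.min T mu) `^ (alpha * beta)).
Proof.
move=> Kf0; case/andP: (beta01) => b0 b1.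
pose K := \sum_(tau <- trees_le d N) Kf tau.
have K0 : 0 <= K by apply: sumr_ge0.
have KfK tau : (tree_size tau <= N)%N -> Kf tau <= K.
  move=> tN; rewrite /K (bigD1_seq tau) ?trees_le_uniq ?mem_trees_le //= lerDl.
  exact: sumr_ge0.
have [C C0 HC] := last_rem_bound K0 (lexx 1).
have [L L0 HL] : exists2 L, 0 <= L & {in trees_le d N, forall tau, forall T Z mu S (e : R),
     0 < mu -> 0 <= S -> 1 <= S \/ beta = 1 -> 0 < e -> e <= 1 ->
     (forall s, 0 <= s -> s <= T -> enorm (Z s - Z 0) <= expR (s / mu) * (2 * S * e `^ alpha)) ->
     forall s, 0 <= s -> s <= T ->
     enorm (Ups tau (Z s)) <= expR (s / mu) * (enorm (Ups tau (Z 0)) + L * S * e `^ (alpha * beta))}.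
  apply: finite_bound => [tau c c' cc H T Z mu S e mu0 S0 S1 e0 e1 HZ s s0 sT|tau].
    apply: le_trans (H T Z mu S e mu0 S0 S1 e0 e1 HZ s s0 sT) _.
    by rewrite ler_wpM2l ?expR_ge0 // lerD2l ler_wpM2r ?powR_ge0 // ler_wpM2r.
  by rewrite mem_trees_le; exact: Ups_growth.
exists (K * L + (1 + C)); first by rewrite !addr_ge0 ?mulr_ge0.
move=> T X Z mu S T0 mu0 e1 Xr Zd XK S0 S1 HR l lN s t s0 st tT tmu.
set e := Num.min T mu in e1 *; have e0 : 0 < e by rewrite lt_min T0 mu0.
case/andP: (lN) => l0 lN'.
have XK' : tree_bound (fun=> K) T X.
  move=> tau tN s1 t1 a1 a2 a3; apply: le_trans (XK tau tN s1 t1 a1 a2 a3) _.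
  by rewrite ler_wpM2r ?powR_ge0 // KfK.
have ea1 : e `^ alpha <= 1.
  have := @ge0_ler_powR _ alpha (ltW alpha_gt0) e 1; rewrite powR1 !nnegrE; apply => //.
  exact: ltW.
have Hlast := HC T X Z mu S mu0 Xr Zd XK' ea1 S0 S1 HR.
have HZ := weighted_sup_bound mu0 S0 (HR 1%N N_gt0).
have h0 : 0 < t - s by rewrite subr_gt0.
have he : t - s <= e.
  rewrite le_min tmu andbT lerBlDr; apply: le_trans tT _; by rewrite lerDl.
have sT : s <= T := le_trans (ltW st) tT.
have w0 : 0 <= expR (t / mu) := expR_ge0 _.
have hl0 : 0 <= (t - s) `^ (l%:R * alpha) := powR_ge0 _ _.
have -> : remainder sigma X Z l s t = remainder sigma X Z l.+1 s t +
    \sum_(tau <- trees_eq d l) X s t [mset tau]%mset *: Ups tau (Z s).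
  by case: (l) l0 => // l' _; exact: remainderS.
set E := e `^ (alpha * beta); have E0 : 0 <= E := powR_ge0 _ _.
have -> : expR (t / mu) * (\sum_(tau <- trees_eq d l) Kf tau * enorm (Ups tau (Z 0)) +
    (K * L + (1 + C)) * S * E) * (t - s) `^ (l%:R * alpha) =
    expR (t / mu) * ((1 + C) * S * E) * (t - s) `^ (l%:R * alpha) +
    expR (t / mu) * (\sum_(tau <- trees_eq d l) Kf tau * enorm (Ups tau (Z 0)) + K * L * S * E)
      * (t - s) `^ (l%:R * alpha).
  by ring.
apply: le_trans (enormD _ _) _; apply: lerD.
  have pw (q : R) : beta <= q -> q <= 1 -> (t - s) `^ (alpha * q) <= E.
    move=> bq q1; apply: (@le_trans _ _ (e `^ (alpha * q))).
      have aq0 : 0 <= alpha * q := mulr_ge0 (ltW alpha_gt0) (le_trans (ltW b0) bq).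
      by apply: ge0_ler_powR; rewrite ?nnegrE ?(ltW h0) ?(ltW e0).
    by apply: ger_powR; [rewrite e0|rewrite ler_wpM2l // ltW].
  have fin (c q r : R) : 0 <= c -> c <= 1 + C -> beta <= q -> q <= 1 -> r = l%:R * alpha + alpha * q ->
      expR (t / mu) * (c * S) * (t - s) `^ r <=
      expR (t / mu) * ((1 + C) * S * E) * (t - s) `^ (l%:R * alpha).
    move=> c0 cC bq q1 ->.
    have -> : (t - s) `^ (l%:R * alpha + alpha * q) = (t - s) `^ (alpha * q) * (t - s) `^ (l%:R * alpha).
      by rewrite powRD 1?mulrC // (gt_eqF h0) implybT.
    rewrite mulrA ler_wpM2r // -!mulrA ler_wpM2l // !mulrA; apply: ler_pM; rewrite ?powR_ge0 ?mulr_ge0 ?pw //.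
    by rewrite ler_wpM2r.
  move: lN'; rewrite leq_eqVlt => /orP[/eqP lN'|lN'].
    rewrite lN'; apply: le_trans (Hlast s t s0 st tT tmu) _; rewrite -lN'.
    apply: fin => //; first by rewrite lerDr.
    by rewrite mulrDl [beta * _]mulrC.
  apply: le_trans (HR l.+1 _ s t s0 st tT tmu) _ => //.
  rewrite -{1}[S]mul1r; apply: (fin 1 1) => //; first by rewrite lerDl.
  by rewrite -natr1 mulrDl mul1r mulr1.
apply: le_trans (enorm_sum _ _) _.
have sumE : \sum_(tau <- trees_eq d l) Kf tau <= K.
  rewrite /K [leRHS](bigID (fun tau => tree_size tau == l)) /= -[leLHS]addr0; apply: lerD; last exact: sumr_ge0.
  have pe : perm_eq (trees_eq d l) [seq tau <- trees_le d N | tree_size tau == l]; last first.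
    by rewrite (perm_big _ pe) big_filter.
  apply: uniq_perm; rewrite ?filter_uniq ?trees_le_uniq ?trees_eq_uniq //.
  by move=> tau; rewrite mem_trees_eq mem_filter mem_trees_le; case: eqP => //= ->; rewrite lN'.
apply: (@le_trans _ _ (\sum_(tau <- trees_eq d l) Kf tau * (enorm (Ups tau (Z 0)) + L * S * E)
    * (expR (t / mu) * (t - s) `^ (l%:R * alpha)))).
  rewrite big_seq [leRHS]big_seq; apply: ler_sum => tau; rewrite mem_trees_eq => /eqP tl.
  have tN : (tree_size tau <= N)%N by rewrite tl.
  have tI : tau \in trees_le d N by rewrite mem_trees_le.
  rewrite enormZ.
  have -> : Kf tau * (enorm (Ups tau (Z 0)) + L * S * E) * (expR (t / mu) * (t - s) `^ (l%:R * alpha)) =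
    (Kf tau * (t - s) `^ (l%:R * alpha)) * (expR (t / mu) * (enorm (Ups tau (Z 0)) + L * S * E)).
    by ring.
  apply: ler_pM; rewrite ?enorm_ge0 //.
    by rewrite -tl; apply: XK => //; exact: ltW.
  apply: le_trans (HL tau tI T Z mu S e mu0 S0 S1 e0 e1 HZ s s0 sT) _.
  rewrite ler_wpM2r ?addr_ge0 ?enorm_ge0 ?mulr_ge0 // ler_expR ler_wpM2r ?invr_ge0 ?(ltW mu0) ?(ltW st) //.
rewrite -mulr_suml; set D := \sum_(tau <- _) _ * enorm _; set W := (t - s) `^ _.
have -> : \sum_(tau <- trees_eq d l) Kf tau * (enorm (Ups tau (Z 0)) + L * S * E) =
    D + (\sum_(tau <- trees_eq d l) Kf tau) * (L * S * E).
  by rewrite mulr_suml -big_split; apply: eq_bigr => tau _; rewrite mulrDr.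
have -> : expR (t / mu) * (D + K * L * S * E) * W = (D + K * (L * S * E)) * (expR (t / mu) * W).
  by ring.
rewrite ler_wpM2r ?mulr_ge0 // lerD2l ler_wpM2r // !mulr_ge0 //.
Qed.

End DavieEstimates.

Section ExtendedNorms.
Variables (R : realType) (n d : nat) (sigma : 'I_d -> 'rV[R]_n -> 'rV[R]_n).
Implicit Types (s t T mu p c : R) (X : R -> R -> forest d -> R) (Z : R -> 'rV[R]_n).

Lemma rem_norm_leP T X Z l p mu c :
  (rem_norm sigma T X Z l p mu <= c%:E)%E <-> rem_bound sigma T X Z mu l p c.
Proof.
have eq s t : s < t -> (expR (- (t / mu)) * enorm (remainder sigma X Z l s t) / (t - s) `^ p <= c) =
   (enorm (remainder sigma X Z l s t) <= expR (t / mu) * c * (t - s) `^ p).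
  move=> st; rewrite ler_pdivrMr ?powR_gt0 ?subr_gt0 // expRN ler_pdivrMl ?expR_gt0 //.
  by rewrite mulrA.
split=> [H s t s0 st tT tmu|H].
  rewrite -eq // -lee_fin; apply: le_trans H; apply: ereal_sup_ubound.
  by exists s, t.
by apply: ge_ereal_sup => _ [s [t [s0 st tT tmu ->]]]; rewrite lee_fin eq // H.
Qed.

Lemma rem_norm_ge0 T X Z l p mu : 0 < T -> 0 < mu -> (0 <= rem_norm sigma T X Z l p mu)%E.
Proof.
move=> T0 mu0; set m := Num.min T mu; have m0 : 0 < m by rewrite lt_min T0.
apply: (@le_trans _ _ (expR (- (m / mu)) * enorm (remainder sigma X Z l 0 m) / (m - 0) `^ p)%:E).
  by rewrite lee_fin divr_ge0 ?powR_ge0 // mulr_ge0 ?expR_ge0 ?enorm_ge0.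
apply: ereal_sup_ubound; exists 0, m; split=> //; first by rewrite ge_min lexx.
by rewrite subr0 ge_min lexx orbT.
Qed.

Lemma rp_norm_ge0 alpha T X tau : 0 < T -> (0 <= rp_norm alpha T X tau)%E.
Proof.
move=> T0.
apply: (@le_trans _ _ (`|X 0 T [mset tau]%mset| / (T - 0) `^ ((tree_size tau)%:R * alpha))%:E).
  by rewrite lee_fin divr_ge0 ?powR_ge0.
by apply: ereal_sup_ubound; exists 0, T; split.
Qed.

Lemma rp_norm_tree_bound N alpha T X (K : tree d -> R) : 0 < alpha ->
  branched_rough_path N alpha T X ->
  (forall tau : tree d, (tree_size tau <= N)%N -> rp_norm alpha T X tau = (K tau)%:E) ->
  tree_bound N alpha K T X.
Proof.
move=> a0 [_ _ [C HC] _] HK tau tN s t s0; rewrite le_eqVlt => /predU1P[<-|st] tT.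
  have := HC tau tN s s s0 (lexx _) tT; rewrite subrr powR0 ?mulr0 //.
  by rewrite mulf_neq0 ?gt_eqF // ltr0n tree_size_gt0.
rewrite -ler_pdivrMr ?powR_gt0 ?subr_gt0 // -lee_fin -HK //.
by apply: ereal_sup_ubound; exists s, t.
Qed.

End ExtendedNorms.

Section TreeSums.
Variables (R : realType) (d : nat).

Lemma bullet_inj : injective (@bullet d).
Proof. by move=> i j /(congr1 (@tree_root d)). Qed.

Lemma big_trees_eq1 (F : tree d -> R) : \sum_(tau <- trees_eq d 1) F tau = \sum_(i < d) F (bullet i).
Proof.
rewrite -(big_map (@bullet d) xpredT F); apply: perm_big; apply: uniq_perm.
- exact: trees_eq_uniq.
- by rewrite map_inj_uniq ?index_enum_uniq //; exact: bullet_inj.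
move=> tau; rewrite mem_trees_eq; apply/eqP/mapP => [t1|[i _ ->]]; last first.
  by rewrite tree_size_node forest_size_mset0.
exists (tree_root tau); first by rewrite mem_index_enum.
rewrite /bullet -[LHS]node_root_branches; congr node; apply/eqP; rewrite -size_mset_eq0 -leqn0.
apply: leq_trans (size_le_forest_size _) _; rewrite -ltnS -(tree_size_node (tree_root tau)).
by rewrite node_root_branches t1.
Qed.

Lemma sum_trees_ge2 N (F : tree d -> R) : (0 < N)%N ->
  \sum_(tau <- trees_le d N | (2 <= tree_size tau)%N) F tau =
  \sum_(2 <= l < N.+1) \sum_(tau <- trees_eq d l) F tau.
Proof.
move=> N0; rewrite big_mkcond big_trees_le.
rewrite -(big_mkord xpredT (fun l => \sum_(tau <- trees_eq d l.+1) if (2 <= tree_size tau)%N then F tau else 0)).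
rewrite big_ltn // big1_seq ?add0r; last first.
  by move=> tau /andP[_]; rewrite mem_trees_eq => /eqP ->.
rewrite [RHS]big_add1; apply: eq_big_nat => l /andP[l0 _]; apply: eq_big_seq => tau.
by rewrite mem_trees_eq => /eqP ->; rewrite ltnS l0.
Qed.

Lemma fsbig_trees_EFin N (P : pred (tree d)) (F : tree d -> \bar R) (G : tree d -> R) :
  (forall tau, (tree_size tau <= N)%N -> F tau = (G tau)%:E) ->
  \sum_(tau \in [set tau | P tau && (tree_size tau <= N)%N]) F tau =
  (\sum_(tau <- trees_le d N | P tau) G tau)%:E.
Proof.
move=> FG; rewrite (@fsbigE _ _ _ _ _ [seq tau <- trees_le d N | P tau]).
- rewrite -sumEFin big_filter_cond [LHS]big_seq_cond [RHS]big_seq_cond.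
  apply: eq_big => tau; rewrite mem_trees_le; last by case/andP=> /FG.
  case tN: (tree_size tau <= N)%N => //=; case Pt: (P tau) => //=.
  by rewrite mem_set //= Pt tN.
- by rewrite filter_uniq ?trees_le_uniq.
- by move=> tau /=; rewrite mem_filter mem_trees_le.
- by move=> tau /= ?; rewrite mem_filter mem_trees_le => /negP.
Qed.

End TreeSums.

Section NormEstimates.
Variables (R : realType) (n d : nat) (sigma : 'I_d -> 'rV[R]_n -> 'rV[R]_n) (N : nat) (alpha beta : R).
Hypothesis sigmaC : forall (j : 'I_d) (a : 'I_n), Ck (N - 1) (fun y => sigma j y 0 a).
Hypothesis N_gt0 : (0 < N)%N.
Hypothesis beta01 : 0 < beta <= 1.
Hypothesis Ups_lip : forall tau : tree d, (tree_size tau <= N - 1)%N ->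
  glob_lipschitz (Upsilon sigma tau).
Hypothesis Ups_hol : forall tau : tree d, tree_size tau = N ->
  glob_holder beta (Upsilon sigma tau).
Hypothesis alpha_gt0 : 0 < alpha.
Hypothesis N_alpha : N%:R * alpha <= 1.
Hypothesis eta_gt1 : 1 < (N%:R + beta) * alpha.
Implicit Types (s t h T mu S c : R) (X : R -> R -> forest d -> R) (Z : R -> 'rV[R]_n).

Lemma rem_norm_finite T X Z mu : 0 < T -> 0 < mu -> branched_rough_path N alpha T X ->
  davie_solution N sigma T X Z -> exists a : nat -> R,
    [/\ forall l, 0 <= a l,
        forall l, (0 < l <= N)%N -> rem_norm sigma T X Z l (l%:R * alpha) mu = (a l)%:E &
        forall l c, (0 < l <= N)%N -> rem_bound sigma T X Z mu l (l%:R * alpha) c <-> a l <= c].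
Proof.
move=> T0 mu0 Xr Zd.
pose a l := fine (rem_norm sigma T X Z l (l%:R * alpha) mu).
have Ha l : (0 < l <= N)%N -> rem_norm sigma T X Z l (l%:R * alpha) mu = (a l)%:E.
  move=> lN; rewrite /a fineK // ge0_fin_numE ?rem_norm_ge0 //.
  have [K K0 XK] := rough_tree_bound Xr.
  have [B B0 HB] := davie_finite beta01 Ups_lip Ups_hol alpha_gt0 N_alpha
    T0 K0 XK Zd lN.
  apply: (@le_lt_trans _ _ B%:E); last exact: ltry.
  apply/rem_norm_leP => s t s0 st tT tmu; apply: le_trans (HB s t s0 (ltW st) tT) _.
  rewrite ler_wpM2r ?powR_ge0 // ler_peMl // -(@expR0 R) ler_expR divr_ge0 ?(ltW mu0) //.
  exact: le_trans s0 (ltW st).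
exists a; split=> [l|//|l c lN]; first by rewrite fine_ge0 ?rem_norm_ge0.
by rewrite -lee_fin -Ha //; apply: iff_sym; exact: rem_norm_leP.
Qed.

Lemma rem_norm_absorb (Kf : tree d -> R) : (forall tau, 0 <= Kf tau) ->
  exists2 eps0 : R, 0 < eps0 & forall T X Z mu (a : nat -> R) S,
  0 < T -> 0 < mu -> Num.min T mu <= eps0 -> branched_rough_path N alpha T X ->
  davie_solution N sigma T X Z -> tree_bound N alpha Kf T X -> 1 <= S \/ beta = 1 ->
  (forall l c, (0 < l <= N)%N -> rem_bound sigma T X Z mu l (l%:R * alpha) c <-> a l <= c) ->
  (forall l, (0 < l <= N)%N -> a l <= S) -> 0 <= S ->
  exists2 delta : R, 0 <= delta /\ N%:R * delta <= S / 2 & forall l, (0 < l <= N)%N ->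
    a l <= \sum_(tau <- trees_eq d l) Kf tau * enorm (Upsilon sigma tau (Z 0)) + delta.
Proof.
move=> Kf0; case/andP: (beta01) => b0 b1.
have [G G0 HG] := rem_absorb sigmaC N_gt0 beta01 Ups_lip Ups_hol alpha_gt0 eta_gt1 Kf0.
have ab0 : 0 < alpha * beta by rewrite mulr_gt0.
pose q := (2 * (N%:R * G + 1))^-1.
have NG0 : 0 <= N%:R * G by rewrite mulr_ge0 // ler0n.
have q0 : 0 < q by rewrite invr_gt0 mulr_gt0 // ltr_wpDl.
exists (Num.min 1 (q `^ (alpha * beta)^-1)); first by rewrite lt_min ltr01 powR_gt0.
move=> T X Z mu a S T0 mu0; rewrite le_min => /andP[m1 mq] Xr Zd XK S1 Ha aS S0.
exists (G * S * (Num.min T mu) `^ (alpha * beta)); last first.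
  move=> l lN; apply/Ha => //; apply: HG => // k kN; apply/Ha => //; exact: aS.
split; first by rewrite !mulr_ge0 ?powR_ge0.
have m0 : 0 <= Num.min T mu by rewrite le_min !ltW.
have mE : (Num.min T mu) `^ (alpha * beta) <= q.
  have : (Num.min T mu) `^ (alpha * beta) <= (q `^ (alpha * beta)^-1) `^ (alpha * beta).
    by apply: ge0_ler_powR; rewrite ?nnegrE ?powR_ge0 // ltW.
  by rewrite -powRrM mulVf ?gt_eqF // powRr1 // ltW.
apply: le_trans (_ : N%:R * (G * S * q) <= _).
  by rewrite ler_wpM2l ?ler0n // ler_wpM2l // mulr_ge0.
have -> : N%:R * (G * S * q) = S * (N%:R * G * q) by ring.
apply: ler_wpM2l => //; rewrite /q invfM mulrCA ger_pMr ?invr_gt0 //.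
by rewrite ler_pdivrMr ?mul1r ?lerDl // ltr_wpDl.
Qed.

End NormEstimates.

Section Absorption.
Variable R : realType.
Implicit Types (a D : nat -> R).

Lemma max1_sum_ge a N : (forall l, 0 <= a l) ->
  let S := Num.max 1 (a 1%N) + \sum_(2 <= l < N.+1) a l in
  1 <= S /\ forall l, (0 < l <= N)%N -> a l <= S.
Proof.
move=> a_ge0 S; have s0 : 0 <= \sum_(2 <= l < N.+1) a l by apply: sumr_ge0.
split; first by apply: ler_wpDr => //; rewrite le_max lexx.
case=> // -[_|l lN]; first by apply: ler_wpDr => //; rewrite le_max lexx orbT.
apply: ler_wpDl; first by rewrite le_max ler01.
by rewrite (bigD1_seq l.+2) ?iota_uniq ?mem_index_iota ?ltnS //= lerDl sumr_ge0.
Qed.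

Lemma sum_ge a N l : (forall l, 0 <= a l) -> (0 < l <= N)%N -> a l <= \sum_(1 <= k < N.+1) a k.
Proof.
by move=> a_ge0 lN; rewrite (bigD1_seq l) ?iota_uniq ?mem_index_iota ?ltnS //= lerDl sumr_ge0.
Qed.

Lemma ler_sum_shift a D N m delta : (0 < m)%N ->
  (forall l, (0 < l <= N)%N -> a l <= D l + delta) ->
  \sum_(m <= l < N.+1) a l <= \sum_(m <= l < N.+1) D l + (N.+1 - m)%:R * delta.
Proof.
move=> m0 aD; rewrite mulr_natl -sumr_const_nat -big_split /=.
apply: ler_sum_nat => l /andP[ml lN]; apply: aD.
by rewrite (leq_trans m0 ml).
Qed.

Lemma sum_absorb a D N delta :
  N%:R * delta <= (\sum_(1 <= l < N.+1) a l) / 2 ->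
  (forall l, (0 < l <= N)%N -> a l <= D l + delta) ->
  \sum_(1 <= l < N.+1) a l <= 2 * \sum_(1 <= l < N.+1) D l.
Proof.
move=> NS /(ler_sum_shift (leqnn 1)); rewrite subn1 /=; move: NS.
move: (\sum_(1 <= l < _) _) (\sum_(1 <= l < _) _) (N%:R * delta) => x y z; lra.
Qed.

Lemma max1_sum_absorb a D N delta : (0 < N)%N -> 0 <= delta ->
  let S := Num.max 1 (a 1%N) + \sum_(2 <= l < N.+1) a l in
  N%:R * delta <= S / 2 -> (forall l, (0 < l <= N)%N -> a l <= D l + delta) ->
  S <= 2 * (Num.max 1 (D 1%N) + \sum_(2 <= l < N.+1) D l).
Proof.
move=> N0 delta0 S NS aD; have sD := ler_sum_shift (isT : (0 < 2)%N) aD.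
have m1 : Num.max 1 (a 1%N) <= Num.max 1 (D 1%N) + delta.
  rewrite ge_max ler_wpDr ?le_max ?lexx //=; apply: le_trans (aD _ _) _ => //.
  by rewrite lerD2r le_max lexx orbT.
have := lerD m1 sD; rewrite -/S; move: NS.
set x := N%:R * delta; rewrite subSS natrB //; have -> : (N%:R - 1) * delta = x - delta by rewrite /x; ring.
clearbody S x; set y := Num.max 1 (D _); set z := \sum_(2 <= l < N.+1) D l; clearbody y z.
clear; lra.
Qed.

End Absorption.

Theorem theorem5p4 (R : realType) (n d N : nat) (alpha beta : R)
    (sigma : 'I_d -> 'rV[R]_n -> 'rV[R]_n)
    (halpha : 0 < alpha <= 1)
    (hN : Num.floor alpha^-1 = N%:Z)
    (hbeta : alpha^-1 - N%:R < beta <= 1)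
    (hsigma : forall (j : 'I_d) (a : 'I_n), Ck (N - 1) (fun y => sigma j y 0 a))
    (hlip : forall tau : tree d, (tree_size tau <= N - 1)%N ->
       glob_lipschitz (Upsilon sigma tau))
    (hhol : forall tau : tree d, tree_size tau = N ->
       glob_holder beta (Upsilon sigma tau)) :
  [/\ (* (i) *)
      forall (T : R) (x : R -> 'rV[R]_d) (X : R -> R -> forest d -> R),
        0 < T -> branched_lift N alpha T x X ->
        exists2 c : R, 0 < c &
          forall (mu : R) (Z : R -> 'rV[R]_n),
            0 < mu -> davie_solution N sigma T X Z ->
            (rem_norm sigma T X Z N.+1 ((N%:R + beta) * alpha) mu
             <= c%:E * (maxe 1 (rem_norm sigma T X Z 1 alpha mu)
                        + \sum_(2 <= l < N.+1)
                            rem_norm sigma T X Z l (l%:R * alpha) mu))%E,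
      (* (ii) : K prescribes the numbers ||X(tau)||_(|tau| alpha), |tau| <= N *)
      forall K : tree d -> R,
        exists2 eps0 : R, 0 < eps0 &
          forall (T : R) (x : R -> 'rV[R]_d) (X : R -> R -> forest d -> R),
            0 < T -> branched_lift N alpha T x X ->
            (forall tau : tree d, (tree_size tau <= N)%N ->
               rp_norm alpha T X tau = (K tau)%:E) ->
          forall (mu : R) (Z : R -> 'rV[R]_n),
            0 < mu -> Num.min T mu <= eps0 -> davie_solution N sigma T X Z ->
            (maxe 1 (rem_norm sigma T X Z 1 alpha mu)
             + \sum_(2 <= i < N.+1) rem_norm sigma T X Z i (i%:R * alpha) mu
             <= 2%:E *
                (maxe 1 (\sum_(i < d) (enorm (Upsilon sigma (bullet i) (Z 0%R)))%:E
                                      * rp_norm alpha T X (bullet i))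
                 + \sum_(tau \in [set tau : tree d | (2 <= tree_size tau <= N)%N])
                     ((tree_size tau)%:R * enorm (Upsilon sigma tau (Z 0%R)))%:E
                     * rp_norm alpha T X tau))%E &
      (* (iii) *)
      beta = 1 ->
      forall K : tree d -> R,
        exists2 eps0 : R, 0 < eps0 &
          forall (T : R) (x : R -> 'rV[R]_d) (X : R -> R -> forest d -> R),
            0 < T -> branched_lift N alpha T x X ->
            (forall tau : tree d, (tree_size tau <= N)%N ->
               rp_norm alpha T X tau = (K tau)%:E) ->
          forall (mu : R) (Z : R -> 'rV[R]_n),
            0 < mu -> Num.min T mu <= eps0 -> davie_solution N sigma T X Z ->
            (\sum_(1 <= i < N.+1) rem_norm sigma T X Z i (i%:R * alpha) mu
             <= 2%:E *
                \sum_(tau \in [set tau : tree d | (tree_size tau <= N)%N])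
                  ((tree_size tau)%:R * enorm (Upsilon sigma tau (Z 0%R)))%:E
                  * rp_norm alpha T X tau)%E].
Proof.
case/andP: halpha => a0 a1; case/andP: hbeta => b1 b2.
have ai0 : 0 <= alpha^-1 by rewrite invr_ge0 ltW.
have Nle : N%:R <= alpha^-1 by have := floor_le alpha^-1; rewrite hN.
have N0 : (0 < N)%N.
  have : 1 < (Num.floor alpha^-1 + 1)%:~R :> R.
    by apply: le_lt_trans (floorD1_gt _); rewrite invf_ge1.
  by rewrite hN; case: (N) => //; rewrite add0r ltxx.
have b0 : 0 < beta by apply: le_lt_trans b1; rewrite subr_ge0.
have b01 : 0 < beta <= 1 by rewrite b0.
have Na : N%:R * alpha <= 1 by rewrite -ler_pdivlMr // div1r.
have eta1 : 1 < (N%:R + beta) * alpha by rewrite -ltr_pdivrMr // div1r -ltrBlDl.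
have finite := rem_norm_finite b01 hlip hhol a0 Na.
have absorb := rem_norm_absorb hsigma N0 b01 hlip hhol a0 eta1.
have N1 : (0 < 1 <= N)%N by [].
have lN l : (2 <= l < N.+1)%N -> (0 < l <= N)%N by case/andP=> l2 ?; rewrite (ltnW l2).
have alphaE : alpha = 1%:R * alpha by rewrite mul1r.
have weighted (Kf e : tree d -> R) : (forall tau, 0 <= Kf tau * e tau) -> forall l,
    \sum_(tau <- trees_eq d l) Kf tau * e tau <=
    \sum_(tau <- trees_eq d l) (tree_size tau)%:R * (Kf tau * e tau).
  by move=> Ke l; apply: ler_sum => tau _; rewrite ler_peMl // ler1n tree_size_gt0.
have Ke0 (K : tree d -> R) Z tau : 0 <= `|K tau| * enorm (Upsilon sigma tau (Z 0)).
  by rewrite mulr_ge0 ?enorm_ge0.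
split.
- move=> T x X T0 [_ Xr _].
  have [K K0 XK] := rough_tree_bound Xr.
  have Th1 : 1 <= Num.max 1 (T `^ alpha) by rewrite le_max lexx.
  have [C C0 HC] := last_rem_bound hsigma N0 b01 hlip hhol a0 eta1 K0 Th1.
  exists (C + 1); first exact: ltr_wpDl.
  move=> mu Z mu0 Zd; have [a [a_ge0 aE aP]] := finite _ _ _ _ T0 mu0 Xr Zd.
  have [S1 aS] := max1_sum_ge N a_ge0; set S := _ + _ in S1 aS.
  have S0 : 0 <= S := le_trans ler01 S1.
  rewrite {2}alphaE aE // (eq_big_nat _ _ (fun l h => aE l (lN l h))) sumEFin -EFin_max -EFinD -EFinM.
  apply/rem_norm_leP => s t s_ge0 st tT tmu.
  apply: le_trans (HC T X Z mu S mu0 Xr Zd XK _ S0 (or_introl S1) _ s t s_ge0 st tT tmu) _.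
  + rewrite le_max; apply/orP; right; apply: ge0_ler_powR; rewrite ?nnegrE ?ge_min ?lexx //.
    * exact: ltW.
    * by rewrite le_min !ltW.
    * exact: ltW.
  + by move=> l lN'; apply/aP => //; exact: aS.
  by rewrite ler_wpM2r ?powR_ge0 // ler_wpM2l ?expR_ge0 // ler_wpM2r // lerDl.
- move=> K; have [e e0 He] := absorb (fun tau => `|K tau|) (fun tau => normr_ge0 _).
  exists e => // T x X T0 [_ Xr _] XK mu Z mu0 mue Zd.
  have KE tau : (tree_size tau <= N)%N -> `|K tau| = K tau.
    by move=> tN; rewrite ger0_norm // -lee_fin -XK // rp_norm_ge0.
  have XB : tree_bound N alpha (fun tau => `|K tau|) T X.
    by apply: rp_norm_tree_bound => // tau tN; rewrite KE // XK.
  have [a [a_ge0 aE aP]] := finite _ _ _ _ T0 mu0 Xr Zd.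
  have [S1 aS] := max1_sum_ge N a_ge0; have S0 := le_trans ler01 S1.
  have [delta [delta0 Ndelta] ale] := He _ _ _ _ _ _ T0 mu0 mue Xr Zd XB (or_introl S1) aP aS S0.
  have {Ndelta} Sle := max1_sum_absorb N0 delta0 Ndelta ale.
  rewrite {1}alphaE aE // (eq_big_nat _ _ (fun l h => aE l (lN l h))) sumEFin -EFin_max -EFinD.
  rewrite (eq_bigr (fun i => (`|K (bullet i)| * enorm (Upsilon sigma (bullet i) (Z 0)))%:E)); last first.
    by move=> i _; rewrite mulrC EFinM XK ?KE // tree_size_node forest_size_mset0.
  rewrite (@fsbig_trees_EFin _ _ N (fun tau => 2 <= tree_size tau)%N _
    (fun tau => (tree_size tau)%:R * (`|K tau| * enorm (Upsilon sigma tau (Z 0))))); last first.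
    by move=> tau tN; rewrite XK // -EFinM KE //; congr EFin; ring.
  rewrite sumEFin -EFin_max -EFinD -EFinM lee_fin.
  apply: le_trans Sle _; rewrite ler_pM2l // big_trees_eq1 lerD2l sum_trees_ge2 //.
  apply: ler_sum => l _; apply: weighted; exact: Ke0.
- move=> beta1 K; have [e e0 He] := absorb (fun tau => `|K tau|) (fun tau => normr_ge0 _).
  exists e => // T x X T0 [_ Xr _] XK mu Z mu0 mue Zd.
  have KE tau : (tree_size tau <= N)%N -> `|K tau| = K tau.
    by move=> tN; rewrite ger0_norm // -lee_fin -XK // rp_norm_ge0.
  have XB : tree_bound N alpha (fun tau => `|K tau|) T X.
    by apply: rp_norm_tree_bound => // tau tN; rewrite KE // XK.
  have [a [a_ge0 aE aP]] := finite _ _ _ _ T0 mu0 Xr Zd.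
  have S0 : 0 <= \sum_(1 <= l < N.+1) a l by apply: sumr_ge0.
  have [delta [delta0 Ndelta] ale] := He _ _ _ _ _ _ T0 mu0 mue Xr Zd XB (or_intror beta1) aP
    (fun l => sum_ge a_ge0) S0.
  have {Ndelta} Sle := sum_absorb Ndelta ale.
  rewrite (eq_big_nat _ _ (F2 := fun l => (a l)%:E)) ?sumEFin; last by move=> l; rewrite ltnS => /aE.
  rewrite (@fsbig_trees_EFin _ _ N xpredT _
    (fun tau => (tree_size tau)%:R * (`|K tau| * enorm (Upsilon sigma tau (Z 0))))); last first.
    by move=> tau tN; rewrite XK // -EFinM KE //; congr EFin; ring.
  rewrite -EFinM lee_fin; apply: le_trans Sle _; rewrite ler_pM2l // big_trees_le.
  rewrite big_add1 big_mkord; apply: ler_sum => l _; apply: weighted; exact: Ke0.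
Qed.
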